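(* Assume: (Smoothness) for each $i\in\{1,\dots,n\}$, $f_i$ is differentiable in $u$ and in $v_i$, $\nabla_u f_i(u,v_i)$ is $L_u$-Lipschitz in $u$ and $L_{uv}$-Lipschitz in $v_i$, $\nabla_v f_i(u,v_i)$ is $L_v$-Lipschitz in $v_i$ and $L_{vu}$-Lipschitz in $u$; put $L=\max\{L_u,L_v,L_{uv},L_{vu}\}$. (Stochastic gradients) for each $i$ and all $u,v_i$, $\mathbb{E}[\nabla_u F(u,v_i;\xi_i)]=\nabla_u f_i(u,v_i)$, $\mathbb{E}[\nabla_v F(u,v_i;\xi_i)]=\nabla_v f_i(u,v_i)$, $\mathbb{E}\|\nabla_u F(u,v_i;\xi_i)-\nabla_u f_i(u,v_i)\|^2\le\sigma_u^2$ and $\mathbb{E}\|\nabla_v F(u,v_i;\xi_i)-\nabla_v f_i(u,v_i)\|^2\le\sigma_v^2$. Run Scaffold-P for $T$ rounds with $\eta_u\ge\sqrt m$, $\eta_v\ge\sqrt{n/m}$ and $$\gamma=\Big(72LK\max\big(\tfrac{n^{2/3}}{m},1\big)+\sqrt{\tfrac{37LKT}{F_0}\big(\tfrac{\sigma_u^2}{m}+\tfrac{m\sigma_v^2}{n}\big)}\Big)^{-1},$$ where $\gamma=\gamma_u\eta_u=\gamma_v\eta_v$. Then $$\frac1T\sum_{t=0}^{T-1}\big(\mathcal G_u^t+\hat{\mathcal G}_{\mathbf v}^t\big)\le8\sqrt{\frac{37LF_0}{KT}\Big(\frac{\sigma_u^2}{m}+\frac{\sigma_v^2m}{n}\Bi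g)}+\frac{288LF_0}{T}\max\Big(1,\frac{n^{2/3}}{m}\Big).$$
   Context: Problem: $n$ clients, shared variable $u\in\mathbb R^{d_u}$, personal variables $\mathbf v=[v_1;\dots;v_n]$, $v_i\in\mathbb R^{d_v}$; $f_i(u,v_i)=\mathbb E_{\xi_i\sim\mathcal D_i}[F(u,v_i;\xi_i)]$ and $f(u,\mathbf v)=\frac1n\sum_{i=1}^n f_i(u,v_i)$. $\nabla_u,\nabla_v$ are the partial gradients in the first and second argument; $\|\cdot\|$ is Euclidean. Scaffold-P algorithm: parameters $T\ge1$ rounds, $K\ge1$ local steps, $1\le m\le n$, step sizes $\gamma_u,\gamma_v,\eta_u,\eta_v>0$ satisfying $\gamma_u\eta_u=\gamma_v\eta_v=:\gamma$; deterministic initial point $(u^0,\mathbf v^0)$; $c_i^0=\frac1K\sum_{k=0}^{K-1}\nabla_uF(u^0,v_i^0;\xi_{i,k}^{-1})$, $c^0=\frac1n\sum_{i=1}^nc_i^0$. In each round $t=0,\dots,T-1$: draw $\mathcal S^t\subset\{1,\dots,n\}$ uniformly at random among subsets of size $m$. Each $i\in\mathcal S^t$ sets $u_{i,0}^t=u^t$, $v_{i,0}^t=v_i^t$, and for $k=0,\dots,K-1$ performs $u_{i,k+1}^t=u_{i,k}^t-\gamma_u(\nabla_uF(u_{i,k}^t,v_{i,k}^t;\xi_{i,k}^t)-c_i^t+c^t)$, $v_{i,k+1}^t=v_{i,k}^t-\gamma_v\nabla_vF(u_{i,k}^t,v_{i,k}^t;\xi_{i,k}^t)$; then $v_i^{t+1}=(1-\eta_v)v_i^t+\eta_vv_{i,K}^t$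 and $c_i^{t+1}=c_i^t-c^t+\frac1{K\gamma_u}(u^t-u_{i,K}^t)$. For $i\notin\mathcal S^t$, $v_i^{t+1}=v_i^t$ and $c_i^{t+1}=c_i^t$. Finally $u^{t+1}=(1-\eta_u)u^t+\frac{\eta_u}m\sum_{i\in\mathcal S^t}u_{i,K}^t$ and $c^{t+1}=c^t+\frac1n\sum_{i\in\mathcal S^t}(c_i^{t+1}-c_i^t)$. All samples $\xi_{i,k}^t\sim\mathcal D_i$ ($t\ge-1$) and all sets $\mathcal S^t$ are mutually independent. Notation: $\mathcal G_u^t=\mathbb E\|\nabla_uf(u^t,\mathbf v^t)\|^2$, $\hat{\mathcal G}_{\mathbf v}^t=\frac{m}{n^2}\sum_{i=1}^n\mathbb E\|\nabla_vf_i(u^t,v_i^t)\|^2$, $F_0=f(u^0,\mathbf v^0)-\inf_{u,\mathbf v}f(u,\mathbf v)$. Assume $L>0$ and $0<F_0<\infty$. *)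

(* Defs.v *)
From HB Require Import structures.
From mathcomp Require Import all_boot all_order all_algebra.
From mathcomp Require Import all_classical all_reals all_analysis.

Set Implicit Arguments.
Unset Strict Implicit.
Unset Printing Implicit Defensive.

Import Order.TTheory GRing.Theory Num.Theory.
Import numFieldNormedType.Exports.

Local Open Scope classical_set_scope.
Local Open Scope ring_scope.

(* The norm carried by the normed module 'rV[R]_d is the sup norm, hence this
   definition. The topology, and so [differentiable], is the same. *)
Definition enorm {R : realType} {d : nat} (x : 'rV[R]_d) : R :=
  Num.sqrt (\sum_j x 0 j ^+ 2).

(* The vector of partial derivatives; see gradientE. *)
Definition gradient {R : realType} {d : nat} (g : 'rV[R]_d -> R)
    (x : 'rV[R]_d) : 'rV[R]_d :=
  \row_j 'D_(delta_mx 0 j) g x.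

Lemma gradientE (R : realType) (d : nat) (g : 'rV[R]_d -> R) (x h : 'rV[R]_d) :
  differentiable g x -> 'd g x h = \sum_j gradient g x 0 j * h 0 j.
Proof.
move=> dg; rewrite {1}(row_sum_delta h) linear_sum /=.
by apply: eq_bigr => j _; rewrite linearZ /= /gradient mxE deriveE // mulrC.
Qed.

Definition grad_u {R : realType} {du dv : nat} {X : Type}
    (F : 'rV[R]_du -> 'rV[R]_dv -> X -> R)
    (u : 'rV[R]_du) (v : 'rV[R]_dv) (x : X) : 'rV[R]_du :=
  gradient (fun u' => F u' v x) u.

Definition grad_v {R : realType} {du dv : nat} {X : Type}
    (F : 'rV[R]_du -> 'rV[R]_dv -> X -> R)
    (u : 'rV[R]_du) (v : 'rV[R]_dv) (x : X) : 'rV[R]_dv :=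
  gradient (fun v' => F u v' x) v.

Definition floc {R : realType} {n du dv : nat} {dX : measure_display}
    {X : measurableType dX} (D : 'I_n -> probability X R)
    (F : 'rV[R]_du -> 'rV[R]_dv -> X -> R)
    (i : 'I_n) (u : 'rV[R]_du) (v : 'rV[R]_dv) : R :=
  fine 'E_(D i)[F u v].

Definition fglob {R : realType} {n du dv : nat} {dX : measure_display}
    {X : measurableType dX} (D : 'I_n -> probability X R)
    (F : 'rV[R]_du -> 'rV[R]_dv -> X -> R)
    (u : 'rV[R]_du) (v : 'I_n -> 'rV[R]_dv) : R :=
  n%:R^-1 * \sum_(i < n) floc D F i u (v i).

(* Joint measurability in (u, v, x): R^d gets its Borel sigma-algebra as the
   product sigma-algebra of d.-tuple R, since 'rV[R]_d has none. *)
Definition jointly_measurable {R : realType} {du dv d : nat}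
    {dX : measure_display} {X : measurableType dX}
    (G : 'rV[R]_du -> 'rV[R]_dv -> X -> 'rV[R]_d) : Prop :=
  forall j : 'I_d, measurable_fun [set: (du.-tuple R * dv.-tuple R) * X]
    (fun p : (du.-tuple R * dv.-tuple R) * X =>
       G (\row_k tnth p.1.1 k) (\row_k tnth p.1.2 k) p.2 0 j).

Record state (R : realType) (n du dv : nat) := State {
  st_u : 'rV[R]_du;
  st_v : 'I_n -> 'rV[R]_dv;
  st_c : 'rV[R]_du;
  st_ci : 'I_n -> 'rV[R]_du
}.

Section ScaffoldP.
Context {R : realType} {n du dv : nat} {X : Type}.
Variable F : 'rV[R]_du -> 'rV[R]_dv -> X -> R.
Variables (m K : nat) (gamma_u gamma_v eta_u eta_v : R).

(* (u_{i,k}, v_{i,k}) from the start (u, v), the correction ci - c and the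
   samples x 0, x 1, ... of one client in one round *)
Fixpoint local_steps (u : 'rV[R]_du) (v : 'rV[R]_dv) (ci c : 'rV[R]_du)
    (x : nat -> X) (k : nat) : 'rV[R]_du * 'rV[R]_dv :=
  if k is k'.+1 then
    let: (uk, vk) := local_steps u v ci c x k' in
    (uk - gamma_u *: (grad_u F uk vk (x k') - ci + c),
     vk - gamma_v *: grad_v F uk vk (x k'))
  else (u, v).

Definition scaffoldP_round (S : {set 'I_n}) (x : 'I_n -> nat -> X)
    (s : state R n du dv) : state R n du dv :=
  let c := st_c s in
  let loc i := local_steps (st_u s) (st_v s i) (st_ci s i) c (x i) K in
  let ci' i := if i \in S
    then st_ci s i - c + (K%:R * gamma_u)^-1 *: (st_u s - (loc i).1)
    else st_ci s i in
  {| st_u := (1 - eta_u) *: st_u s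
             + (eta_u / m%:R) *: \sum_(i in S) (loc i).1;
     st_v := fun i => if i \in S
             then (1 - eta_v) *: st_v s i + eta_v *: (loc i).2
             else st_v s i;
     st_c := c + n%:R^-1 *: \sum_(i in S) (ci' i - st_ci s i);
     st_ci := ci' |}.

Definition scaffoldP_init (u0 : 'rV[R]_du) (v0 : 'I_n -> 'rV[R]_dv)
    (x : 'I_n -> nat -> X) : state R n du dv :=
  let ci i := K%:R^-1 *: \sum_(k < K) grad_u F u0 (v0 i) (x i k) in
  {| st_u := u0; st_v := v0;
     st_c := n%:R^-1 *: \sum_(i < n) ci i; st_ci := ci |}.

(* Sample times are shifted by one: x 0 holds the samples used to initialise
   the control variates (time -1), and x t.+1 those of round t. *)
Fixpoint scaffoldP (u0 : 'rV[R]_du) (v0 : 'I_n -> 'rV[R]_dv)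
    (x : nat -> 'I_n -> nat -> X) (S : nat -> {set 'I_n}) (t : nat) :
    state R n du dv :=
  if t is t'.+1
  then scaffoldP_round (S t') (x t) (scaffoldP u0 v0 x S t')
  else scaffoldP_init u0 v0 (x 0).

End ScaffoldP.

(* Mutual independence of the families of events E j. *)
Definition mutually_independent {R : realType} {dO : measure_display}
    {Omega : measurableType dO} (P : probability Omega R) {J : finType}
    (E : J -> set (set Omega)) : Prop :=
  forall (B : {set J}) (A : J -> set Omega),
    (forall j, j \in B -> E j (A j)) ->
    P (\bigcap_(j in [set` B]) A j) = (\prod_(j in B) P (A j))%E.

Definition uniform_subset {R : realType} {dO : measure_display}
    {Omega : measurableType dO} (P : probability Omega R) {n : nat} (m : nat)
    (S : Omega -> {set 'I_n}) : Prop :=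
  forall A : {set 'I_n}, measurable (S @^-1` [set A]) /\
    P (S @^-1` [set A]) =
      (if #|A| == m then ('C(n, m)%:R)^-1 else 0 : R)%:E.

(* The events generated by each sample (with times shifted as in scaffoldP)
   and by each set of participating clients, for a run of T rounds. *)
Definition run_events {R : realType} {dO dX : measure_display}
    {Omega : measurableType dO} {X : measurableType dX}
    (P : probability Omega R) {n : nat} (K T : nat)
    (xi : nat -> 'I_n -> nat -> {RV P >-> X})
    (S : nat -> Omega -> {set 'I_n})
    (j : ('I_T.+1 * 'I_n * 'I_K) + 'I_T) : set (set Omega) :=
  match j with
  | inl (s, i, k) => preimage_set_system setT (xi s i k) measurable
  | inr t => preimage_set_system setT (S t) setT
  end.

(* Main.v *)
(**
The control variate c_i of client i estimates the gradient at u~_i, the shared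
variable when i last took part.  Let a_i be c_i with its sampling noise removed,
so that E|c_i - a_i|^2 <= sigma_u^2/K, and measure the staleness by
  Y = (1/n) sum_i (L^2 E|u - u~_i|^2 + E|grad_u f_i(u~_i, v_i) - a_i|^2).
With V = sigma_u^2/m + m sigma_v^2/n and A = 60 L (gamma K)^2 n/m^2, the expected
one-round bound on f(u,v) plus A Y decreases by
  (gamma K/4) (|grad_u f|^2 + (m/n^2) sum_i |grad_v f_i|^2) - 37 L gamma^2 K V.
Here a non-participating client keeps its staleness, a participating one resets
it, hence Y contracts by 1 - m/(4n) up to the movement of u; the condition
gamma K L <= 1/(72 max(n^(2/3)/m, 1)) is what makes A times this movement small.
As Y vanishes initially, summing over the rounds and inserting gamma gives the
rate.

The mean and variance of a stochastic gradient are taken at a point that depends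
on the other samples only; by independence one may integrate over the new sample
with that point frozen.  The values of f along the run need not be integrable: the
descent inequality is used pathwise, and only its quadratic right-hand side is
integrated.
*)
Require Import Defs.
From HB Require Import structures.
From mathcomp Require Import all_boot all_order all_algebra.
From mathcomp Require Import all_classical all_reals all_analysis.
From mathcomp Require Import measurable_realfun ring lra.

Set Implicit Arguments.
Unset Strict Implicit.
Unset Printing Implicit Defensive.

Import Order.TTheory GRing.Theory Num.Theory.
Import numFieldNormedType.Exports.

Local Open Scope classical_set_scope.
Local Open Scope ring_scope.

(** * Freezing all samples but one *)

(** Expected squares are squared norms in a space of square-integrable vectors, so one round becomes
    a statement about abstract inner product spaces. There a stochastic gradient enters only through
    its variance and its orthogonality to vectors that do not use its sample, and the client set
    only through the finite average [avgS]. The probabilistic work left is to know which quantities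
    avoid a given sample or set; [othersType] records this. The obstacle is the cross term between
    the lag u - u~_i and the step of u. A plain Young inequality would put a factor n/m on the whole
    expected squared step, noise included. Averaging the cross term over the sets first leaves only
    the mean step, so n/m falls on |avg pa|^2 alone, which the descent inequality supplies with a
    negative sign. This costs a bound on (gamma K L)^3 n^2/m^3, the source of the exponent 2/3. The
    weight 60 makes the gain from contraction, 15 L (gamma K)^2 Y/m, exceed the 12 L (gamma K)^2 Y/m
    caused by the step of u, with room for the drift. *)

Section Independence.
Context {R : realType} {dO : measure_display} {Omega : measurableType dO}.
Variables (P : probability Omega R) (J : finType) (E : J -> set (set Omega)).
Hypothesis indE : mutually_independent P E.
Hypothesis setIE : forall j, setI_closed (E j).
Hypothesis setTE : forall j, E j setT.
Hypothesis measE : forall j, E j `<=` measurable.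

(** One event from each remaining family: a pi-system on which mutual independence applies directly.
    As each family contains [setT], intersections over fewer families are included. *)
Definition others (j0 : J) : set (set Omega) :=
  [set A | exists2 C : J -> set Omega, forall j, E j (C j) &
           A = \bigcap_(j in [set` [set~ j0]%SET]) C j].

(* A copy of the sample space carrying the sigma-algebra generated by all the
   [E j] but [E j0]. *)
Definition othersType (j0 : J) := g_sigma_algebraType (others j0).

HB.instance Definition _ j0 := Measurable.on (othersType j0).

Lemma others_setI j0 : setI_closed (others j0).
Proof.
move=> _ _ [C EC ->] [C' EC' ->]; exists (fun j => C j `&` C' j).
  by move=> j; exact: setIE.
by rewrite -bigcapI.
Qed.

Lemma others_measurable j0 : others j0 `<=` measurable.
Proof.
move=> _ [C EC ->].
by apply: fin_bigcap_measurable => [|j _]; [exact: finite_finset|exact: measE].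
Qed.

Lemma others_subset j0 j : j != j0 -> E j `<=` others j0.
Proof.
move=> jj0 A EA; exists (fun j' => if j' == j then A else setT).
  by move=> j'; case: eqP => [->|_].
apply/seteqP; split => [w Aw j' _|w /(_ j)].
  by case: eqP.
by rewrite eqxx; apply; rewrite /= !inE.
Qed.

Lemma others_sub_measurable j0 (A : set Omega) :
  (others j0).-sigma.-measurable A -> measurable A.
Proof.
apply: smallest_sub; first exact: sigma_algebra_measurable.
exact: others_measurable.
Qed.

Lemma measurable_fun_others d (T : measurableType d) j0 (f : Omega -> T) :
  measurable_fun [set: othersType j0] f -> measurable_fun setT f.
Proof.
move=> mf _ B mB; have := mf measurableT B mB.
exact: others_sub_measurable.
Qed.

(** Restricting [P] to [B] and scaling [P] by the mass of [B] give two finite measures that agree on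
    the pi-system [others j0], hence on the sigma-algebra it generates. *)
Lemma others_indep j0 (A B : set Omega) :
  (others j0).-sigma.-measurable A -> E j0 B ->
  P (A `&` B) = (P A * P B)%E.
Proof.
move=> mA EB; have mB := measE EB.
have PBfin : (0 <= fine (P B))%R by exact: fine_ge0.
pose m1 : {measure set Omega -> \bar R} := mrestr P mB.
pose m2 : {measure set Omega -> \bar R} := mscale (NngNum PBfin) P.
suff : m1 A = m2 A.
  rewrite /m1 /m2 /= /mrestr /mscale /= => ->.
  by rewrite fineK ?fin_num_measure// muleC.
apply: (g_sigma_algebra_measure_unique (others j0) (@others_measurable j0)
  (fun=> setT)) => //.
- by move=> _; exists (fun=> setT) => //; rewrite bigcapT.
- by apply/seteqP; split => // w _; exists 0%N.
- exact: others_setI.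
- move=> _ [C EC ->]; rewrite /m1 /m2 /= /mrestr /mscale /=.
  rewrite fineK ?fin_num_measure//.
  rewrite indE; last by [].
  pose C' j := if j == j0 then B else C j.
  have -> : \bigcap_(j in [set` [set~ j0]%SET]) C j `&` B =
            \bigcap_(j in [set` [set: J]%SET]) C' j.
    apply/seteqP; split => [w [Cw Bw] j _|w Cw].
      by rewrite /C'; case: eqP => // /eqP jj0; apply: Cw; rewrite /= !inE.
    split; last by have := Cw j0; rewrite /C' eqxx; apply; rewrite /= inE.
    move=> j; rewrite /= !inE => jj0.
    by have := Cw j; rewrite /C' (negbTE jj0); apply; rewrite /= inE.
  rewrite indE; last first.
    by move=> j _; rewrite /C'; case: eqP => // ->.
  rewrite (bigD1 j0) ?inE//= /C' eqxx; congr (_ * _)%E.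
  apply: eq_big => [j|j]; first by rewrite !inE.
  by move=> /andP[_ /negbTE ->].
- by move=> _; rewrite /m1 /= /mrestr setTI; apply: le_lt_trans (probability_le1 _ _) (ltry _).
Qed.

(** On rectangles this is [others_indep], and rectangles determine the product measure. *)
Lemma others_joint_law j0 d1 d2 (T1 : measurableType d1) (T2 : measurableType d2)
    (Y : {RV P >-> T1}) (x : {RV P >-> T2})
    (mYx : measurable_fun setT (fun w => (Y w, x w))) :
  measurable_fun [set: othersType j0] Y ->
  (forall B, measurable B -> E j0 (x @^-1` B)) ->
  forall C, measurable C ->
    (distribution P Y \x distribution P x)%E C
    = pushforward P (fun w => (Y w, x w)) C.
Proof.
move=> mY Ex.
pose m' : {measure set (T1 * T2) -> \bar R} :=
  distribution P (mfun_Sub (mem_set mYx)).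
apply: (@product_measure_unique _ _ _ _ _ _ _ m') => A B mA mB.
rewrite /m' /distribution /= /pushforward /=.
rewrite -(@others_indep j0); last exact: Ex.
  by [].
by have := mY measurableT A mA; rewrite setTI.
Qed.

Section Freezing.
Variables (j0 : J) (d1 d2 : measure_display).
Variables (T1 : measurableType d1) (T2 : measurableType d2).
Variables (Y : Omega -> T1) (x : {RV P >-> T2}).
Hypothesis mY : measurable_fun [set: othersType j0] Y.
Hypothesis Ex : forall B, measurable B -> E j0 (x @^-1` B).

Let mYO : measurable_fun setT Y. Proof. exact: measurable_fun_others mY. Qed.
Let Y' : {RV P >-> T1} := mfun_Sub (mem_set mYO).

Let mYx : measurable_fun setT (fun w => (Y w, x w)).
Proof. by apply: measurable_fun_pair => //. Qed.

Let joint : {RV P >-> (T1 * T2)%type} := mfun_Sub (mem_set mYx).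

Let joint_integral (phi : T1 * T2 -> \bar R) :
  (\int[distribution P Y' \x distribution P x]_z phi z
   = \int[distribution P joint]_z phi z)%E.
Proof.
apply: eq_measure_integral => A mA _.
exact: (@others_joint_law j0 _ _ _ _ Y' x mYx).
Qed.

(* Stands in for conditioning on [Y]. *)
Lemma ge0_integral_freeze (phi : T1 * T2 -> \bar R) :
  measurable_fun [set: T1 * T2] phi -> (forall z, 0 <= phi z)%E ->
  (\int[P]_w phi (Y w, x w)
   = \int[P]_w \int[distribution P x]_z phi (Y w, z))%E.
Proof.
move=> mphi phi0.
transitivity (\int[distribution P joint]_z phi z)%E.
  by rewrite ge0_integral_distribution.
rewrite -joint_integral fubini_tonelli1 //.
rewrite ge0_integral_distribution //; last by move=> y; exact: integral_ge0.
exact: measurable_fun_fubini_tonelli_F.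
Qed.

(** For signed integrands Fubini replaces Tonelli. Integrability passes from [P] to the product
    measure because the latter is the joint law. *)
Lemma integral_freeze (phi : T1 * T2 -> \bar R) :
  measurable_fun [set: T1 * T2] phi -> P.-integrable setT (fun w => phi (Y w, x w)) ->
  (\int[P]_w phi (Y w, x w)
   = \int[P]_w \int[distribution P x]_z phi (Y w, z))%E.
Proof.
move=> mphi iphi.
have iprod : (distribution P Y' \x distribution P x)%E.-integrable [set: T1 * T2] phi.
  apply/integrableP; split => //.
  rewrite joint_integral ge0_integral_distribution //.
    by case/integrableP : iphi.
  exact: measurableT_comp.
transitivity (\int[distribution P joint]_z phi z)%E.
  by rewrite integral_distribution.
have [mF Foo] := integrableP _ _ _ (integrable_fubini_F iprod).
rewrite -joint_integral -integral12_prod_meas1 // integral_distribution //.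
apply/integrableP; split; first exact: measurableT_comp.
by rewrite ge0_integral_distribution // in Foo; exact: measurableT_comp.
Qed.

End Freezing.

End Independence.

(** * Square-integrable random vectors *)

Section Dot.
Context {R : realType} {d : nat}.
Implicit Types x y z : 'rV[R]_d.

Definition dot x y : R := \sum_j x 0 j * y 0 j.
Definition sqn x : R := dot x x.

Lemma dotC x y : dot x y = dot y x.
Proof. by apply: eq_bigr => j _; rewrite mulrC. Qed.

Lemma dotDl x y z : dot (x + y) z = dot x z + dot y z.
Proof. by rewrite -big_split /=; apply: eq_bigr => j _; rewrite mxE mulrDl. Qed.

Lemma dotZl a x y : dot (a *: x) y = a * dot x y.
Proof. by rewrite mulr_sumr; apply: eq_bigr => j _; rewrite mxE mulrA. Qed.

Lemma dotDr x y z : dot z (x + y) = dot z x + dot z y.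
Proof. by rewrite !(dotC z) dotDl. Qed.

Lemma dotZr a x y : dot y (a *: x) = a * dot y x.
Proof. by rewrite !(dotC y) dotZl. Qed.

Lemma dotNl x y : dot (- x) y = - dot x y.
Proof. by rewrite -scaleN1r dotZl mulN1r. Qed.

Lemma dotNr x y : dot y (- x) = - dot y x.
Proof. by rewrite !(dotC y) dotNl. Qed.

Lemma dot0l y : dot 0 y = 0.
Proof. by rewrite -(scale0r 0) dotZl mul0r. Qed.

Lemma sqn_ge0 x : 0 <= sqn x.
Proof. by apply: sumr_ge0 => j _; rewrite -expr2 sqr_ge0. Qed.

Lemma sqn0 : sqn 0 = 0. Proof. exact: dot0l. Qed.

Lemma sqnZ a x : sqn (a *: x) = a ^+ 2 * sqn x.
Proof. by rewrite /sqn dotZl dotZr mulrA. Qed.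

Lemma sqnN x : sqn (- x) = sqn x.
Proof. by rewrite /sqn dotNl dotNr opprK. Qed.

Lemma sqnD x y : sqn (x + y) = sqn x + 2 * dot x y + sqn y.
Proof. by rewrite /sqn dotDl !dotDr (dotC y x); ring. Qed.

Lemma sqnD_le x y : sqn (x + y) <= 2 * sqn x + 2 * sqn y.
Proof.
have := sqn_ge0 (x - y); rewrite !sqnD sqnN dotNr; lra.
Qed.

Lemma dot_abs_le x y : `|dot x y| <= sqn x + sqn y.
Proof.
have := sqn_ge0 (x - y); have := sqn_ge0 (x + y).
have := sqn_ge0 x; have := sqn_ge0 y.
rewrite !sqnD sqnN dotNr ler_norml => *; apply/andP; split; lra.
Qed.

Lemma enorm_sqn x : enorm x ^+ 2 = sqn x.
Proof.
rewrite /enorm sqr_sqrtr; first by apply: eq_bigr => j _; rewrite expr2.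
by apply: sumr_ge0 => j _; rewrite sqr_ge0.
Qed.

Lemma enorm_ge0 x : 0 <= enorm x. Proof. exact: sqrtr_ge0. Qed.

Lemma coord_sqr_le x j : x 0 j ^+ 2 <= sqn x.
Proof.
rewrite /sqn /dot (bigD1 j) //= -expr2 lerDl.
by apply: sumr_ge0 => k _; rewrite -expr2 sqr_ge0.
Qed.

Lemma dot_le_enorm x y : dot x y <= enorm x * enorm y.
Proof.
have [x0|x0] := eqVneq (enorm x) 0.
  have sx0 : sqn x = 0 by rewrite -enorm_sqn x0 expr0n.
  have -> : x = 0.
    apply/rowP => j; rewrite mxE; apply/eqP; rewrite -sqrf_eq0 eq_le sqr_ge0.
    by rewrite andbT -sx0 coord_sqr_le.
  by rewrite dot0l mulr_ge0 // enorm_ge0.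
have ex : 0 < enorm x by rewrite lt0r x0 enorm_ge0.
(* Expanding gives 2 |x| |y| (|x| |y| - dot x y) >= 0. The factor |x| |y| has to be cancelled, hence
   the separate treatment of zero norms. *)
have := sqn_ge0 (enorm y *: x - enorm x *: y).
rewrite sqnD sqnN !sqnZ dotNr dotZl dotZr -!enorm_sqn => h.
have [y0|y0] := eqVneq (enorm y) 0.
  have sy0 : sqn y = 0 by rewrite -enorm_sqn y0 expr0n.
  have -> : y = 0.
    apply/rowP => j; rewrite mxE; apply/eqP; rewrite -sqrf_eq0 eq_le sqr_ge0.
    by rewrite andbT -sy0 coord_sqr_le.
  by rewrite dotC dot0l mulr_ge0 // enorm_ge0.
have ey : 0 < enorm y by rewrite lt0r y0 enorm_ge0.
have exy : 0 < enorm x * enorm y by rewrite mulr_gt0.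
rewrite -(ler_pM2l exy); nra.
Qed.

End Dot.

Section VectorMeasurability.
Context {R : realType} {dY : measure_display} {Y : measurableType dY}.

Definition mvec d (f : Y -> 'rV[R]_d) : Prop :=
  forall j, measurable_fun setT (fun w => f w 0 j).

Lemma mvec_cst d (c : 'rV[R]_d) : mvec (fun=> c).
Proof. by move=> j; exact: measurable_cst. Qed.

Lemma mvecD d (f g : Y -> 'rV[R]_d) :
  mvec f -> mvec g -> mvec (fun w => f w + g w).
Proof.
move=> mf mg j; under eq_fun do rewrite mxE.
by apply: measurable_funD; [exact: mf|exact: mg].
Qed.

Lemma mvecZ d a (f : Y -> 'rV[R]_d) : mvec f -> mvec (fun w => a *: f w).
Proof.
move=> mf j; under eq_fun do rewrite mxE.
by apply: measurable_funM => //; exact: mf.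
Qed.

Lemma mvecB d (f g : Y -> 'rV[R]_d) :
  mvec f -> mvec g -> mvec (fun w => f w - g w).
Proof.
move=> mf mg; apply: mvecD => // j.
rewrite (_ : (fun w => _) = fun w => (-1 *: g w) 0 j); first exact: mvecZ.
by apply/funext => w; rewrite scaleN1r.
Qed.

Lemma mvec_sum d (I : Type) (r : seq I) (Q : pred I) (f : I -> Y -> 'rV[R]_d) :
  (forall i, Q i -> mvec (f i)) -> mvec (fun w => \sum_(i <- r | Q i) f i w).
Proof.
move=> mf j; under eq_fun do rewrite summxE.
under eq_fun do rewrite big_mkcond /=.
by apply: measurable_sum => i; case: (Q i) (mf i) => [/(_ isT)|_].
Qed.

Lemma measurable_dot d (f g : Y -> 'rV[R]_d) :
  mvec f -> mvec g -> measurable_fun setT (fun w => dot (f w) (g w)).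
Proof.
move=> mf mg; apply: measurable_sum => j.
by apply: measurable_funM; [exact: mf|exact: mg].
Qed.

Lemma measurable_tuple_of d (f : Y -> 'rV[R]_d) :
  mvec f -> measurable_fun setT (fun w => [tuple f w 0 j | j < d]).
Proof.
move=> mf; apply/measurable_fun_tnthP => j /=.
rewrite (_ : _ \o _ = fun w => f w 0 j); first exact: mf.
by apply/funext => w /=; rewrite tnth_mktuple.
Qed.

Lemma mvec_if d (I : eqType) (h : Y -> I) (k : I) (f g : Y -> 'rV[R]_d) :
  measurable (h @^-1` [set k]) -> mvec f -> mvec g ->
  mvec (fun w => if h w == k then f w else g w).
Proof.
move=> mh mf mg j.
rewrite (_ : (fun w => _) =
    (fun w => if h w == k then f w 0 j else g w 0 j)); last first.
  by apply/funext => w; case: ifP.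
apply: measurable_fun_ifT; [|exact: mf|exact: mg].
apply: (measurable_fun_bool true) => //.
rewrite setTI (_ : _ @^-1` _ = h @^-1` [set k]) //.
by apply/seteqP; split => w /= => [/eqP|->]; rewrite ?eqxx.
Qed.

End VectorMeasurability.

Section L2.
Context {R : realType} {dO : measure_display} {Omega : measurableType dO}.
Variable (P : probability Omega R).

Definition L2 d (f : Omega -> 'rV[R]_d) : Prop :=
  mvec f /\ P.-integrable setT (fun w => (sqn (f w))%:E).

Lemma L2_dominated d (f : Omega -> 'rV[R]_d) (h : Omega -> R) :
  mvec f -> (forall w, sqn (f w) <= h w) ->
  P.-integrable setT (fun w => (h w)%:E) -> L2 f.
Proof.
move=> mf fh ih; split=> //; apply: le_integrable ih => //.
  by apply/measurable_EFinP; exact: measurable_dot.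
by move=> w _ /=; rewrite lee_fin !ger0_norm ?sqn_ge0 // (le_trans (sqn_ge0 (f w))).
Qed.

Lemma integrable_scale a (h : Omega -> R) :
  P.-integrable setT (fun w => (h w)%:E) ->
  P.-integrable setT (fun w => (a * h w)%:E).
Proof. by move=> ih; under eq_fun do rewrite EFinM; exact: integrableZl. Qed.

Lemma integrable_add (h h' : Omega -> R) :
  P.-integrable setT (fun w => (h w)%:E) ->
  P.-integrable setT (fun w => (h' w)%:E) ->
  P.-integrable setT (fun w => (h w + h' w)%:E).
Proof. by move=> ih ih'; under eq_fun do rewrite EFinD; exact: integrableD. Qed.

Lemma integrable_cstR (c : R) : P.-integrable setT (fun=> c%:E).
Proof. exact: finite_measure_integrable_cst. Qed.

Lemma L2_cst d (c : 'rV[R]_d) : L2 (fun=> c).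
Proof.
apply: (L2_dominated (h := fun=> sqn c)) => //; exact: integrable_cstR.
Qed.

Lemma L2D d (f g : Omega -> 'rV[R]_d) : L2 f -> L2 g -> L2 (fun w => f w + g w).
Proof.
move=> [mf jf] [mg jg].
apply: (L2_dominated (h := fun w => 2 * sqn (f w) + 2 * sqn (g w))).
- exact: mvecD.
- by move=> w; exact: sqnD_le.
- by apply: integrable_add; exact: integrable_scale.
Qed.

Lemma L2Z d a (f : Omega -> 'rV[R]_d) : L2 f -> L2 (fun w => a *: f w).
Proof.
move=> [mf jf]; apply: (L2_dominated (h := fun w => a ^+ 2 * sqn (f w))).
- exact: mvecZ.
- by move=> w; rewrite sqnZ.
- exact: integrable_scale.
Qed.

Lemma L2B d (f g : Omega -> 'rV[R]_d) : L2 f -> L2 g -> L2 (fun w => f w - g w).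
Proof.
move=> lf lg; have := L2D lf (L2Z (-1) lg).
by under [X in L2 X -> _]eq_fun do rewrite scaleN1r.
Qed.

Lemma L2_sum d (I : Type) (r : seq I) (Q : pred I) (f : I -> Omega -> 'rV[R]_d) :
  (forall i, Q i -> L2 (f i)) -> L2 (fun w => \sum_(i <- r | Q i) f i w).
Proof.
move=> lf; elim: r => [|i r IH].
  by under eq_fun do rewrite big_nil; exact: L2_cst.
under eq_fun do rewrite big_cons.
by case: (Q i) (lf i) => [/(_ isT) li|_] //; exact: L2D.
Qed.

Lemma integrable_dot d (f g : Omega -> 'rV[R]_d) :
  L2 f -> L2 g -> P.-integrable setT (fun w => (dot (f w) (g w))%:E).
Proof.
move=> [mf jf] [mg jg]; apply: le_integrable (integrable_add jf jg) => //.
  by apply/measurable_EFinP; exact: measurable_dot.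
move=> w _ /=; rewrite lee_fin [leRHS]ger0_norm ?addr_ge0 ?sqn_ge0 //.
exact: dot_abs_le.
Qed.

Definition L2pred d : {pred (Omega -> 'rV[R]_d)} := [pred f | `[< L2 f >]].

Arguments L2pred : clear implicits.

Lemma L2predP d (f : Omega -> 'rV[R]_d) : reflect (L2 f) (f \in L2pred d).
Proof. exact: asboolP. Qed.

Lemma L2_submod_closed d : submod_closed (L2pred d).
Proof.
split=> [|a f g /L2predP lf /L2predP lg]; apply/L2predP; first exact: L2_cst.
by apply: (@L2D _ (fun w => a *: f w)) => //; exact: L2Z.
Qed.

HB.instance Definition _ d :=
  GRing.isSubmodClosed.Build _ _ (L2pred d) (@L2_submod_closed d).

Record L2v d := MkL2v { L2val :> Omega -> 'rV[R]_d; L2val_in : L2val \in L2pred d }.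

HB.instance Definition _ d := [isSub for @L2val d].
HB.instance Definition _ d := [Choice of L2v d by <:].
HB.instance Definition _ d := [SubChoice_isSubLmodule of L2v d by <:].

End L2.

(* The form is only semidefinite: the vectors of [L2v] are functions, not classes
   modulo almost-everywhere equality. *)
Record ipSpace (R : realFieldType) := IpSpace {
  ip_sort :> lmodType R;
  ip : ip_sort -> ip_sort -> R;
  ipC : forall x y, ip x y = ip y x;
  ipDl : forall x y z, ip (x + y) z = ip x z + ip y z;
  ipZl : forall a x y, ip (a *: x) y = a * ip x y;
  ip_ge0 : forall x, 0 <= ip x x }.

Section InnerProduct.
Context {R : realFieldType} {E : ipSpace R}.
Implicit Types x y z : E.

Definition nsq x : R := ip x x.

Lemma nsq_ge0 x : 0 <= nsq x. Proof. exact: ip_ge0. Qed.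

Lemma ipDr x y z : ip z (x + y) = ip z x + ip z y.
Proof. by rewrite !(ipC z) ipDl. Qed.

Lemma ipZr a x y : ip x (a *: y) = a * ip x y.
Proof. by rewrite !(ipC x) ipZl. Qed.

Lemma ip0l x : ip 0 x = 0. Proof. by rewrite -(scale0r 0) ipZl mul0r. Qed.

Lemma ip0r x : ip x 0 = 0. Proof. by rewrite ipC ip0l. Qed.

Lemma ipNl x y : ip (- x) y = - ip x y.
Proof. by rewrite -scaleN1r ipZl mulN1r. Qed.

Lemma ipNr x y : ip x (- y) = - ip x y.
Proof. by rewrite !(ipC x) ipNl. Qed.

Lemma ip_suml (I : Type) (r : seq I) (Q : pred I) (f : I -> E) y :
  ip (\sum_(i <- r | Q i) f i) y = \sum_(i <- r | Q i) ip (f i) y.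
Proof. by apply: (big_morph (fun x : E => ip x y)) => [a b|]; [exact: ipDl|exact: ip0l]. Qed.

Lemma ip_sumr (I : Type) (r : seq I) (Q : pred I) (f : I -> E) y :
  ip y (\sum_(i <- r | Q i) f i) = \sum_(i <- r | Q i) ip y (f i).
Proof. by rewrite ipC ip_suml; apply: eq_bigr => i _; exact: ipC. Qed.

Lemma nsqZ a x : nsq (a *: x) = a ^+ 2 * nsq x.
Proof. by rewrite /nsq ipZl ipZr mulrA. Qed.

Lemma nsqN x : nsq (- x) = nsq x.
Proof. by rewrite /nsq ipNl ipNr opprK. Qed.

Lemma nsq0 : nsq 0 = 0. Proof. exact: ip0l. Qed.

Lemma nsqD x y : nsq (x + y) = nsq x + 2 * ip x y + nsq y.
Proof. by rewrite /nsq ipDl !ipDr (ipC y x); ring. Qed.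

Lemma nsqB x y : nsq (x - y) = nsq x - 2 * ip x y + nsq y.
Proof. by rewrite nsqD ipNr nsqN; ring. Qed.

Lemma nsqBC x y : nsq (x - y) = nsq (y - x).
Proof. by rewrite -nsqN opprB. Qed.

Lemma nsqD_le x y : nsq (x + y) <= 2 * nsq x + 2 * nsq y.
Proof. have := nsq_ge0 (x - y); rewrite !nsqD ipNr nsqN; lra. Qed.

Lemma nsqD3_le x y z : nsq (x + y + z) <= 3 * (nsq x + nsq y + nsq z).
Proof.
have := nsq_ge0 (x - y); have := nsq_ge0 (x - z); have := nsq_ge0 (y - z).
rewrite !nsqD !ipNr !nsqN ipDl; lra.
Qed.

Lemma ip_polar x y : ip x y = (nsq x + nsq y - nsq (x - y)) / 2.
Proof. rewrite nsqB; lra. Qed.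

Lemma ip_young b x y : 0 < b -> 2 * ip x y <= b * nsq x + b^-1 * nsq y.
Proof.
move=> b0; have := nsq_ge0 (b *: x - y).
rewrite nsqB nsqZ ipZl => h; rewrite -(ler_pM2l b0) mulrDr mulVKf ?gt_eqF //; nra.
Qed.

(** Variance decomposition: the centred vectors sum to zero, so their cross term with [y]
    vanishes. *)
Lemma avg_nsq_shift (I : finType) (x : I -> E) y :
  (0 < #|I|)%N ->
  let a : R := (#|I|%:R)^-1 in
  let xb := a *: \sum_i x i in
  a * \sum_i nsq (x i - xb + y) = nsq y + a * (\sum_i nsq (x i)) - nsq xb.
Proof.
move=> I0 a xb.
have n0 : (#|I|%:R : R) != 0 by rewrite pnatr_eq0 -lt0n.
have hs : \sum_i x i = #|I|%:R *: xb by rewrite scalerA mulfV // scale1r.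
have -> : \sum_i nsq (x i - xb + y) = \sum_i nsq (x i)
    + 2 * ip (\sum_i x i) (y - xb) + #|I|%:R * nsq (y - xb).
  rewrite ip_suml mulr_sumr -big_split /= mulr_natl -sumr_const -big_split /=.
  by apply: eq_bigr => i _; rewrite -nsqD; congr nsq; rewrite addrAC addrA.
rewrite hs ipZl nsqB ipDr ipNr (ipC xb y) -/(nsq xb) /a; field.
exact: n0.
Qed.

Lemma nsq_avg_le (I : finType) (x : I -> E) :
  (0 < #|I|)%N -> nsq (#|I|%:R^-1 *: \sum_i x i) <= #|I|%:R^-1 * \sum_i nsq (x i).
Proof.
move=> I0; have := avg_nsq_shift x 0 I0; rewrite /= nsq0 add0r => h.
rewrite -subr_ge0 -h mulr_ge0 ?invr_ge0 ?ler0n // sumr_ge0 // => i _.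
exact: nsq_ge0.
Qed.

Lemma nsq_sum_le (I : finType) (x : I -> E) :
  nsq (\sum_i x i) <= #|I|%:R * \sum_i nsq (x i).
Proof.
have [I0|I0] := posnP #|I|.
  rewrite !big_pred0 ?nsq0 ?mulr0 // => i;
  by have := fintype0 i I0.
have n0 : (0 : R) < #|I|%:R by rewrite ltr0n.
have := nsq_avg_le x I0; rewrite nsqZ.
rewrite -(ler_pM2l (exprn_gt0 2 n0)) mulrA -exprMn mulfV ?gt_eqF // expr1n mul1r.
by rewrite expr2 -!mulrA mulVKf ?gt_eqF.
Qed.

Lemma nsq_orthogonal_sum (I : finType) (A : pred I) (x : I -> E) :
  (forall i j, i != j -> ip (x i) (x j) = 0) ->
  nsq (\sum_(i in A) x i) = \sum_(i in A) nsq (x i).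
Proof.
move=> ox; rewrite /nsq ip_suml; apply: eq_bigr => i Ai.
rewrite ip_sumr (bigD1 i) //= big1 ?addr0 // => j /andP[_ ji].
by rewrite ox // eq_sym.
Qed.

Lemma nsq_avg_orthogonal_le (I : finType) (x : I -> E) s : (0 < #|I|)%N ->
  (forall i j, i != j -> ip (x i) (x j) = 0) -> (forall i, nsq (x i) <= s) ->
  nsq (#|I|%:R^-1 *: \sum_i x i) <= s / #|I|%:R.
Proof.
move=> I0 ox xs; have IR : (0 : R) < #|I|%:R by rewrite ltr0n.
rewrite nsqZ (nsq_orthogonal_sum xpredT ox).
have -> : s / #|I|%:R = #|I|%:R^-1 ^+ 2 * \sum_(i : I) s.
  by rewrite sumr_const -[s *+ _]mulr_natl; field; rewrite gt_eqF.
by rewrite ler_wpM2l ?sqr_ge0 // ler_sum.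
Qed.

End InnerProduct.

Section L2Space.
Context {R : realType} {dO : measure_display} {Omega : measurableType dO}.
Context {P : probability Omega R} {d : nat}.
Implicit Types x y z : L2v P d.

(** Total by sending functions that are not square-integrable to 0; every faithful use therefore
    goes through [toL2K] with a proof of [L2]. *)
Definition toL2 (f : Omega -> 'rV[R]_d) : L2v P d := insubd (0 : L2v P d) f.

Lemma toL2K (f : Omega -> 'rV[R]_d) : L2 P f -> toL2 f = f :> (Omega -> 'rV[R]_d).
Proof. by move=> lf; rewrite -[LHS]/(val _) insubdK //; apply/L2predP. Qed.

Lemma L2_val x : L2 P x.
Proof. by apply/L2predP; case: x. Qed.

Lemma L2v_ext x y : (forall w, x w = y w) -> x = y.
Proof. by move=> xy; apply: val_inj; apply/funext. Qed.

Lemma L2vD x y w : (x + y) w = x w + y w. Proof. by []. Qed.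
Lemma L2vN x w : (- x) w = - x w. Proof. by []. Qed.
Lemma L2vZ a x w : (a *: x) w = a *: x w. Proof. by []. Qed.
Lemma L2v0 w : (0 : L2v P d) w = 0. Proof. by []. Qed.

Lemma L2v_sum (I : Type) (r : seq I) (Q : pred I) (f : I -> L2v P d) w :
  (\sum_(i <- r | Q i) f i) w = \sum_(i <- r | Q i) f i w.
Proof. exact: (big_morph (fun x : L2v P d => x w) (fun _ _ => erefl)). Qed.

Definition L2vE := (L2vD, L2vN, L2vZ, L2v0, L2v_sum).

Definition L2_ip x y : R := (\int[P]_w (dot (x w) (y w)))%R.

Lemma L2_ipC x y : L2_ip x y = L2_ip y x.
Proof. by apply: eq_Rintegral => w _; rewrite dotC. Qed.

Lemma L2_ipDl x y z : L2_ip (x + y) z = L2_ip x z + L2_ip y z.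
Proof.
rewrite /L2_ip -RintegralD //; last 2 first.
- exact: integrable_dot (L2_val _) (L2_val _).
- exact: integrable_dot (L2_val _) (L2_val _).
by apply: eq_Rintegral => w _; rewrite -dotDl.
Qed.

Lemma L2_ipZl a x y : L2_ip (a *: x) y = a * L2_ip x y.
Proof.
rewrite /L2_ip -RintegralZl //; last exact: integrable_dot (L2_val _) (L2_val _).
by apply: eq_Rintegral => w _; rewrite -dotZl.
Qed.

Lemma L2_ip_ge0 x : 0 <= L2_ip x x.
Proof. by apply: Rintegral_ge0 => w _; exact: sqn_ge0. Qed.

Definition L2space : ipSpace R := IpSpace L2_ipC L2_ipDl L2_ipZl L2_ip_ge0.

Lemma toL2D (f g : Omega -> 'rV[R]_d) : L2 P f -> L2 P g ->
  toL2 (fun w => f w + g w) = toL2 f + toL2 g.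
Proof. by move=> lf lg; apply: L2v_ext => w; rewrite !L2vE !toL2K //; exact: L2D. Qed.

Lemma toL2Z a (f : Omega -> 'rV[R]_d) : L2 P f ->
  toL2 (fun w => a *: f w) = a *: toL2 f.
Proof. by move=> lf; apply: L2v_ext => w; rewrite !L2vE !toL2K //; exact: L2Z. Qed.

Lemma toL2B (f g : Omega -> 'rV[R]_d) : L2 P f -> L2 P g ->
  toL2 (fun w => f w - g w) = toL2 f - toL2 g.
Proof. by move=> lf lg; apply: L2v_ext => w; rewrite !L2vE !toL2K //; exact: L2B. Qed.

Lemma toL2_sum (I : Type) (r : seq I) (Q : pred I) (f : I -> Omega -> 'rV[R]_d) :
  (forall i, Q i -> L2 P (f i)) ->
  toL2 (fun w => \sum_(i <- r | Q i) f i w) = \sum_(i <- r | Q i) toL2 (f i).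
Proof.
move=> lf; apply: L2v_ext => w; rewrite L2vE toL2K; last exact: L2_sum.
by apply: eq_bigr => i Qi; rewrite toL2K //; exact: lf.
Qed.

Lemma ip_toL2 (f g : Omega -> 'rV[R]_d) : L2 P f -> L2 P g ->
  L2_ip (toL2 f) (toL2 g) = (\int[P]_w dot (f w) (g w))%R.
Proof. by move=> lf lg; apply: eq_Rintegral => w _; rewrite !toL2K. Qed.

End L2Space.

Arguments toL2 {R dO Omega} P {d} f.
Arguments L2space {R dO Omega} P d.

(** Integrates pointwise Lipschitz bounds. Three dimensions occur, since one gradient is controlled
    by increments of both u and v. *)
Lemma nsq_le2 (R : realType) (dO : measure_display) (Omega : measurableType dO)
    (P : probability Omega R) d d1 d2 (x : L2v P d) (y : L2v P d1)
    (z : L2v P d2) (a b : R) :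
  (forall w, sqn (x w) <= a * sqn (y w) + b * sqn (z w)) ->
  L2_ip x x <= a * L2_ip y y + b * L2_ip z z.
Proof.
move=> xyz; rewrite /L2_ip.
have iy := integrable_dot (L2_val y) (L2_val y).
have iz := integrable_dot (L2_val z) (L2_val z).
have iay := integrable_scale a iy; have ibz := integrable_scale b iz.
rewrite -(RintegralZl a measurableT iy) -(RintegralZl b measurableT iz).
rewrite -(RintegralD measurableT iay ibz).
apply: le_Rintegral => // [||w _]; last exact: xyz.
  exact: integrable_dot (L2_val x) (L2_val x).
exact: integrable_add.
Qed.

Lemma Rintegral_sum (R : realType) (d : measure_display) (T : measurableType d)
    (mu : {measure set T -> \bar R}) (I : Type) (r : seq I) (f : I -> T -> R) :
  (forall i, mu.-integrable setT (fun w => (f i w)%:E)) ->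
  (\int[mu]_w (\sum_(i <- r) f i w) = \sum_(i <- r) \int[mu]_w f i w)%R.
Proof.
move=> jf; rewrite /Rintegral; under eq_integral do rewrite -sumEFin.
rewrite integral_sum // -sum_fine // => i _; exact: integrable_fin_num.
Qed.

(** * Averages over the client sets *)

Section SubsetAverage.
Context {R : realFieldType} (n m : nat).
Hypothesis hm : (0 < m <= n)%N.

Let m0 : (0 < m)%N. Proof. by case/andP: hm. Qed.
Let mn : (m <= n)%N. Proof. by case/andP: hm. Qed.
Let n0 : (0 < n)%N. Proof. exact: leq_trans mn. Qed.

Definition avgS (F : {set 'I_n} -> R) : R :=
  ('C(n, m)%:R)^-1 * \sum_(A : {set 'I_n} | #|A| == m) F A.

Lemma avgSD F G : avgS (fun A => F A + G A) = avgS F + avgS G.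
Proof. by rewrite /avgS big_split mulrDr. Qed.

Lemma avgSZ a F : avgS (fun A => a * F A) = a * avgS F.
Proof. by rewrite /avgS -mulr_sumr mulrCA. Qed.

Lemma avgS_sum (I : Type) (r : seq I) (F : I -> {set 'I_n} -> R) :
  avgS (fun A => \sum_(i <- r) F i A) = \sum_(i <- r) avgS (F i).
Proof. by rewrite /avgS exchange_big /= mulr_sumr. Qed.

Lemma eq_avgS_in F G : (forall A : {set 'I_n}, #|A| = m -> F A = G A) ->
  avgS F = avgS G.
Proof.
by move=> FG; rewrite /avgS; congr (_ * _); apply: eq_bigr => A /eqP; exact: FG.
Qed.

Lemma eq_avgS F G : F =1 G -> avgS F = avgS G.
Proof. by move=> FG; apply: eq_avgS_in => A _; exact: FG. Qed.

Lemma le_avgS F G : (forall A : {set 'I_n}, #|A| = m -> F A <= G A) ->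
  avgS F <= avgS G.
Proof.
move=> FG; rewrite /avgS ler_wpM2l ?invr_ge0 ?ler0n //.
by apply: ler_sum => A /eqP; exact: FG.
Qed.

(** Union with [I] is a bijection onto these sets from the subsets of size [m - #|I|] of the
    complement of [I]. *)
Lemma card_draws_superset (I : {set 'I_n}) : (#|I| <= m)%N ->
  #|[set A : {set 'I_n} | (I \subset A) && (#|A| == m)]%SET|
  = 'C(n - #|I|, m - #|I|).
Proof.
move=> Im; have <- : #|~: I| = (n - #|I|)%N.
  by rewrite cardsCs finset.setCK card_ord.
rewrite -cards_draws.
rewrite -[RHS](card_in_imset (f := fun B => B :|: I)); last first.
  move=> B C; rewrite !inE => /andP[BI _] /andP[CI _] BC.
  have restr (D : {set 'I_n}) : D \subset ~: I -> D = (D :|: I) :\: I.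
    move=> DI; apply/setP => i; rewrite !inE.
    by have := fintype.subsetP DI i; rewrite inE; case: (i \in I); case: (i \in D) => // /(_ isT).
  by rewrite (restr _ BI) BC -restr.
apply: eq_card => A.  rewrite inE; apply/andP/imsetP.
  move=> [IA /eqP Am]; exists (A :\: I); last first.
    apply/setP => i; rewrite !inE.
    by have := fintype.subsetP IA i; case: (i \in I); case: (i \in A) => // /(_ isT).
  rewrite !inE cardsD (finset.setIidPr IA) Am eqxx andbT.
  by apply/fintype.subsetP => i; rewrite !inE => /andP[].
move=> [B]; rewrite !inE => /andP[BI /eqP Bm] ->.
rewrite finset.subsetUr; split=> //; rewrite cardsU Bm.
have -> : B :&: I = finset.set0.
  apply/setP => i; rewrite !inE.
  by have := fintype.subsetP BI i; rewrite inE; case: (i \in I); case: (i \in B) => // /(_ isT).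
by rewrite cards0 subn0 subnK.
Qed.

Let Cnm_neq0 : ('C(n, m)%:R : R) != 0.
Proof. by rewrite pnatr_eq0 -lt0n bin_gt0. Qed.

Let nR0 : (n%:R : R) != 0. Proof. by rewrite pnatr_eq0 -lt0n. Qed.

Lemma avgS_cst c : avgS (fun=> c) = c.
Proof.
rewrite /avgS sumr_const -[c *+ _]mulr_natl mulrA.
rewrite (_ : #|_| = #|[set A : {set 'I_n} | #|A| == m]%SET|); last first.
  by apply: eq_card => A; rewrite !inE.
by rewrite card_draws card_ord mulVf // mul1r.
Qed.

Lemma avgS_superset (I : {set 'I_n}) : (#|I| <= m)%N ->
  avgS (fun A => (I \subset A)%:R) = 'C(n - #|I|, m - #|I|)%:R / 'C(n, m)%:R.
Proof.
move=> Im; rewrite /avgS mulrC -(card_draws_superset Im); congr (_ / _).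
rewrite -sum1_card natr_sum big_mkcond /= [RHS]big_mkcond /=.
apply: eq_bigr => A _; rewrite !inE.
by case: (_ == _); case: (_ \subset _).
Qed.

Lemma avgS_in1 i : avgS (fun A => (i \in A)%:R) = m%:R / n%:R.
Proof.
have -> : avgS (fun A => (i \in A)%:R) = avgS (fun A => ([set i]%SET \subset A)%:R).
  by apply: eq_avgS => A; rewrite finset.sub1set.
rewrite avgS_superset cards1 // !subn1; apply/eqP.
rewrite eqr_div // -!natrM eqr_nat mulnC.
by have := mul_bin_diag n m.-1; rewrite prednK // => ->.
Qed.

Lemma avgS_in2 i j : i != j ->
  avgS (fun A => ((i \in A) && (j \in A))%:R)
    = (m%:R * (m%:R - 1)) / (n%:R * (n%:R - 1)).
Proof.
move=> ij; have n2 : (1 < n)%N.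
  have := max_card (mem [set i; j]%SET); rewrite card_ord cards2 ij //.
have -> : avgS (fun A => ((i \in A) && (j \in A))%:R)
    = avgS (fun A => ([set i; j]%SET \subset A)%:R).
  by apply: eq_avgS => A; rewrite finset.subUset !finset.sub1set.
have [m1|m2] := leqP m 1.
  have -> : m = 1%N by apply/eqP; rewrite eqn_leq m1.
  rewrite subrr mulr0 mul0r /avgS big1 ?mulr0 // => A /eqP A1.
  case: (boolP (_ \subset _)) => // /subset_leq_card; rewrite cards2 ij.
  by move=> h; have := leq_trans h (eq_leq A1); rewrite ltnNge m1.
rewrite avgS_superset cards2 ij //= !subn2.
have n1R : (n%:R - 1 : R) != 0.
  by rewrite -[1]/(1%:R) -natrB 1?ltnW // pnatr_eq0 subn_eq0 -ltnNge.
apply/eqP; rewrite eqr_div ?mulf_neq0 //.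
rewrite -[1]/(1%:R) -!natrB // -!natrM eqr_nat !subn1.
have := mul_bin_diag n m.-1; rewrite prednK // => h1.
have := mul_bin_diag n.-1 m.-2; rewrite prednK -?subn1 ?subn_gt0 // !subn1 => h2.
by rewrite mulnCA (mulnC 'C(_, _)) h2 mulnCA h1 mulnCA mulnA.
Qed.

Lemma avgS_sum_in (x : 'I_n -> R) :
  avgS (fun A => \sum_(i in A) x i) = m%:R / n%:R * \sum_i x i.
Proof.
transitivity (avgS (fun A => \sum_i x i * (i \in A)%:R)).
  apply: eq_avgS => A; rewrite big_mkcond; apply: eq_bigr => i _.
  by case: ifP; rewrite ?mulr1 ?mulr0.
rewrite avgS_sum mulr_sumr; apply: eq_bigr => i _.
by rewrite avgSZ avgS_in1 mulrC.
Qed.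

(** Two distinct clients are drawn together with probability [q], which is at most (m/n)^2: draws
    without replacement are negatively correlated. Expanding the square gives an exact formula, of
    which both coefficients are then bounded. *)
Lemma avgS_nsq_sum (E : ipSpace R) (x : 'I_n -> E) :
  avgS (fun A => nsq (\sum_(i in A) x i))
  <= m%:R ^+ 2 / n%:R ^+ 2 * nsq (\sum_i x i) + m%:R / n%:R * \sum_i nsq (x i).
Proof.
set q : R := (m%:R * (m%:R - 1)) / (n%:R * (n%:R - 1)).
have m1 : (1 : R) <= m%:R by rewrite ler1n.
have mnR : (m%:R : R) <= n%:R by rewrite ler_nat.
have q0 : 0 <= q by rewrite divr_ge0 // mulr_ge0 ?ler0n // ?subr_ge0 // (le_trans m1).
(* For n = 1 the denominator of [q] is 0, so [q] is 0 by convention; the exact formula below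
   survives as there are no distinct pairs. *)
have qle : q <= m%:R ^+ 2 / n%:R ^+ 2.
  have [n1|n1] := eqVneq n 1%N.
    by rewrite /q n1 subrr mulr0 invr0 mulr0 divr_ge0 // exprn_ge0 ?ler0n.
  have n2 : (2 : R) <= n%:R by rewrite ler_nat ltn_neqAle eq_sym n1.
  have nn1 : 0 < n%:R * (n%:R - 1) :> R by apply: mulr_gt0; lra.
  rewrite /q ler_pdivrMr //.
  have -> : m%:R ^+ 2 / n%:R ^+ 2 * (n%:R * (n%:R - 1))
      = m%:R * (m%:R * (n%:R - 1) / n%:R) :> R by field.
  rewrite ler_wpM2l ?ler0n // ler_pdivlMr ?ltr0n //; nra.
have -> : avgS (fun A => nsq (\sum_(i in A) x i))
    = q * nsq (\sum_i x i) + (m%:R / n%:R - q) * \sum_i nsq (x i).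
  transitivity (avgS (fun A => \sum_i \sum_j ip (x i) (x j) *
      ((i \in A) && (j \in A))%:R)).
    apply: eq_avgS => A; rewrite /nsq ip_suml big_mkcond; apply: eq_bigr => i _.
    case: (i \in A) => /=; last by rewrite big1 // => j _; rewrite mulr0.
    rewrite ip_sumr big_mkcond; apply: eq_bigr => j _.
    by case: ifP; rewrite ?mulr1 ?mulr0.
  rewrite avgS_sum {1}/nsq ip_suml mulr_sumr mulr_sumr -big_split /=.
  apply: eq_bigr => i _; rewrite avgS_sum ip_sumr.
  rewrite (bigD1 i) //= [X in q * X](bigD1 i) //=.
  rewrite (eq_bigr (fun j => q * ip (x i) (x j))); last first.
    by move=> j ji; rewrite avgSZ avgS_in2 1?eq_sym // mulrC.
  rewrite -mulr_sumr avgSZ (eq_avgS (G := fun A => (i \in A)%:R)); last first.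
    by move=> A; rewrite andbb.
  by rewrite avgS_in1 -/(nsq (x i)); ring.
rewrite lerD // ler_wpM2r ?nsq_ge0 ?sumr_ge0 // => [i _|]; first exact: nsq_ge0.
by rewrite gerBl.
Qed.

End SubsetAverage.

(** * One round in an abstract inner product space *)

Section Drift.
Context {R : realFieldType}.

(** The displacement is a sum of noises, which grows like k rather than k^2 in squared norm, plus a
    sum of mean directions [p l + c], compared with the initial direction [g + c]. The deviation [S]
    is itself governed by the drift and is left open here. *)
Lemma steps_drift (E : ipSpace R) (K : nat) (step su : R) (S : R) (x p G : nat -> E)
    (g c : E) :
  (forall k, (k < K)%N -> x k.+1 = x k - step *: (G k + c)) ->
  (forall k, (k <= K)%N -> nsq (\sum_(l < k) (G l - p l)) <= k%:R * su) ->
  0 <= su -> \sum_(l < K) nsq (p l - g) <= S ->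
  forall k, (k <= K)%N ->
  nsq (x k - x 0%N) <= step ^+ 2 *
    (2 * K%:R * su + 4 * K%:R * S + 4 * K%:R ^+ 2 * nsq (g + c)).
Proof.
move=> hx hN su0 hS k kK.
have -> : x k - x 0%N
    = - step *: (\sum_(l < k) (G l - p l) + \sum_(l < k) (p l + c)).
  rewrite -big_split /=; elim: k kK => [|k IH] kK.
    by rewrite subrr big_ord0 scaler0.
  rewrite big_ord_recr /= hx // addrAC (IH (ltnW kK)) [RHS]scalerDr; congr (_ + _).
  by rewrite scaleNr addrA subrK.
rewrite nsqZ sqrrN ler_wpM2l ?sqr_ge0 //.
apply: le_trans (nsqD_le _ _) _.
have h1 := hN k kK.
have h2 : nsq (\sum_(l < k) (p l + c)) <= k%:R * \sum_(l < k) nsq (p l + c).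
  by have := nsq_sum_le (fun l : 'I_k => p l + c); rewrite card_ord.
have h3 : \sum_(l < k) nsq (p l + c) <= \sum_(l < K) (2 * nsq (p l - g) + 2 * nsq (g + c)).
  rewrite (big_ord_widen_cond K xpredT (fun l => nsq (p l + c)) kK).
  rewrite big_mkcond /=; apply: ler_sum => l _; case: ifP => _.
    have -> : p l + c = (p l - g) + (g + c) by rewrite addrA subrK.
    exact: nsqD_le.
  by rewrite addr_ge0 // mulr_ge0 // nsq_ge0.
have kK' : (k%:R : R) <= K%:R by rewrite ler_nat.
have k0 : (0 : R) <= k%:R by rewrite ler0n.
rewrite big_split /= -mulr_sumr sumr_const card_ord -mulr_natl in h3.
have h4 : k%:R * \sum_(l < k) nsq (p l + c) <= K%:R * (2 * S + K%:R * (2 * nsq (g + c))).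
  apply: ler_pM => //; first by rewrite sumr_ge0 // => l _; exact: nsq_ge0.
  lra.
have h5 : k%:R * su <= K%:R * su by rewrite ler_wpM2r.
rewrite expr2; lra.
Qed.

(** Closes the circle left by [steps_drift]: the gradient deviations are bounded by the average
    drift, which then bounds itself. Both variables must be treated together because each gradient
    feels both drifts. *)
Lemma client_drift (E E' : ipSpace R) (K : nat) (L gu gv su sv : R)
    (x p G : nat -> E) (y q H : nat -> E')
    (g c : E) (b : E') :
  (0 < K)%N ->
  (forall k, (k < K)%N -> x k.+1 = x k - gu *: (G k + c)) ->
  (forall k, (k < K)%N -> y k.+1 = y k - gv *: H k) ->
  (forall k, (k <= K)%N -> nsq (\sum_(l < k) (G l - p l)) <= k%:R * su) ->
  (forall k, (k <= K)%N -> nsq (\sum_(l < k) (H l - q l)) <= k%:R * sv) ->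
  0 <= su -> 0 <= sv ->
  let D k := nsq (x k - x 0%N) + nsq (y k - y 0%N) in
  (forall k, (k < K)%N -> nsq (p k - g) <= 2 * L ^+ 2 * D k) ->
  (forall k, (k < K)%N -> nsq (q k - b) <= 2 * L ^+ 2 * D k) ->
  8 * L ^+ 2 * K%:R ^+ 2 * (gu ^+ 2 + gv ^+ 2) <= 1 / 5 ->
  K%:R^-1 * \sum_(k < K) D k <=
    5 * (gu ^+ 2 * K%:R ^+ 2 * (su / K%:R + nsq (g + c))
         + gv ^+ 2 * K%:R ^+ 2 * (sv / K%:R + nsq b)).
Proof.
move=> K0 hx hy hNu hNv su0 sv0 D hp hq small.
have KR : (0 : R) < K%:R by rewrite ltr0n.
set X := K%:R^-1 * _.
have sD : \sum_(k < K) D k = K%:R * X by rewrite /X mulVKf // gt_eqF.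
have X0 : 0 <= X.
  by rewrite mulr_ge0 ?invr_ge0 ?ler0n // sumr_ge0 // => k _; rewrite addr_ge0 ?nsq_ge0.
have sp : \sum_(l < K) nsq (p l - g) <= 2 * L ^+ 2 * (K%:R * X).
  by rewrite -sD mulr_sumr ler_sum // => k _; exact: hp.
have sq : \sum_(l < K) nsq (q l - b) <= 2 * L ^+ 2 * (K%:R * X).
  by rewrite -sD mulr_sumr ler_sum // => k _; exact: hq.
have hy' k : (k < K)%N -> y k.+1 = y k - gv *: (H k + 0) by rewrite addr0; exact: hy.
set Bu := 2 * K%:R * su + 4 * K%:R * (2 * L ^+ 2 * (K%:R * X)) + 4 * K%:R ^+ 2 * nsq (g + c).
set Bv := 2 * K%:R * sv + 4 * K%:R * (2 * L ^+ 2 * (K%:R * X)) + 4 * K%:R ^+ 2 * nsq (b + 0).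
have : \sum_(k < K) D k <= \sum_(k < K) (gu ^+ 2 * Bu + gv ^+ 2 * Bv).
  apply: ler_sum => k _; apply: lerD.
    exact: (steps_drift hx hNu su0 sp (ltnW (ltn_ord k))).
  exact: (steps_drift hy' hNv sv0 sq (ltnW (ltn_ord k))).
rewrite sumr_const card_ord -[leRHS]mulr_natl sD ler_pM2l // /Bu /Bv addr0 => hX.
have e1 : gu ^+ 2 * K%:R ^+ 2 * (su / K%:R + nsq (g + c))
    = gu ^+ 2 * (K%:R * su) + gu ^+ 2 * (K%:R ^+ 2 * nsq (g + c)).
  by field; rewrite gt_eqF.
have e2 : gv ^+ 2 * K%:R ^+ 2 * (sv / K%:R + nsq b)
    = gv ^+ 2 * (K%:R * sv) + gv ^+ 2 * (K%:R ^+ 2 * nsq b).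
  by field; rewrite gt_eqF.
rewrite e1 e2.
have hs := ler_wpM2r X0 small.
have u1 : 0 <= gu ^+ 2 * (K%:R * su) by rewrite mulr_ge0 ?sqr_ge0 // mulr_ge0 // ler0n.
have v1 : 0 <= gv ^+ 2 * (K%:R * sv) by rewrite mulr_ge0 ?sqr_ge0 // mulr_ge0 // ler0n.
(* [X] returns with factor at most 1/5; absorbing it multiplies the rest by 5/4, and 4 times 5/4 is
   the 5 of the claim. *)
have h : X <= 2 * (gu ^+ 2 * (K%:R * su)) + 4 * (gu ^+ 2 * (K%:R ^+ 2 * nsq (g + c)))
   + 2 * (gv ^+ 2 * (K%:R * sv)) + 4 * (gv ^+ 2 * (K%:R ^+ 2 * nsq b)) + 1 / 5 * X.
  apply: le_trans hX _.
  set Z := 1 / 5 * X in hs *.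
  have -> : gu ^+ 2 * (2 * K%:R * su + 4 * K%:R * (2 * L ^+ 2 * (K%:R * X)) + 4 * K%:R ^+ 2 * nsq (g + c)) +
    gv ^+ 2 * (2 * K%:R * sv + 4 * K%:R * (2 * L ^+ 2 * (K%:R * X)) + 4 * K%:R ^+ 2 * nsq b)
   = 2 * (gu ^+ 2 * (K%:R * su)) + 4 * (gu ^+ 2 * (K%:R ^+ 2 * nsq (g + c)))
   + 2 * (gv ^+ 2 * (K%:R * sv)) + 4 * (gv ^+ 2 * (K%:R ^+ 2 * nsq b))
   + 8 * L ^+ 2 * K%:R ^+ 2 * (gu ^+ 2 + gv ^+ 2) * X by ring.
  by rewrite lerD2l.
lra.
Qed.

End Drift.

Section RoundArithmetic.
Context {R : realFieldType}.

(** Here k = gamma K, [x] is L^2 times the average drift, [Pn] and [Vq] are the squared mean steps,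
    [s] and [w] the two noise levels. The bound on [a] makes drift and curvature harmless, that on
    a^2 n/m^2 controls A L^2 times the squared steps, and that on a^3 n^2/m^3 controls the factor
    n/m in the bound for [W']. *)
Lemma round_arithmetic (k a L m n U V Pn Vq s w W Q x Du Dv ER W' Q' A : R) :
  0 < k -> 0 < L -> a = k * L -> 1 <= m -> m <= n ->
  0 <= U -> 0 <= V -> 0 <= Pn -> 0 <= Vq -> 0 <= s -> 0 <= w ->
  0 <= W -> 0 <= Q -> 0 <= x ->
  a <= 1 / 72 -> a ^+ 2 * n / m ^+ 2 <= 1 / 72 ^+ 2 ->
  a ^+ 3 * n ^+ 2 / m ^+ 3 <= 1 / 72 ^+ 3 ->
  let Y := L ^+ 2 * W + Q in
  ER <= - (k / 2) * (U + V + Pn + Vq) + 2 * k * x + L * Du + L * Dv ->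
  Du <= k ^+ 2 * (8 * s + 4 * Pn + 12 * x + 12 * Y / m) ->
  Dv <= k ^+ 2 * (2 * Vq + 2 * w) ->
  x <= 5 * a ^+ 2 * (3 * s + w + U + V + 4 * Y / m) ->
  W' <= (1 - m / n / 4) * W + 3 * Du + 4 * (n / m) * k ^+ 2 * Pn ->
  Q' <= (1 - m / n) * Q + 2 * L ^+ 2 * Dv + 4 * (m / n) * x ->
  A = 60 * k * a * n / m ^+ 2 ->
  ER + A * (L ^+ 2 * W' + Q') <= A * Y - k / 4 * (U + V) + 37 * a * k * (s + w).
Proof.
move=> k0 L0 ea m1 mn U0 V0 P0 Vq0 s0 w0 W0 Q0 x0 a1 a2 a3 Y hER hDu hDv hx hW hQ eA.
have a0 : 0 < a by rewrite ea mulr_gt0.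
have m0 : 0 < m by lra.
have n0 : 0 < n by lra.
have Y0 : 0 <= Y by rewrite addr_ge0 // mulr_ge0 // sqr_ge0.
have A0 : 0 < A by rewrite eA divr_gt0 ?exprn_gt0 // !mulr_gt0 //; lra.
pose y := Y / m.
have y0 : 0 <= y by rewrite divr_ge0 // ltW.
pose al := A * a ^+ 2.
have al0 : 0 <= al by rewrite mulr_ge0 ?sqr_ge0 // ltW.
have hal : al <= 60 / 72 ^+ 2 * (k * a).
  have -> : al = 60 * (k * a) * (a ^+ 2 * n / m ^+ 2).
    by rewrite /al eA; field; rewrite gt_eqF.
  have ka : 0 <= 60 * (k * a) by rewrite !mulr_ge0 // ltW.
  by have := ler_wpM2l ka a2; lra.
pose be := A * a ^+ 2 * (n / m).
have hbe : be <= 60 / 72 ^+ 3 * k.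
  have -> : be = 60 * k * (a ^+ 3 * n ^+ 2 / m ^+ 3).
    by rewrite /be eA; field; rewrite gt_eqF.
  have k0' : 0 <= 60 * k by rewrite !mulr_ge0 // ltW.
  by have := ler_wpM2l k0' a3; lra.
(* A quarter of this times [Y] is the gain 15 k a y. Against it stand 12 k a y from [L * Du], less
   than 2 k a y from the drift and less than k a y from [A * L ^+ 2 * Du]. *)
have Arho : A * (m / n) = 60 * (k * a / m).
  by rewrite eA; field; rewrite !gt_eqF.
have Y_ry : A * (m / n * Y) = 60 * (k * a * y).
  by rewrite mulrA Arho /y; field; rewrite gt_eqF.
have LDu : L * Du <= k * a * (8 * s + 4 * Pn + 12 * x + 12 * y).
  apply: le_trans (ler_wpM2l (ltW L0) hDu) _.
  by rewrite ea /y le_eqVlt; apply/orP; left; apply/eqP; field; rewrite gt_eqF.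
have LDv : L * Dv <= k * a * (2 * Vq + 2 * w).
  apply: le_trans (ler_wpM2l (ltW L0) hDv) _.
  by rewrite ea le_eqVlt; apply/orP; left; apply/eqP; ring.
have L2Du : A * (L ^+ 2 * Du) <= al * (8 * s + 4 * Pn + 12 * x + 12 * y).
  have -> : A * (L ^+ 2 * Du) = A * L * (L * Du) by ring.
  have AL : 0 <= A * L by rewrite mulr_ge0 // ltW.
  apply: le_trans (ler_wpM2l AL LDu) _.
  by rewrite /al ea le_eqVlt; apply/orP; left; apply/eqP; ring.
have L2Dv : A * (L ^+ 2 * Dv) <= al * (2 * Vq + 2 * w).
  have -> : A * (L ^+ 2 * Dv) = A * L * (L * Dv) by ring.
  have AL : 0 <= A * L by rewrite mulr_ge0 // ltW.
  apply: le_trans (ler_wpM2l AL LDv) _.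
  by rewrite /al ea le_eqVlt; apply/orP; left; apply/eqP; ring.
have hx' : x <= 5 * a ^+ 2 * (3 * s + w + U + V + 4 * y) by rewrite /y mulrA.
have hY' : A * (L ^+ 2 * W' + Q') <= A * Y - A * (m / n * Y) / 4
    + 3 * (A * (L ^+ 2 * Du)) + 4 * be * Pn + 2 * (A * (L ^+ 2 * Dv))
    + 4 * (A * (m / n)) * x.
  have := ler_wpM2l (mulr_ge0 (ltW A0) (sqr_ge0 L)) hW.
  have := ler_wpM2l (ltW A0) hQ.
  have : 0 <= A * (m / n) * Q by rewrite !mulr_ge0 ?invr_ge0 // ltW.
  have e : A * L ^+ 2 * (4 * (n / m) * k ^+ 2 * Pn) = 4 * be * Pn.
    by rewrite /be ea; ring.
  rewrite [A * L ^+ 2 * (_ + _)]mulrDr e /Y; lra.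
have ka0 : 0 <= k * a by rewrite mulr_ge0 // ltW.
have ka72 : k * a <= k / 72 by have := ler_wpM2l (ltW k0) a1; lra.
have kam : k * a / m <= k * a by rewrite ler_pdivrMr // -[leLHS]mulr1 ler_wpM2l.
(* Total weight of the drift: from the descent inequality, from [Du] with weights L and 3 A L^2, and
   from [Q']. The last term alone reaches 240 k / 72. *)
pose Cx := 2 * k + 12 * (k * a) + 36 * al + 4 * (A * (m / n)).
have hCx : Cx <= 6 * k by rewrite /Cx Arho; lra.
have hCxx : Cx * x <= 30 * (k * a) * a * (3 * s + w + U + V + 4 * y).
  apply: le_trans (ler_wpM2r x0 hCx) _.
  have k6 : 0 <= 6 * k by rewrite mulr_ge0 // ltW.
  apply: le_trans (ler_wpM2l k6 hx') _.
  by rewrite le_eqVlt; apply/orP; left; apply/eqP; ring.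
have kaa : k * a * a <= k * a / 72 by have := ler_wpM2l ka0 a1; lra.
have T0 : 0 <= 3 * s + w + U + V + 4 * y by lra.
have hCxx' : Cx * x <= 30 / 72 * (k * a) * (3 * s + w + U + V + 4 * y).
  apply: le_trans hCxx _; rewrite ler_wpM2r //; lra.
have kU : k * a * (U + V) <= k / 72 * (U + V) by rewrite ler_wpM2r //; lra.
have kP : k * a * Pn <= k / 72 * Pn by rewrite ler_wpM2r.
have kVq : k * a * Vq <= k / 72 * Vq by rewrite ler_wpM2r.
have ay : al * y <= 60 / 72 ^+ 2 * (k * a) * y by rewrite ler_wpM2r.
have as_ : al * s <= 60 / 72 ^+ 2 * (k * a) * s by rewrite ler_wpM2r.
have aw : al * w <= 60 / 72 ^+ 2 * (k * a) * w by rewrite ler_wpM2r.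
have aP : al * Pn <= 60 / 72 ^+ 2 * (k * a) * Pn by rewrite ler_wpM2r.
have aVq : al * Vq <= 60 / 72 ^+ 2 * (k * a) * Vq by rewrite ler_wpM2r.
have bP : be * Pn <= 60 / 72 ^+ 3 * k * Pn by rewrite ler_wpM2r.
have pos1 : 0 <= k * a * s by rewrite mulr_ge0.
have pos2 : 0 <= k * a * w by rewrite mulr_ge0.
have pos3 : 0 <= k * a * y by rewrite mulr_ge0.
have pos4 : 0 <= k * Pn by rewrite mulr_ge0 // ltW.
have pos5 : 0 <= k * Vq by rewrite mulr_ge0 // ltW.
have pos6 : 0 <= k * (U + V) by rewrite mulr_ge0 ?addr_ge0 // ltW.
rewrite Y_ry in hY'.
have fin : ER + A * (L ^+ 2 * W' + Q') <= A * Y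
  - k / 2 * (U + V + Pn + Vq) + Cx * x
  + k * a * (8 * s + 4 * Pn + 12 * y) + k * a * (2 * Vq + 2 * w)
  - 15 * (k * a * y) + 3 * (al * (8 * s + 4 * Pn + 12 * y))
  + 4 * (be * Pn) + 2 * (al * (2 * Vq + 2 * w)).
  rewrite /Cx; lra.
clear - fin hCxx' kU kP kVq ay as_ aw aP aVq bP pos1 pos2 pos3 pos4 pos5 pos6.
lra.
Qed.

End RoundArithmetic.

(* Proves a linear goal whose atoms are norms and inner products; these are
   generalized first, as otherwise [lra] compares them up to conversion. *)
Ltac norm_lra :=
  repeat match goal with H : is_true (_ <= _) |- _ => revert H end;
  repeat match goal with
  | |- context [nsq ?x] => generalize (nsq x)
  | |- context [ip ?x ?y] => generalize (ip x y)
  end;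
  repeat match goal with x := _ |- _ => clearbody x end;
  intros; lra.

Section Round.
Context {R : realFieldType} {E E' : ipSpace R}.
Variables (n m K : nat) (L gam gu gv su sv : R).
Hypotheses (hm : (0 < m <= n)%N) (hK : (0 < K)%N).
Hypotheses (L0 : 0 < L) (gam0 : 0 < gam) (su0 : 0 <= su) (sv0 : 0 <= sv).
Hypothesis hgu : gu ^+ 2 <= gam ^+ 2 / m%:R.
Hypothesis hgv : gv ^+ 2 <= gam ^+ 2 * (m%:R / n%:R).

(* [uk i k], [vk i k]: local iterates of client [i]; [G], [H]: stochastic
   gradients there, with means [p], [q]; [g], [b]: gradients at the start of the
   round; [c]: control variates, [al]: the same without noise; [z] = u - u~_i;
   [y], [y']: staleness of [al i] before the round, and after it if [i] takes
   part. *)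
Variables (uk p G : 'I_n -> nat -> E) (vk q H : 'I_n -> nat -> E').
Variables (g c al z y y' : 'I_n -> E) (b : 'I_n -> E').

Let avg (E0 : ipSpace R) (x : 'I_n -> E0) : E0 := n%:R^-1 *: \sum_i x i.
Let kavg (E0 : ipSpace R) (x : nat -> E0) : E0 := K%:R^-1 *: \sum_(k < K) x k.
Let D i k := nsq (uk i k - uk i 0%N) + nsq (vk i k - vk i 0%N).
Let e i := kavg (fun k => G i k - p i k).
Let r i := kavg (fun k => H i k - q i k).
Let pa i := kavg (p i).
Let qa i := kavg (q i).

Definition round_du (A : {set 'I_n}) : E :=
  - (gam * K%:R / m%:R) *: \sum_(i in A) (kavg (G i) + (avg c - c i)).
Definition round_dv i : E' := - (gam * K%:R) *: kavg (H i).

Hypothesis hstep_u : forall i k, (k < K)%N ->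
  uk i k.+1 = uk i k - gu *: (G i k + (avg c - c i)).
Hypothesis hstep_v : forall i k, (k < K)%N -> vk i k.+1 = vk i k - gv *: H i k.
Hypothesis hlip_u : forall i k, (k < K)%N -> nsq (p i k - g i) <= 2 * L ^+ 2 * D i k.
Hypothesis hlip_v : forall i k, (k < K)%N -> nsq (q i k - b i) <= 2 * L ^+ 2 * D i k.
Hypothesis hy : forall i, nsq (g i - al i) <= 2 * L ^+ 2 * nsq (z i) + 2 * nsq (y i).
Hypothesis hy' : forall i, nsq (y' i) <=
  2 * L ^+ 2 * nsq (round_dv i) + 2 * nsq (g i - pa i).
Hypothesis hc : forall i, nsq (c i - al i) <= su / K%:R.
Hypothesis var_u : forall i k, (k < K)%N -> nsq (G i k - p i k) <= su.
Hypothesis var_v : forall i k, (k < K)%N -> nsq (H i k - q i k) <= sv.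
Hypothesis orth_u : forall i k j l, (k < K)%N -> (l < K)%N -> (i, k) != (j, l) ->
  ip (G i k - p i k) (G j l - p j l) = 0.
Hypothesis orth_v : forall i k l, (k < K)%N -> (l < K)%N -> k != l ->
  ip (H i k - q i k) (H i l - q i l) = 0.
Hypothesis orth_g : forall i k, (k < K)%N -> ip (avg g) (G i k - p i k) = 0.
Hypothesis orth_z : forall i k, (k < K)%N -> ip (avg z) (G i k - p i k) = 0.
Hypothesis orth_b : forall i k, (k < K)%N -> ip (b i) (H i k - q i k) = 0.

Let m0 : (0 < m)%N. Proof. by case/andP: hm. Qed.
Let n0 : (0 < n)%N. Proof. by case/andP: hm => h; exact: leq_trans. Qed.
Let mR : (0 : R) < m%:R. Proof. by rewrite ltr0n. Qed.
Let nR : (0 : R) < n%:R. Proof. by rewrite ltr0n. Qed.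
Let KR : (0 : R) < K%:R. Proof. by rewrite ltr0n. Qed.
Let m1R : (1 : R) <= m%:R. Proof. by rewrite ler1n. Qed.
Let mnR : (m%:R : R) <= n%:R. Proof. by rewrite ler_nat; case/andP: hm. Qed.

Let X i := K%:R^-1 * \sum_(k < K) D i k.
Let Xb := n%:R^-1 * \sum_i X i.
Let s := su / (m%:R * K%:R).
Let w := m%:R * sv / (n%:R * K%:R).
Let U := nsq (avg g).
Let V := m%:R / n%:R ^+ 2 * \sum_i nsq (b i).
Let Pn := nsq (avg pa).
Let Vq := m%:R / n%:R ^+ 2 * \sum_i nsq (qa i).
Let W := n%:R^-1 * \sum_i nsq (z i).
Let Q := n%:R^-1 * \sum_i nsq (y i).
Let Y := L ^+ 2 * W + Q.
Let Du := avgS m (fun A => nsq (round_du A)).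
Let Dv := avgS m (fun A => n%:R^-1 * \sum_(i in A) nsq (round_dv i)).

Let kavg_split (E0 : ipSpace R) (x x' : nat -> E0) :
  kavg x = kavg x' + kavg (fun k => x k - x' k).
Proof.
rewrite /kavg -scalerDr -big_split /=; congr (_ *: _).
by apply: eq_bigr => k _; rewrite addrC subrK.
Qed.

Let kavgB (E0 : ipSpace R) (x : nat -> E0) c0 : kavg x - c0 = kavg (fun k => x k - c0).
Proof.
rewrite /kavg big_split /= sumr_const card_ord scalerDr.
by rewrite -[- c0 *+ K]scaler_nat scalerA mulVf ?gt_eqF // scale1r.
Qed.

Let nsq_kavg_le (E0 : ipSpace R) (x : nat -> E0) :
  nsq (kavg x) <= K%:R^-1 * \sum_(k < K) nsq (x k).
Proof.
by have := nsq_avg_le (fun k : 'I_K => x k); rewrite card_ord; apply.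
Qed.

Let nsq_avg_le' (E0 : ipSpace R) (x : 'I_n -> E0) :
  nsq (avg x) <= n%:R^-1 * \sum_i nsq (x i).
Proof. by have := nsq_avg_le x; rewrite card_ord; apply. Qed.

Let X_ge0 i : 0 <= X i.
Proof.
by rewrite mulr_ge0 ?invr_ge0 ?ler0n // sumr_ge0 // => k _; rewrite addr_ge0 ?nsq_ge0.
Qed.

Let Xb_ge0 : 0 <= Xb.
Proof. by rewrite mulr_ge0 ?invr_ge0 ?ler0n // sumr_ge0. Qed.

Let pag i : nsq (g i - pa i) <= 2 * L ^+ 2 * X i.
Proof.
rewrite nsqBC /pa kavgB; apply: le_trans (nsq_kavg_le _) _.
rewrite /X mulrCA ler_wpM2l ?invr_ge0 ?ler0n // mulr_sumr.
by apply: ler_sum => k _; exact: hlip_u.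
Qed.

Let qab i : nsq (b i - qa i) <= 2 * L ^+ 2 * X i.
Proof.
rewrite nsqBC /qa kavgB; apply: le_trans (nsq_kavg_le _) _.
rewrite /X mulrCA ler_wpM2l ?invr_ge0 ?ler0n // mulr_sumr.
by apply: ler_sum => k _; exact: hlip_v.
Qed.

Let noise_sum_u i k : (k <= K)%N -> nsq (\sum_(l < k) (G i l - p i l)) <= k%:R * su.
Proof.
move=> kK; rewrite (nsq_orthogonal_sum xpredT (x := fun l : 'I_k => G i l - p i l)).
  rewrite mulr_natl -[k in _ *+ k]card_ord -sumr_const; apply: ler_sum => l _.
  by apply: var_u; exact: leq_trans kK.
move=> l l' ll'; apply: orth_u; [exact: leq_trans kK|exact: leq_trans kK|].
by rewrite xpair_eqE eqxx.
Qed.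

Let noise_sum_v i k : (k <= K)%N -> nsq (\sum_(l < k) (H i l - q i l)) <= k%:R * sv.
Proof.
move=> kK; rewrite (nsq_orthogonal_sum xpredT (x := fun l : 'I_k => H i l - q i l)).
  rewrite mulr_natl -[k in _ *+ k]card_ord -sumr_const; apply: ler_sum => l _.
  by apply: var_v; exact: leq_trans kK.
by move=> l l' ll'; apply: orth_v => //; exact: leq_trans kK.
Qed.

Let nsq_e i : nsq (e i) <= su / K%:R.
Proof.
rewrite /e /kavg nsqZ; apply: le_trans (ler_wpM2l (sqr_ge0 _) (noise_sum_u i (leqnn K))) _.
by rewrite le_eqVlt; apply/orP; left; apply/eqP; field; rewrite gt_eqF.
Qed.

Let nsq_r i : nsq (r i) <= sv / K%:R.
Proof.
rewrite /r /kavg nsqZ; apply: le_trans (ler_wpM2l (sqr_ge0 _) (noise_sum_v i (leqnn K))) _.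
by rewrite le_eqVlt; apply/orP; left; apply/eqP; field; rewrite gt_eqF.
Qed.

Let ip_ee i j : i != j -> ip (e i) (e j) = 0.
Proof.
move=> ij; rewrite ipZl ipZr ip_suml big1 ?mulr0 // => k _.
by rewrite ip_sumr big1 // => l _; apply: orth_u => //; rewrite xpair_eqE (negbTE ij).
Qed.

Let ip_ge i : ip (avg g) (e i) = 0.
Proof. by rewrite /e /kavg ipZr ip_sumr big1 ?mulr0 // => k _; exact: orth_g. Qed.

Let ip_ze i : ip (avg z) (e i) = 0.
Proof. by rewrite /e /kavg ipZr ip_sumr big1 ?mulr0 // => k _; exact: orth_z. Qed.

Let ip_br i : ip (b i) (r i) = 0.
Proof. by rewrite /r /kavg ipZr ip_sumr big1 ?mulr0 // => k _; exact: orth_b. Qed.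

(** The direction of client [i] without this round's noise. The corrections cancel in the sum over
    all clients, but not over a drawn set. *)
Let d i := pa i + (avg c - c i).

Let round_duE A : round_du A =
  - (gam * K%:R / m%:R) *: (\sum_(i in A) e i + \sum_(i in A) d i).
Proof.
rewrite -big_split /=; congr (_ *: _); apply: eq_bigr => i _.
by rewrite (kavg_split (G i) (p i)) addrAC [RHS]addrC.
Qed.

Let sum_avg (E0 : ipSpace R) (x : 'I_n -> E0) : \sum_i x i = n%:R *: avg x.
Proof. by rewrite /avg scalerA mulfV ?scale1r // gt_eqF. Qed.

Let sum_d : \sum_i d i = n%:R *: avg pa.
Proof.
rewrite /d big_split /= big_split /= sumrN sum_avg sumr_const card_ord.
by rewrite (sum_avg c) -[avg c *+ n]scaler_nat subrr addr0.
Qed.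

(** Linear in the step, so averaging over the sets reaches all clients equally: the control variates
    cancel and only the mean gradient is left. *)
Let avg_ip_du x : (forall i, ip x (e i) = 0) ->
  avgS m (fun A => ip x (round_du A)) = - (gam * K%:R) * ip x (avg pa).
Proof.
move=> xe.
have -> : avgS m (fun A => ip x (round_du A)) =
  avgS m (fun A => - (gam * K%:R / m%:R) * \sum_(i in A) ip x (d i)).
  apply: eq_avgS => A; rewrite round_duE ipZr ipDr !ip_sumr.
  by rewrite [X in X + _]big1 ?add0r // => i _.
rewrite avgSZ avgS_sum_in // -ip_sumr sum_d ipZr.
by field; rewrite !gt_eqF.
Qed.

(** Polarization rather than Young, in order to keep the negative [Pn]: it later pays for the
    squared step and for the lag. *)
Let descent_u : avgS m (fun A => ip (avg g) (round_du A))
  <= - (gam * K%:R / 2) * (U + Pn) + gam * K%:R * L ^+ 2 * Xb.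
Proof.
rewrite avg_ip_du; last exact: ip_ge.
rewrite ip_polar -/U -/Pn.
have : nsq (avg g - avg pa) <= 2 * L ^+ 2 * Xb.
  have -> : avg g - avg pa = avg (fun i => g i - pa i).
    by rewrite /avg -scalerBr -sumrB.
  apply: le_trans (nsq_avg_le' _) _.
  rewrite /Xb mulrCA ler_wpM2l ?invr_ge0 ?ler0n // mulr_sumr.
  by apply: ler_sum => i _; exact: pag.
have k0 : 0 <= gam * K%:R by rewrite mulr_ge0 ?ler0n // ltW.
by move=> /(ler_wpM2l k0); norm_lra.
Qed.

Let round_dvE i : round_dv i = - (gam * K%:R) *: (qa i + r i).
Proof. by rewrite /round_dv (kavg_split (H i) (q i)). Qed.

Let descent_v : avgS m (fun A => n%:R^-1 * \sum_(i in A) ip (b i) (round_dv i))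
  <= - (gam * K%:R / 2) * (V + Vq) + gam * K%:R * L ^+ 2 * Xb.
Proof.
rewrite avgSZ avgS_sum_in //.
have k0 : 0 <= gam * K%:R by rewrite mulr_ge0 ?ler0n // ltW.
have : \sum_i ip (b i) (round_dv i) <= \sum_i
    (- (gam * K%:R / 2) * (nsq (b i) + nsq (qa i)) + gam * K%:R * L ^+ 2 * X i).
  apply: ler_sum => i _; rewrite round_dvE ipZr ipDr ip_br addr0 ip_polar.
  by have /(ler_wpM2l k0) := qab i; norm_lra.
rewrite big_split /= -mulr_sumr -[X in _ <= _ + X]mulr_sumr big_split /=.
have SX : \sum_i X i = n%:R * Xb by rewrite /Xb mulVKf // gt_eqF.
rewrite SX; set T := \sum_i _ => hT.
have mn2 : 0 <= n%:R^-1 * (m%:R / n%:R) :> R by rewrite !mulr_ge0 ?invr_ge0 ?ler0n.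
rewrite mulrA; apply: le_trans (ler_wpM2l mn2 hT) _.
rewrite /V /Vq.
have -> : n%:R^-1 * (m%:R / n%:R) * (- (gam * K%:R / 2) *
    (\sum_i nsq (b i) + \sum_i nsq (qa i)) + gam * K%:R * L ^+ 2 * (n%:R * Xb))
  = - (gam * K%:R / 2) * (m%:R / n%:R ^+ 2 * \sum_i nsq (b i) +
      m%:R / n%:R ^+ 2 * \sum_i nsq (qa i)) + m%:R / n%:R * (gam * K%:R * L ^+ 2 * Xb).
  by field; rewrite gt_eqF.
(* The factor m/n <= 1 on the drift is given away. *)
rewrite lerD2l -[leRHS]mul1r ler_wpM2r // ?ler_pdivrMr ?mul1r //.
by rewrite mulr_ge0 ?Xb_ge0 // mulr_ge0 ?sqr_ge0.
Qed.

Let mean_nsq_shift (E0 : ipSpace R) (x : 'I_n -> E0) x0 :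
  n%:R^-1 * \sum_i nsq (x i - avg x + x0) <= nsq x0 + n%:R^-1 * \sum_i nsq (x i).
Proof.
have := avg_nsq_shift x x0; rewrite card_ord => /(_ n0) ->.
by rewrite gerBl nsq_ge0.
Qed.

Let mean_scale (a0 : R) (f : 'I_n -> R) :
  n%:R^-1 * \sum_i (a0 * f i) = a0 * (n%:R^-1 * \sum_i f i).
Proof. by rewrite -mulr_sumr mulrCA. Qed.

Let mean_X (a0 : R) : n%:R^-1 * \sum_i (a0 * X i) = a0 * Xb.
Proof. exact: mean_scale. Qed.

Let mean_le (f f' : 'I_n -> R) : (forall i, f i <= f' i) ->
  n%:R^-1 * \sum_i f i <= n%:R^-1 * \sum_i f' i.
Proof. by move=> ff'; rewrite ler_wpM2l ?invr_ge0 ?ler0n // ler_sum. Qed.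

Let mean_cst (c0 : R) : n%:R^-1 * \sum_(i < n) c0 = c0.
Proof.
by rewrite sumr_const card_ord -[c0 *+ n]mulr_natl mulKf // gt_eqF.
Qed.

Let mean_add (f f' : 'I_n -> R) :
  n%:R^-1 * \sum_i (f i + f' i) = n%:R^-1 * \sum_i f i + n%:R^-1 * \sum_i f' i.
Proof. by rewrite big_split mulrDr. Qed.

Let mean_affine (f1 f2 f3 : 'I_n -> R) (a0 b0 c0 : R) :
  n%:R^-1 * \sum_i (f1 i + a0 * f2 i + (c0 + b0 * f3 i)) =
  n%:R^-1 * \sum_i f1 i + a0 * (n%:R^-1 * \sum_i f2 i)
  + (c0 + b0 * (n%:R^-1 * \sum_i f3 i)).
Proof. by rewrite !mean_add mean_cst !mean_scale. Qed.

Let avgS_affine (F1 F2 F3 : {set 'I_n} -> R) (a0 b0 b1 c0 : R) :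
  avgS m (fun A => c0 + a0 * F1 A + (b0 * F2 A + b1 * F3 A)) =
  c0 + a0 * avgS m F1 + (b0 * avgS m F2 + b1 * avgS m F3).
Proof. by rewrite !avgSD avgS_cst // !avgSZ. Qed.

(** This is where the control variates act: [d i] is the centred [pa i - c i] plus [avg pa], so by
    the variance decomposition client heterogeneity enters only through [pa i - c i], that is,
    through drift, staleness and the noise of [c i]. *)
Let mean_d : n%:R^-1 * \sum_i nsq (d i) <=
  Pn + 3 * (2 * L ^+ 2 * Xb + 2 * Y + su / K%:R).
Proof.
have -> : \sum_i nsq (d i) = \sum_i nsq ((pa i - c i) - avg (fun j => pa j - c j) + avg pa).
  apply: eq_bigr => i _; congr nsq.
  have -> : avg (fun j => pa j - c j) = avg pa - avg c by rewrite /avg -scalerBr -sumrB.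
  by rewrite opprB addrA addrNK addrAC /d addrA.
apply: le_trans (mean_nsq_shift _ _) _; rewrite lerD2l.
have h i : nsq (pa i - c i) <= 3 * (2 * L ^+ 2 * X i +
     (2 * L ^+ 2 * nsq (z i) + 2 * nsq (y i)) + su / K%:R).
  have -> : pa i - c i = (pa i - g i) + (g i - al i) + (al i - c i).
    by rewrite !addrA !subrK.
  apply: le_trans (nsqD3_le _ _ _) _; rewrite ler_pM2l //.
  have := pag i; have := hy i; have := hc i.
  rewrite (nsqBC (pa i)) (nsqBC (al i)); norm_lra.
apply: le_trans (mean_le h) _.
rewrite mean_scale !mean_add mean_X (mean_cst (su / K%:R)) !mean_scale -/W -/Q /Y.
norm_lra.
Qed.

Let s_ge0 : 0 <= s.
Proof. by rewrite divr_ge0 // mulr_ge0 ?ler0n. Qed.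

Let w_ge0 : 0 <= w.
Proof. by rewrite divr_ge0 // mulr_ge0 ?ler0n. Qed.

Let mean_ge0 (f : 'I_n -> R) : (forall i, 0 <= f i) -> 0 <= n%:R^-1 * \sum_i f i.
Proof. by move=> f0; rewrite mulr_ge0 ?invr_ge0 ?ler0n // sumr_ge0. Qed.

Let W_ge0 : 0 <= W. Proof. by apply: mean_ge0 => i; exact: nsq_ge0. Qed.
Let Q_ge0 : 0 <= Q. Proof. by apply: mean_ge0 => i; exact: nsq_ge0. Qed.
(** Fresh noise gives 2s and the old noise in the control variates 6s. The mean step gives 2 Pn from
    the full sum and 2 Pn / m from the variance of the drawn set. *)
Let bound_Du : Du <= (gam * K%:R) ^+ 2 *
  (8 * s + 4 * Pn + 12 * (L ^+ 2 * Xb) + 12 * Y / m%:R).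
Proof.
have hA (A : {set 'I_n}) : #|A| = m -> nsq (round_du A) <=
    (gam * K%:R / m%:R) ^+ 2 * (2 * (m%:R * (su / K%:R)) + 2 * nsq (\sum_(i in A) d i)).
  move=> Am; rewrite round_duE nsqZ sqrrN ler_wpM2l ?sqr_ge0 //.
  apply: le_trans (nsqD_le _ _) _; rewrite lerD2r ler_wpM2l //.
  rewrite nsq_orthogonal_sum //.
  have -> : m%:R * (su / K%:R) = \sum_(i in A) (su / K%:R).
    by rewrite sumr_const Am mulr_natl.
  by apply: ler_sum => i _; exact: nsq_e.
apply: le_trans (le_avgS hA) _.
rewrite avgSZ avgSD avgS_cst // avgSZ.
have := avgS_nsq_sum hm d; rewrite sum_d nsqZ -/Pn.
have := mean_d; set T := avgS _ _; set Z := \sum_i nsq (d i) => hZ hT.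
have e1 : m%:R ^+ 2 / n%:R ^+ 2 * (n%:R ^+ 2 * Pn) = m%:R ^+ 2 * Pn.
  by field; rewrite gt_eqF.
have hT' : T <= m%:R ^+ 2 * Pn + m%:R * (Pn + 3 * (2 * L ^+ 2 * Xb + 2 * Y + su / K%:R)).
  apply: le_trans hT _; rewrite e1 lerD2l -mulrA.
  by apply: ler_wpM2l => //; rewrite ltW.
have sE : su / K%:R = m%:R * s.
  by rewrite /s; field; rewrite !gt_eqF.
have e2 : (gam * K%:R / m%:R) ^+ 2 = (gam * K%:R) ^+ 2 / m%:R ^+ 2.
  by rewrite expr_div_n.
rewrite e2 -mulrA ler_wpM2l ?sqr_ge0 //.
rewrite ler_pdivrMl ?exprn_gt0 // sE.
have e3 : m%:R ^+ 2 * (8 * s + 4 * Pn + 12 * (L ^+ 2 * Xb) + 12 * Y / m%:R) =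
   8 * (m%:R ^+ 2 * s) + 4 * (m%:R ^+ 2 * Pn) + 12 * (m%:R ^+ 2 * (L ^+ 2 * Xb)) + 12 * (m%:R * Y).
  by field; rewrite gt_eqF.
rewrite e3; rewrite sE in hT'.
have mm : (m%:R : R) <= m%:R ^+ 2 by rewrite expr2 ler_peMl // ltW.
have P0 : 0 <= Pn by exact: nsq_ge0.
have LX0 : 0 <= L ^+ 2 * Xb by rewrite mulr_ge0 // sqr_ge0.
have h1 := ler_wpM2r P0 mm; have h2 := ler_wpM2r LX0 mm.
norm_lra.
Qed.

Let bound_Dv : Dv <= (gam * K%:R) ^+ 2 * (2 * Vq + 2 * w).
Proof.
rewrite /Dv avgSZ avgS_sum_in //.
have h i : nsq (round_dv i) <= (gam * K%:R) ^+ 2 * (2 * nsq (qa i) + 2 * (sv / K%:R)).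
  rewrite round_dvE nsqZ sqrrN ler_wpM2l ?sqr_ge0 //.
  apply: le_trans (nsqD_le _ _) _; rewrite lerD2l ler_wpM2l //; exact: nsq_r.
rewrite mulrCA; have mn0 : 0 <= m%:R / n%:R :> R by rewrite divr_ge0.
apply: le_trans (ler_wpM2l mn0 (mean_le h)) _.
rewrite mean_scale mean_add (mean_cst (2 * (sv / K%:R))) mean_scale /Vq /w.
by rewrite le_eqVlt; apply/orP; left; apply/eqP; field; rewrite !gt_eqF.
Qed.

Let hmn0 : 0 <= m%:R / n%:R :> R. Proof. by rewrite divr_ge0. Qed.

Let bound_W' :
  avgS m (fun A => n%:R^-1 * \sum_i nsq (if i \in A then round_du A else z i + round_du A))
  <= (1 - m%:R / n%:R / 4) * W + 3 * Du + 4 * (n%:R / m%:R) * (gam * K%:R) ^+ 2 * Pn.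
Proof.
have hA (A : {set 'I_n}) : #|A| = m ->
   n%:R^-1 * \sum_i nsq (if i \in A then round_du A else z i + round_du A)
   <= W + - (1 / 2) * (n%:R^-1 * \sum_(i in A) nsq (z i))
      + (3 * nsq (round_du A) + 2 * ip (avg z) (round_du A)).
  move=> Am.
  (* For a participating client the missing cross term is added back by Young, at the cost of half
     of its squared lag and of 2 |du|^2. The cross term then has the same form for all clients,
     whatever [A] is, and sums to one with [avg z]. *)
  have hi i : nsq (if i \in A then round_du A else z i + round_du A)
     <= nsq (z i) + - (1 / 2) * (if i \in A then nsq (z i) else 0)
       + (3 * nsq (round_du A) + 2 * ip (z i) (round_du A)).
    have d0 := nsq_ge0 (round_du A).
    case: (i \in A).
      have b0 : (0 : R) < 1 / 2 by norm_lra.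
      have := ip_young (- z i) (round_du A) b0; rewrite ipNl nsqN.
      have -> : (1 / 2 : R)^-1 = 2 by field.
      norm_lra.
    rewrite nsqD; norm_lra.
  apply: le_trans (mean_le hi) _.
  rewrite mean_affine -/W.
  have -> : n%:R^-1 * \sum_i ip (z i) (round_du A) = ip (avg z) (round_du A).
    by rewrite /avg ipZl ip_suml.
  by rewrite -big_mkcond.
apply: le_trans (le_avgS hA) _.
rewrite avgS_affine avgSZ avgS_sum_in // -/Du avg_ip_du //.
have k0 : 0 < gam * K%:R by rewrite mulr_gt0.
(* The reset yields a gain of m/(2n); this weight spends half of it on the cross term and leaves
   m/(4n). *)
have b0 : 0 < m%:R / n%:R / 4 / (gam * K%:R) :> R by rewrite !divr_gt0 ?mulr_gt0.
have := ip_young (- avg z) (avg pa) b0; rewrite ipNl nsqN -/Pn.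
have hW : nsq (avg z) <= W by exact: nsq_avg_le'.
move=> /(ler_wpM2l (ltW k0)).
have -> : gam * K%:R * (m%:R / n%:R / 4 / (gam * K%:R) * nsq (avg z) +
    (m%:R / n%:R / 4 / (gam * K%:R))^-1 * Pn)
  = m%:R / n%:R / 4 * nsq (avg z) + 4 * (n%:R / m%:R) * (gam * K%:R) ^+ 2 * Pn.
  by field; rewrite !gt_eqF.
have := ler_wpM2l hmn0 hW.
have -> : n%:R^-1 * (m%:R / n%:R * \sum_i nsq (z i)) = m%:R / n%:R * W.
  by rewrite mulrCA.
norm_lra.
Qed.

(** The staleness vector of an absent client is unchanged, as neither its v_i nor its control
    variate moves, so here the full contraction m/n is available. A present client incurs only the
    drift and its own step in v. *)
Let bound_Q' :
  avgS m (fun A => n%:R^-1 * \sum_i nsq (if i \in A then y' i else y i))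
  <= (1 - m%:R / n%:R) * Q + 2 * L ^+ 2 * Dv + 4 * (m%:R / n%:R) * (L ^+ 2 * Xb).
Proof.
have -> : avgS m (fun A => n%:R^-1 * \sum_i nsq (if i \in A then y' i else y i))
   = Q + - 1 * (m%:R / n%:R) * Q + m%:R / n%:R * (n%:R^-1 * \sum_i nsq (y' i)).
  transitivity (avgS m (fun A => Q + - 1 * (n%:R^-1 * \sum_(i in A) nsq (y i))
     + n%:R^-1 * \sum_(i in A) nsq (y' i))).
    apply: eq_avgS => A; rewrite mulN1r -mulrBr -mulrDr; congr (_ * _).
    rewrite (big_mkcond (fun i => i \in A)) /= [X in _ + X]big_mkcond /=.
    rewrite -sumrB -big_split; apply: eq_bigr => i _ /=.
    by case: ifP => _; rewrite ?subrr ?add0r // subr0 addr0.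
  rewrite !avgSD avgS_cst // !avgSZ !avgS_sum_in // /Q.
  by congr (_ + _ + _); rewrite ?mulN1r ?mulNr ?mul1r; rewrite ?(mulrCA n%:R^-1).
have h : n%:R^-1 * \sum_i nsq (y' i) <= n%:R^-1 * \sum_i
    (2 * L ^+ 2 * nsq (round_dv i) + 4 * L ^+ 2 * X i).
  by apply: mean_le => i; have := hy' i; have := pag i; norm_lra.
have := ler_wpM2l hmn0 h.
rewrite mean_add mean_X mean_scale.
have -> : Dv = m%:R / n%:R * (n%:R^-1 * \sum_i nsq (round_dv i)).
  by rewrite /Dv avgSZ avgS_sum_in // mulrCA.
norm_lra.
Qed.

Hypothesis small : gam * K%:R * L <= 1 / 72.

(** The lower bounds on the server step sizes enter here, through [hgu] and [hgv]: they shorten the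
    local steps so that the factors 1/m and m/n appear, which turn the per-client noises into [s]
    and [w] and the staleness into Y/m. *)
Let bound_X : L ^+ 2 * Xb <= 5 * (gam * K%:R * L) ^+ 2 *
  (3 * s + w + U + V + 4 * Y / m%:R).
Proof.
have k0 : 0 < gam * K%:R by rewrite mulr_gt0.
have mn1 : m%:R / n%:R <= 1 :> R by rewrite ler_pdivrMr // mul1r.
have im1 : m%:R^-1 <= 1 :> R by rewrite invf_le1.
have small' : 8 * L ^+ 2 * K%:R ^+ 2 * (gu ^+ 2 + gv ^+ 2) <= 1 / 5.
  have h : gu ^+ 2 + gv ^+ 2 <= 2 * gam ^+ 2.
    have g2 : 0 <= gam ^+ 2 by exact: sqr_ge0.
    have := ler_wpM2l g2 mn1; have := ler_wpM2l g2 im1.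
    rewrite !mulr1 => h1 h2; have := le_trans hgu h1; have := le_trans hgv h2; lra.
  have L2 : 0 <= 8 * L ^+ 2 * K%:R ^+ 2.
    by rewrite mulr_ge0 ?sqr_ge0 // mulr_ge0 ?sqr_ge0.
  apply: le_trans (ler_wpM2l L2 h) _.
  have -> : 8 * L ^+ 2 * K%:R ^+ 2 * (2 * gam ^+ 2) = 16 * (gam * K%:R * L) ^+ 2 by ring.
  have kL0 : 0 <= gam * K%:R * L by rewrite mulr_ge0 // ltW.
  have : (gam * K%:R * L) ^+ 2 <= (1 / 72) ^+ 2 by rewrite lerXn2r ?nnegrE.
  norm_lra.
have hi i : X i <= 5 * (gam * K%:R) ^+ 2 * (m%:R^-1 * (su / K%:R + nsq (g i + (avg c - c i)))
    + m%:R / n%:R * (sv / K%:R + nsq (b i))).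
  have := client_drift hK (@hstep_u i) (@hstep_v i) (@noise_sum_u i) (@noise_sum_v i)
    su0 sv0 (@hlip_u i) (@hlip_v i) small'.
  rewrite -/(X i) => h; apply: le_trans h _.
  have A0 : 0 <= su / K%:R + nsq (g i + (avg c - c i)).
    by rewrite addr_ge0 ?nsq_ge0 // divr_ge0.
  have B0 : 0 <= sv / K%:R + nsq (b i).
    by rewrite addr_ge0 ?nsq_ge0 // divr_ge0.
  have K2 : 0 <= K%:R ^+ 2 :> R by exact: sqr_ge0.
  have := ler_wpM2r (mulr_ge0 K2 A0) hgu.
  have := ler_wpM2r (mulr_ge0 K2 B0) hgv.
  norm_lra.
have hg : n%:R^-1 * \sum_i nsq (g i + (avg c - c i)) <= U + (4 * Y + 2 * (su / K%:R)).
  have -> : \sum_i nsq (g i + (avg c - c i)) =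
      \sum_i nsq ((g i - c i) - avg (fun j => g j - c j) + avg g).
    apply: eq_bigr => i _; congr nsq.
    have -> : avg (fun j => g j - c j) = avg g - avg c by rewrite /avg -scalerBr -sumrB.
    by rewrite opprB [in RHS]addrA addrNK [RHS]addrAC addrA.
  apply: le_trans (mean_nsq_shift _ _) _; rewrite lerD2l.
  have h i : nsq (g i - c i) <= 4 * (L ^+ 2 * nsq (z i)) + 4 * nsq (y i) + 2 * (su / K%:R).
    have -> : g i - c i = (g i - al i) + (al i - c i) by rewrite addrA subrK.
    apply: le_trans (nsqD_le _ _) _.
    have := hy i; have := hc i; rewrite (nsqBC (al i)); norm_lra.
  apply: le_trans (mean_le h) _.
  rewrite !mean_add (mean_cst (2 * (su / K%:R))) !mean_scale -/W -/Q /Y; norm_lra.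
have L2 : 0 <= L ^+ 2 by exact: sqr_ge0.
have := ler_wpM2l L2 (mean_le hi).
rewrite -/Xb mean_scale mean_add !mean_scale !mean_add.
rewrite (mean_cst (su / K%:R)) (mean_cst (sv / K%:R)) => h.
apply: le_trans h _.
have eV : m%:R / n%:R * (sv / K%:R + n%:R^-1 * \sum_i nsq (b i)) = w + V.
  by rewrite /w /V; field; rewrite !gt_eqF.
rewrite eV.
have sE : su / K%:R = m%:R * s by rewrite /s; field; rewrite !gt_eqF.
have im0 : 0 <= m%:R^-1 :> R by rewrite invr_ge0.
have hs : m%:R^-1 * (su / K%:R + n%:R^-1 * \sum_i nsq (g i + (avg c - c i)))
   <= 3 * s + U + 4 * Y / m%:R.
  apply: le_trans (ler_wpM2l im0 (lerD (lexx _) hg)) _.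
  rewrite sE.
  have -> : m%:R^-1 * (m%:R * s + (U + (4 * Y + 2 * (m%:R * s)))) = 3 * s + m%:R^-1 * U + 4 * Y / m%:R.
    by field; rewrite gt_eqF.
  have := ler_wpM2r (nsq_ge0 (avg g)) im1; rewrite -/U; norm_lra.
have -> : L ^+ 2 * (5 * (gam * K%:R) ^+ 2 * (m%:R^-1 * (su / K%:R + n%:R^-1 *
    \sum_i nsq (g i + (avg c - c i))) + (w + V))) = 5 * (gam * K%:R * L) ^+ 2 *
   (m%:R^-1 * (su / K%:R + n%:R^-1 * \sum_i nsq (g i + (avg c - c i))) + (w + V)) by ring.
apply: ler_wpM2l; first by rewrite mulr_ge0 ?sqr_ge0.
apply: le_trans (lerD hs (lexx (w + V))) _.
by rewrite le_eqVlt; apply/orP; left; apply/eqP; ring.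
Qed.

Hypothesis small2 : (gam * K%:R * L) ^+ 2 * n%:R / m%:R ^+ 2 <= 1 / 72 ^+ 2.
Hypothesis small3 : (gam * K%:R * L) ^+ 3 * n%:R ^+ 2 / m%:R ^+ 3 <= 1 / 72 ^+ 3.

Lemma round_progress (A0 : R) :
  A0 = 60 * (gam * K%:R) * (gam * K%:R * L) * n%:R / m%:R ^+ 2 ->
  avgS m (fun A => ip (avg g) (round_du A)
    + n%:R^-1 * \sum_(i in A) ip (b i) (round_dv i)
    + (L * nsq (round_du A)
       + L * (n%:R^-1 * \sum_(i in A) nsq (round_dv i))))
  + A0 * (L ^+ 2 * avgS m (fun A => n%:R^-1 *
            \sum_i nsq (if i \in A then round_du A else z i + round_du A))
          + avgS m (fun A => n%:R^-1 * \sum_i nsq (if i \in A then y' i else y i)))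
  <= A0 * Y - gam * K%:R / 4 * (U + V)
     + 37 * (gam * K%:R * L) * (gam * K%:R) * (s + w).
Proof.
move=> eA0; have k0 : 0 < gam * K%:R by rewrite mulr_gt0.
apply: (round_arithmetic k0 L0 (erefl _) m1R mnR (nsq_ge0 (avg g)) _
  (nsq_ge0 (avg pa)) _ s_ge0 w_ge0 W_ge0 Q_ge0 _ small small2 small3 _
  bound_Du bound_Dv bound_X bound_W' bound_Q' eA0).
- by rewrite mulr_ge0 ?divr_ge0 ?sqr_ge0 // sumr_ge0 // => i _; exact: nsq_ge0.
- by rewrite mulr_ge0 ?divr_ge0 ?sqr_ge0 // sumr_ge0 // => i _; exact: nsq_ge0.
- by rewrite mulr_ge0 ?sqr_ge0.
rewrite !avgSD !avgSZ.
have := descent_u; have := descent_v; rewrite !avgSZ -/Du /Dv avgSZ -/U -/Pn.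
norm_lra.
Qed.

(** The refreshed control variate is [kavg (G i)], so this reproduces the bound [hc] for the next
    round. *)
Lemma round_noise_var i : nsq (kavg (G i) - pa i) <= su / K%:R.
Proof.
by rewrite (kavg_split (G i) (p i)) addrC addKr; exact: nsq_e.
Qed.

End Round.

(** * Descent and sampling inequalities *)

Section Descent.
Context {R : realType} {d : nat}.

Lemma derive_line (f : 'rV[R]_d -> R) (x h : 'rV[R]_d) (s : R) :
  differentiable f (x + s *: h) ->
  derivable (fun t : R => f (x + t *: h)) s 1 /\
  'D_1 (fun t : R => f (x + t *: h)) s = dot (gradient f (x + s *: h)) h.
Proof.
move=> df.
have E : (fun t : R => t^-1 *: (((fun t : R => f (x + t *: h)) \o shift s) (t *: (1 : R)) - f (x + s *: h)))
   = (fun t : R => t^-1 *: ((f \o shift (x + s *: h)) (t *: h) - f (x + s *: h))).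
  apply/funext => t /=; congr (_ *: (f _ - _)).
  by rewrite [t *: 1]mulr1 scalerDl addrCA.
have := diff_derivable (v := h) df.
rewrite /derivable -E => dv; split=> //.
rewrite {1}/derive E -/(derive f (x + s *: h) h) deriveE // gradientE //.
Qed.

Lemma lipschitz_gradient_le (f : 'rV[R]_d -> R) (L : R) (x h : 'rV[R]_d) :
  0 <= L -> (forall y, differentiable f y) ->
  (forall y, enorm (gradient f y - gradient f x) <= L * enorm (y - x)) ->
  f (x + h) <= f x + dot (gradient f x) h + L / 2 * sqn h.
Proof.
move=> L0 df lipf.
(* The function on the segment minus its quadratic upper model; by the Lipschitz bound and
   Cauchy-Schwarz its derivative is nonpositive, so no integral of the gradient is needed. *)
pose phi (s : R) := f (x + s *: h) - s * dot (gradient f x) h - s ^+ 2 * (L / 2 * sqn h).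
have dphi (s : R) : is_derive s 1 phi
    (dot (gradient f (x + s *: h)) h - dot (gradient f x) h - s * (L * sqn h)).
  have [dl dE] := derive_line (df (x + s *: h)).
  have i1 : is_derive s 1 (fun t : R => f (x + t *: h)) (dot (gradient f (x + s *: h)) h).
    by rewrite -dE; exact: derivableP.
  have i2 : is_derive s 1 (fun t : R => t * dot (gradient f x) h) (dot (gradient f x) h).
    by apply: is_derive_eq; rewrite scaler0 add0r [_ *: 1]mulr1.
  have i3 : is_derive s 1 (fun t : R => t ^+ 2 * (L / 2 * sqn h)) (s * (L * sqn h)).
    apply: is_derive_eq; rewrite scaler0 add0r /GRing.scale /=. lra.
  exact: is_deriveB.
suff : phi 1 <= phi 0.
  rewrite /phi scale1r scale0r addr0 expr1n expr0n /= !mul1r !mul0r !subr0; lra.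
have dphi1 (s : R) : derivable phi s 1 by have [] := dphi s.
have cphi : {within `[0, 1], continuous phi}.
  apply: continuous_subspaceT => s.
  exact/differentiable_continuous/derivable1_diffP.
have phi_le0 (s : R) : s \in `]0, 1[%R -> derive1 phi s <= 0.
  rewrite in_itv /= => /andP[s0 _].
  rewrite derive1E; have [_ ->] := dphi s.
  rewrite -dotNl -dotDl.
  have := dot_le_enorm (gradient f (x + s *: h) - gradient f x) h.
  have := lipf (x + s *: h); rewrite (addrC x) addrK (addrC _ x) => h1 h2.
  have es : enorm (s *: h) = s * enorm h.
    apply/eqP; rewrite -(@eqrXn2 _ 2) ?enorm_ge0 ?mulr_ge0 ?enorm_ge0 ?(ltW s0) //.
    by rewrite exprMn !enorm_sqn sqnZ.
  rewrite es in h1.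
  have h3 := ler_wpM2r (enorm_ge0 h) h1.
  rewrite -enorm_sqn expr2; lra.
by apply: (ler0_derive1_le_cc _ phi_le0 cphi) => //; rewrite ?in_itv /= ?lexx ?ler01.
Qed.

End Descent.

Section Select.
Context {R : realType} {dO : measure_display} {Omega : measurableType dO}.
Variables (P : probability Omega R) (J : finType) (E : J -> set (set Omega)).
Hypothesis indE : mutually_independent P E.
Hypothesis setIE : forall j, setI_closed (E j).
Hypothesis setTE : forall j, E j setT.
Hypothesis measE : forall j, E j `<=` measurable.
Variables (n m : nat) (S : Omega -> {set 'I_n}).
Hypothesis hS : uniform_subset P m S.

Let mS A : measurable (S @^-1` [set A]). Proof. by case: (hS A). Qed.

Lemma L2_select d (Z : {set 'I_n} -> Omega -> 'rV[R]_d) :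
  (forall A, L2 P (Z A)) -> L2 P (fun w => Z (S w) w).
Proof.
move=> lZ.
have -> : (fun w => Z (S w) w) =
    (fun w => \sum_(A : {set 'I_n}) (if S w == A then Z A w else 0)).
  by apply/funext => w; rewrite -big_mkcond (big_pred1 (S w)).
apply: L2_sum => A _; apply: (L2_dominated (h := fun w => sqn (Z A w))).
- by apply: mvec_if => //; case: (lZ A).
- by move=> w; case: ifP => // _; rewrite sqn0 sqn_ge0.
- by case: (lZ A).
Qed.

Variable j0 : J.
Hypothesis ES : forall B, E j0 (S @^-1` B).

Lemma integral_event (A : {set 'I_n}) (h : Omega -> R) :
  measurable_fun [set: othersType E j0] h ->
  P.-integrable setT (fun w => (h w)%:E) ->
  (\int[P]_w (h w * (S w == A)%:R) =
   fine (P (S @^-1` [set A])) * \int[P]_w h w)%R.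
Proof.
move=> mh ih.
have mb : measurable_fun setT (fun w => S w == A).
  apply: (measurable_fun_bool true); rewrite setTI.
  rewrite (_ : _ @^-1` _ = S @^-1` [set A]) //.
  by apply/seteqP; split => w /= => [/eqP|->]; rewrite ?eqxx.
(* Only the event that [S] equals [A] matters, so a boolean variable serves as the fresh source in
   the freezing lemma. *)
pose x : {RV P >-> bool} := mfun_Sub (mem_set mb).
have Ex B : measurable B -> E j0 (x @^-1` B).
  move=> _; rewrite (_ : _ @^-1` _ = S @^-1` [set C | B (C == A)]) //.
have mO : measurable_fun setT h by exact: measurable_fun_others mh.
pose phi (z : R * bool) : \bar R := (z.1 * z.2%:R)%:E.
have mphi : measurable_fun setT phi.
  apply/measurable_EFinP; apply: measurable_funM => //.
  apply: (measurableT_comp (f := fun b : bool => b%:R : R)) => //.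
have iphi : P.-integrable setT (fun w => phi (h w, x w)).
  apply: le_integrable ih => //.
    apply: (measurableT_comp mphi); exact: measurable_fun_pair.
  move=> w _ /=; rewrite lee_fin normrM ler_piMr //.
  by case: (S w == A); rewrite ?normr1 ?normr0.
have := integral_freeze indE setIE setTE measE mh Ex mphi iphi.
rewrite /phi /= => e; rewrite /Rintegral e.
have ib : (distribution P x).-integrable setT (fun z : bool => (z%:R : R)%:E).
  apply: le_integrable (finite_measure_integrable_cst _ 1 measurableT) => //.
  by move=> z _ /=; rewrite lee_fin normr1; case: z; rewrite ?normr1 ?normr0.
have inner w : (\int[distribution P x]_z (h w * z%:R)%:E
    = (fine (P (S @^-1` [set A])))%:E * (h w)%:E)%E.
  under eq_integral do rewrite EFinM.
  rewrite integralZl // muleC; congr (_ * _)%E.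
  rewrite (_ : (fun z : bool => _) = (fun z => (\1_[set true] z)%:E)).
    rewrite integral_indic // setIT fineK ?fin_num_measure //.
    rewrite /distribution /pushforward; congr (P _).
    by apply/seteqP; split => w' /= => [/eqP|->]; rewrite ?eqxx.
  by apply/funext => -[]; rewrite indicE; [rewrite mem_set|rewrite memNset].
transitivity (fine (\int[P]_w ((fine (P (S @^-1` [set A])))%:E * (h w)%:E))%E).
  by congr fine; apply: eq_integral => w _; exact: inner.
by rewrite integralZl // fineM // ?fin_num_measure // integrable_fin_num.
Qed.

Lemma ip_select d (Z Z' : {set 'I_n} -> Omega -> 'rV[R]_d) :
  (forall A, L2 P (Z A)) -> (forall A, L2 P (Z' A)) ->
  (forall A, @mvec _ _ (othersType E j0) _ (Z A)) ->
  (forall A, @mvec _ _ (othersType E j0) _ (Z' A)) ->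
  L2_ip (toL2 P (fun w => Z (S w) w)) (toL2 P (fun w => Z' (S w) w))
  = avgS m (fun A => L2_ip (toL2 P (Z A)) (toL2 P (Z' A))).
Proof.
move=> lZ lZ' mZ mZ'.
rewrite ip_toL2; try exact: L2_select.
have iA A : P.-integrable setT (fun w => (dot (Z A w) (Z' A w))%:E).
  exact: integrable_dot.
have mb A : measurable_fun setT (fun w => S w == A).
  apply: (measurable_fun_bool true); rewrite setTI.
  rewrite (_ : _ @^-1` _ = S @^-1` [set A]) //.
  by apply/seteqP; split => w /= => [/eqP|->]; rewrite ?eqxx.
have iAS A : P.-integrable setT (fun w => (dot (Z A w) (Z' A w) * (S w == A)%:R)%:E).
  apply: le_integrable (iA A) => //.
    apply/measurable_EFinP; apply: measurable_funM.
      by apply: measurable_dot; [case: (lZ A)|case: (lZ' A)].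
    exact: (measurableT_comp (f := fun b : bool => b%:R : R)).
  move=> w _ /=; rewrite lee_fin normrM ler_piMr //.
  by case: (S w == A); rewrite ?normr1 ?normr0.
have -> : (fun w => dot (Z (S w) w) (Z' (S w) w)) =
    (fun w => \sum_(A : {set 'I_n}) dot (Z A w) (Z' A w) * (S w == A)%:R).
  apply/funext => w; rewrite (bigD1 (S w)) //= eqxx mulr1 big1 ?addr0 // => A.
  by rewrite eq_sym => /negbTE ->; rewrite mulr0.
rewrite /Rintegral; under eq_integral do rewrite -sumEFin.
rewrite integral_sum // -sum_fine; last by move=> A _; exact: integrable_fin_num.
rewrite /avgS mulr_sumr [RHS]big_mkcond; apply: eq_bigr => A _.
rewrite -/(Rintegral _ _ _) integral_event //; last exact: measurable_dot.
rewrite ip_toL2 //; have [_ ->] := hS A.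
by case: ifP => _ /=; rewrite ?mul0r.
Qed.

End Select.

(** * Noise of the stochastic gradients *)

Section Oracle.
Context {R : realType} {dX : measure_display} {X : measurableType dX}.
Context {du dv d : nat}.
Variables (G : 'rV[R]_du -> 'rV[R]_dv -> X -> 'rV[R]_d).
Variables (gb : 'rV[R]_du -> 'rV[R]_dv -> 'rV[R]_d).
Variables (mu : probability X R) (s2 : R).
Hypothesis hG : jointly_measurable G.
Hypothesis hmean : forall u v j,
  ('E_mu[fun x => G u v x 0%R j] = (gb u v 0%R j)%:E)%E.
Hypothesis hvar : forall u v,
  ('E_mu[fun x => (enorm (G u v x - gb u v) ^+ 2)%R] <= s2%:E)%E.

Let T := ((du.-tuple R * dv.-tuple R)%type).
Let row_u (p : T) : 'rV[R]_du := \row_k tnth p.1 k.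
Let row_v (p : T) : 'rV[R]_dv := \row_k tnth p.2 k.

Let row_tuple k (u : 'rV[R]_k) : \row_i tnth [tuple u 0 j | j < k] i = u.
Proof. by apply/rowP => i; rewrite mxE tnth_mktuple. Qed.

Section Measurability.
Context {dY : measure_display} {Y : measurableType dY}.
Variables (U : Y -> 'rV[R]_du) (V : Y -> 'rV[R]_dv).
Hypotheses (mU : mvec U) (mV : mvec V).

Let pt (w : Y) : T := ([tuple U w 0 j | j < du], [tuple V w 0 j | j < dv]).

Let mpt : measurable_fun setT pt.
Proof. by apply: measurable_fun_pair; exact: measurable_tuple_of. Qed.

Lemma mvec_oracle (x : Y -> X) : measurable_fun setT x ->
  mvec (fun w => G (U w) (V w) (x w)).
Proof.
move=> mx j.
have -> : (fun w => G (U w) (V w) (x w) 0 j) =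
  (fun p : T * X => G (row_u p.1) (row_v p.1) p.2 0 j) \o (fun w => (pt w, x w)).
  by apply/funext => w /=; rewrite /row_u /row_v !row_tuple.
by apply: measurableT_comp; [exact: hG|exact: measurable_fun_pair].
Qed.

(** The mean gradient is a parametric integral of [G], and Tonelli makes the integrals of the
    positive and negative parts measurable in the parameter. *)
Lemma mvec_mean : mvec (fun w => gb (U w) (V w)).
Proof.
move=> j; pose f (p : T * X) : \bar R := (G (row_u p.1) (row_v p.1) p.2 0 j)%:E.
have mf : measurable_fun [set: T * X] f by apply/measurable_EFinP; exact: hG.
have -> : (fun w => gb (U w) (V w) 0 j) =
    fine \o (fun p : T => \int[mu]_x f (p, x))%E \o pt.
  apply/funext => w /=; rewrite /f /= /row_u /row_v !row_tuple.
  by have := hmean (U w) (V w) j; rewrite unlock => ->.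
apply: measurableT_comp => //; apply: measurableT_comp => //.
have mp : measurable_fun setT (fun p : T => \int[mu]_x f^\+ (p, x))%E.
  apply: (@measurable_fun_fubini_tonelli_F _ _ T X R mu (f^\+)%E) => //.
  exact: measurable_funepos.
have mn : measurable_fun setT (fun p : T => \int[mu]_x f^\- (p, x))%E.
  apply: (@measurable_fun_fubini_tonelli_F _ _ T X R mu (f^\-)%E) => //.
  exact: measurable_funeneg.
rewrite (_ : (fun p : T => _) =
  ((fun p : T => \int[mu]_x f^\+ (p, x)) \- (fun p => \int[mu]_x f^\- (p, x)))%E).
  exact: emeasurable_funB mp mn.
by apply/funext => p; rewrite [LHS]integralE; congr (_ - _)%E;
  apply: eq_integral => x _; rewrite ?funeposE ?funenegE.
Qed.

End Measurability.

Let mvec_section u v : mvec (fun x : X => G u v x).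
Proof. by apply: (mvec_oracle (U := fun=> u) (V := fun=> v)); try exact: mvec_cst. Qed.

Let L2_noise_section u v : L2 mu (fun x => G u v x - gb u v).
Proof.
split; first by apply: mvecB => //; exact: mvec_cst.
apply/integrableP; split.
  by apply/measurable_EFinP; apply: measurable_dot; apply: mvecB => //; exact: mvec_cst.
have := hvar u v; rewrite unlock => h; apply: le_lt_trans (ltry s2).
apply: le_trans h; rewrite le_eqVlt; apply/orP; left; apply/eqP.
apply: eq_integral => x _ /=; rewrite enorm_sqn ger0_norm //; exact: sqn_ge0.
Qed.

Let integrable_noise_section u v j :
  mu.-integrable setT (fun x => ((G u v x - gb u v) 0 j)%:E).
Proof.
have [mn jn] := L2_noise_section u v.
have i1 : mu.-integrable setT (fun=> (1 : R)%:E) by exact: integrable_cstR.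
(* A coordinate is dominated by 1 plus the squared norm, so the variance bound yields a finite first
   moment. *)
apply: le_integrable (integrable_add i1 jn) => //.
  by apply/measurable_EFinP; exact: mn.
move=> x _; rewrite !abse_EFin lee_fin [leRHS]ger0_norm ?addr_ge0 ?sqn_ge0 //.
have := coord_sqr_le (G u v x - gb u v) j.
move: ((G u v x - gb u v) 0 j) (sqn _) => a b.
have : 0 <= (`|a| - 1) ^+ 2 by exact: sqr_ge0.
have : 0 <= a ^+ 2 by exact: sqr_ge0.
rewrite sqrrB real_normK ?num_real //; nra.
Qed.

Let mean_noise_section u v j : (\int[mu]_x ((G u v x - gb u v) 0 j)%:E = 0)%E.
Proof.
have iN := integrable_noise_section u v j.
have ic : mu.-integrable setT (fun=> (gb u v 0 j)%:E) by exact: integrable_cstR.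
have : (\int[mu]_x ((G u v x - gb u v) 0 j)%:E + \int[mu]_x (gb u v 0 j)%:E =
   (gb u v 0 j)%:E)%E.
  rewrite -integralD_EFin // -[RHS]hmean unlock; apply: eq_integral => x _.
  by congr (_%:E); rewrite /= !mxE subrK.
have -> : (\int[mu]_x (gb u v 0 j)%:E = (gb u v 0 j)%:E)%E.
  by have := expectation_cst mu (gb u v 0 j); rewrite unlock.
move=> h.
(* Finiteness permits cancelling the mean gradient in the extended reals. *)
have := integrable_fin_num measurableT iN.
move: h; set I0 := (\int[mu]_x _)%E; case: I0 => // r [h] _.
by congr (_%:E); lra.
Qed.

Context {dO : measure_display} {Omega : measurableType dO}.
Variables (P : probability Omega R) (J : finType) (E : J -> set (set Omega)).
Hypothesis indE : mutually_independent P E.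
Hypothesis setIE : forall j, setI_closed (E j).
Hypothesis setTE : forall j, E j setT.
Hypothesis measE : forall j, E j `<=` measurable.
Variables (j0 : J) (xi : {RV P >-> X}).
Hypothesis Exi : forall B, measurable B -> E j0 (xi @^-1` B).
Hypothesis law_xi : forall B, measurable B -> distribution P xi B = mu B.

Variables (U : Omega -> 'rV[R]_du) (V : Omega -> 'rV[R]_dv).
Hypothesis mU : @mvec _ _ (othersType E j0) _ U.
Hypothesis mV : @mvec _ _ (othersType E j0) _ V.

Let noise w := G (U w) (V w) (xi w) - gb (U w) (V w).

Let mvecO k (Z : Omega -> 'rV[R]_k) : @mvec _ _ (othersType E j0) _ Z -> mvec Z.
Proof. by move=> mZ j; apply: measurable_fun_others (mZ j). Qed.

Let mnoise : mvec noise.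
Proof.
by apply: mvecB; [apply: mvec_oracle|apply: mvec_mean] => //; exact: mvecO.
Qed.

Let pt (w : Omega) : T := ([tuple U w 0 j | j < du], [tuple V w 0 j | j < dv]).

Let mpt : measurable_fun [set: othersType E j0] pt.
Proof. by apply: measurable_fun_pair; exact: measurable_tuple_of. Qed.

Let noiseT (p : T * X) := G (row_u p.1) (row_v p.1) p.2 - gb (row_u p.1) (row_v p.1).

Let m_row_u : @mvec _ _ (T * X)%type _ (fun p => row_u p.1).
Proof.
move=> j; under eq_fun do rewrite mxE.
apply: (measurableT_comp (f := fun t : du.-tuple R => tnth t j)).
  exact: measurable_tnth.
exact: measurableT_comp.
Qed.

Let m_row_v : @mvec _ _ (T * X)%type _ (fun p => row_v p.1).
Proof.
move=> j; under eq_fun do rewrite mxE.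
apply: (measurableT_comp (f := fun t : dv.-tuple R => tnth t j)).
  exact: measurable_tnth.
exact: measurableT_comp.
Qed.

Let m_noiseT : mvec noiseT.
Proof. by apply: mvecB; [apply: mvec_oracle|apply: mvec_mean]. Qed.

Let noiseTE w x : noiseT (pt w, x) = G (U w) (V w) x - gb (U w) (V w).
Proof. by rewrite /noiseT /row_u /row_v !row_tuple. Qed.

Let law_integral (f : X -> \bar R) :
  (\int[distribution P xi]_x f x = \int[mu]_x f x)%E.
Proof. by apply: eq_measure_integral => A mA _; exact: law_xi. Qed.

Let var_noise : (\int[P]_w (sqn (noise w))%:E <= s2%:E)%E.
Proof.
pose phi (p : T * X) : \bar R := (sqn (noiseT p))%:E.
have mphi : measurable_fun [set: T * X] phi.
  by apply/measurable_EFinP; exact: measurable_dot.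
have phi0 p : (0 <= phi p)%E by rewrite lee_fin sqn_ge0.
have := ge0_integral_freeze indE setIE setTE measE mpt Exi mphi phi0.
have -> : (\int[P]_w phi (pt w, xi w) = \int[P]_w (sqn (noise w))%:E)%E.
  by apply: eq_integral => w _; rewrite /phi noiseTE.
move=> ->; apply: (@le_trans _ _ (\int[P]_w s2%:E)%E); last first.
  by have := expectation_cst P s2; rewrite unlock => ->.
have hle w : (\int[distribution P xi]_z phi (pt w, z) <= s2%:E)%E.
  rewrite law_integral; apply: le_trans (hvar (U w) (V w)).
  rewrite unlock le_eqVlt; apply/orP; left; apply/eqP; apply: eq_integral => x _.
  by rewrite /phi noiseTE enorm_sqn.
have mF : measurable_fun setT (fun w => \int[distribution P xi]_z phi (pt w, z))%E.
  apply: (measurableT_comp (f := fun p : T => \int[distribution P xi]_z phi (p, z))%E).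
    exact: (@measurable_fun_fubini_tonelli_F _ _ T X R (distribution P xi) phi).
  exact: measurable_fun_others mpt.
have h0 w : (0 <= \int[distribution P xi]_z phi (pt w, z))%E by exact: integral_ge0.
by apply: ge0_le_integral => // w _; exact: le_trans (h0 w) (hle w).
Qed.

Lemma L2_noise : L2 P noise.
Proof.
split=> //; apply/integrableP; split.
  by apply/measurable_EFinP; exact: measurable_dot.
apply: le_lt_trans (ltry s2); apply: le_trans var_noise.
rewrite le_eqVlt; apply/orP; left; apply/eqP; apply: eq_integral => w _ /=.
by rewrite ger0_norm // sqn_ge0.
Qed.

Lemma nsq_noise : L2_ip (toL2 P noise) (toL2 P noise) <= s2.
Proof.
rewrite ip_toL2; try exact: L2_noise.
have [_ iN] := L2_noise; have fN := integrable_fin_num measurableT iN.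
by rewrite /Rintegral -lee_fin fineK //; exact: var_noise.
Qed.

Lemma noise_orthogonal (Z : Omega -> 'rV[R]_d) :
  @mvec _ _ (othersType E j0) _ Z -> L2 P Z ->
  L2_ip (toL2 P Z) (toL2 P noise) = 0.
Proof.
move=> mZ lZ; rewrite ip_toL2 //; last exact: L2_noise.
(* [Z] and the evaluation point are frozen together; the inner integral is then linear in the noise,
   whose coordinates have mean zero. *)
pose pz (w : Omega) : (d.-tuple R * T)%type := ([tuple Z w 0 j | j < d], pt w).
have mpz : measurable_fun [set: othersType E j0] pz.
  by apply: measurable_fun_pair => //; exact: measurable_tuple_of.
pose phi (p : (d.-tuple R * T) * X) : \bar R :=
  (dot (\row_j tnth p.1.1 j) (noiseT (p.1.2, p.2)))%:E.
have mphi : measurable_fun [set: (d.-tuple R * T) * X] phi.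
  apply/measurable_EFinP; apply: measurable_dot.
    move=> j; under eq_fun do rewrite mxE.
    apply: (measurableT_comp (f := fun t : d.-tuple R => tnth t j)).
      exact: measurable_tnth.
    exact: measurableT_comp.
  move=> j.
  apply: (measurableT_comp (m_noiseT j)
    (g := fun p : (d.-tuple R * T) * X => (p.1.2, p.2))).
  by apply: measurable_fun_pair => //; exact: measurableT_comp.
have phiE w x : phi (pz w, x) = (dot (Z w) (G (U w) (V w) x - gb (U w) (V w)))%:E.
  by rewrite /phi /= row_tuple noiseTE.
have iphi : P.-integrable setT (fun w => phi (pz w, xi w)).
  under eq_fun do rewrite phiE.
  by apply: integrable_dot => //; exact: L2_noise.
have := integral_freeze indE setIE setTE measE mpz Exi mphi iphi.
rewrite /Rintegral => e.
transitivity (fine (\int[P]_w phi (pz w, xi w))%E).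
  by congr fine; apply: eq_integral => w _; rewrite phiE.
rewrite e integral0_eq //= => w _.
rewrite law_integral.
under eq_integral do rewrite phiE /dot -sumEFin.
rewrite integral_sum // => [|j]; last first.
  by under eq_fun do rewrite EFinM; apply: integrableZl.
rewrite big1 // => j _.
under eq_integral do rewrite EFinM.
by rewrite integralZl // mean_noise_section mule0.
Qed.

End Oracle.

(** * The trajectory *)

Section Trajectory.
Context {R : realType} {n du dv : nat} {dX : measure_display} {X : measurableType dX}.
Variable F : 'rV[R]_du -> 'rV[R]_dv -> X -> R.
Variables (m K : nat) (gamma_u gamma_v eta_u eta_v : R).
Variables (u0 : 'rV[R]_du) (v0 : 'I_n -> 'rV[R]_dv).
Variable gu : 'I_n -> 'rV[R]_du -> 'rV[R]_dv -> 'rV[R]_du.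

Section Defs.
Context {Y : Type}.
Variables (x : nat -> 'I_n -> nat -> Y -> X) (S : nat -> Y -> {set 'I_n}).

Definition traj t (w : Y) : state R n du dv :=
  scaffoldP F m K gamma_u gamma_v eta_u eta_v u0 v0
    (fun s i k => x s i k w) (fun s => S s w) t.

Definition local t i k (w : Y) : 'rV[R]_du * 'rV[R]_dv :=
  local_steps F gamma_u gamma_v (st_u (traj t w)) (st_v (traj t w) i)
    (st_ci (traj t w) i) (st_c (traj t w)) (fun k => x t.+1 i k w) k.

(** The round is played with a fixed set, so that the randomness of [S t] enters by substitution
    only, as [ip_select] requires. *)
Definition next t (A : {set 'I_n}) (w : Y) : state R n du dv :=
  scaffoldP_round F m K gamma_u gamma_v eta_u eta_v A
    (fun i k => x t.+1 i k w) (traj t w).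

Definition local_grad_u t i k w :=
  grad_u F (local t i k w).1 (local t i k w).2 (x t.+1 i k w).

Definition local_grad_v t i k w :=
  grad_v F (local t i k w).1 (local t i k w).2 (x t.+1 i k w).

Definition local_mean t i w :=
  K%:R^-1 *: \sum_(k < K) gu i (local t i k w).1 (local t i k w).2.

(* [last_u t i] is the shared variable at the last participation of client
   [i], and [mean_ci t i] is its control variate with the sampling noise
   removed. *)
Fixpoint last_u t i (w : Y) : 'rV[R]_du :=
  if t is t'.+1 then
    if i \in S t' w then st_u (traj t' w) else last_u t' i w
  else u0.

Fixpoint mean_ci t i (w : Y) : 'rV[R]_du :=
  if t is t'.+1 then
    if i \in S t' w then local_mean t' i w else mean_ci t' i w
  else gu i u0 (v0 i).

Lemma trajS t w : traj t.+1 w = next t (S t w) w. Proof. by []. Qed.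

Lemma local_uS t i k w : (local t i k.+1 w).1 = (local t i k w).1
  - gamma_u *: (local_grad_u t i k w - st_ci (traj t w) i + st_c (traj t w)).
Proof. by rewrite /local_grad_u /local /=; case: (local_steps _ _ _ _ _ _ _ _ k). Qed.

Lemma local_vS t i k w : (local t i k.+1 w).2 = (local t i k w).2
  - gamma_v *: local_grad_v t i k w.
Proof. by rewrite /local_grad_v /local /=; case: (local_steps _ _ _ _ _ _ _ _ k). Qed.

Lemma local_u_sum t i k w : (local t i k w).1 = st_u (traj t w) - gamma_u *:
  \sum_(l < k) (local_grad_u t i l w - st_ci (traj t w) i + st_c (traj t w)).
Proof.
elim: k => [|k IH]; first by rewrite big_ord0 scaler0 subr0.
by rewrite local_uS IH big_ord_recr /= [in RHS]scalerDr opprD addrA.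
Qed.

Lemma local_v_sum t i k w : (local t i k w).2 = st_v (traj t w) i - gamma_v *:
  \sum_(l < k) local_grad_v t i l w.
Proof.
elim: k => [|k IH]; first by rewrite big_ord0 scaler0 subr0.
by rewrite local_vS IH big_ord_recr /= [in RHS]scalerDr opprD addrA.
Qed.

Hypotheses (K0 : (0 < K)%N) (m0 : (0 < m)%N) (n0 : (0 < n)%N) (gu0 : gamma_u != 0).

Let KR : (K%:R : R) != 0. Proof. by rewrite pnatr_eq0 -lt0n. Qed.
Let mR : (m%:R : R) != 0. Proof. by rewrite pnatr_eq0 -lt0n. Qed.
Let nR : (n%:R : R) != 0. Proof. by rewrite pnatr_eq0 -lt0n. Qed.

(** The local displacement contains K times the old correction, which the update of the control
    variate removes exactly; a plain average of stochastic gradients is left. *)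
Lemma next_ci t A i w : st_ci (next t A w) i =
  if i \in A then K%:R^-1 *: \sum_(k < K) local_grad_u t i k w
  else st_ci (traj t w) i.
Proof.
rewrite /= -/(local t i K w); case: ifP => // _.
rewrite local_u_sum opprB addrCA subrr addr0 scalerA invfM mulfVK //.
rewrite big_split big_split /= !sumr_const card_ord !scalerDr.
rewrite -[- st_ci _ _ *+ K]scaler_nat -[st_c _ *+ K]scaler_nat !scalerA mulVf //.
by rewrite !scale1r addrC addrACA subrK subrr addr0.
Qed.

Lemma traj_c t w : st_c (traj t w) = n%:R^-1 *: \sum_i st_ci (traj t w) i.
Proof.
elim: t => [//|t IH]; rewrite trajS.
rewrite [LHS]/= -/(traj t w) -/(next t (S t w) w) {1}IH -scalerDr; congr (_ *: _).
rewrite [X in _ + X]big_mkcond -big_split; apply: eq_bigr => i _ /=.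
by case: (i \in S t w); rewrite ?addr0 // addrC subrK.
Qed.

Lemma next_v t A i w : st_v (next t A w) i - st_v (traj t w) i =
  if i \in A then - (eta_v * gamma_v * K%:R) *:
    (K%:R^-1 *: \sum_(k < K) local_grad_v t i k w) else 0.
Proof.
rewrite /= -/(local t i K w); case: ifP => _; last by rewrite subrr.
rewrite [in RHS]scalerA mulNr mulfK // local_v_sum.
rewrite scalerBl scale1r scalerBr scalerA addrA subrK addrAC subrr add0r.
by rewrite scaleNr.
Qed.

Lemma next_u t (A : {set 'I_n}) w : #|A| = m -> st_u (next t A w) - st_u (traj t w) =
  - (eta_u * gamma_u * K%:R / m%:R) *: \sum_(i in A)
    (K%:R^-1 *: (\sum_(k < K) local_grad_u t i k w)
     + (st_c (traj t w) - st_ci (traj t w) i)).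
Proof.
move=> Am; rewrite /=.
have -> : \sum_(i in A) (local_steps F gamma_u gamma_v (st_u (traj t w))
    (st_v (traj t w) i) (st_ci (traj t w) i) (st_c (traj t w))
    (x t.+1 i ^~ w) K).1 = \sum_(i in A) (st_u (traj t w) - (gamma_u * K%:R) *:
   (K%:R^-1 *: (\sum_(k < K) local_grad_u t i k w)
     + (st_c (traj t w) - st_ci (traj t w) i))).
  apply: eq_bigr => i _; rewrite -/(local t i K w) local_u_sum; congr (_ - _).
  rewrite -scalerA scalerDr scalerA mulfV // scale1r; congr (_ *: _).
  rewrite (eq_bigr (fun l : 'I_K => local_grad_u t i l w
     + (st_c (traj t w) - st_ci (traj t w) i))); last first.
    by move=> l _; rewrite -addrA (addrC (- _)).
  by rewrite big_split /= sumr_const card_ord scaler_nat.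
(* The size of [A] enters here: the m copies of u restore the part [eta_u *: u] taken away by
   [1 - eta_u]. *)
rewrite sumrB sumr_const Am -scaler_sumr scalerBr -[st_u _ *+ m]scaler_nat scalerA.
rewrite mulfVK // scalerBl scale1r addrA subrK addrAC subrr add0r.
rewrite scalerA -scaleNr; congr (_ *: _); congr (- _).
by rewrite mulrAC mulrA.
Qed.

End Defs.

Section Measurability.
Hypothesis hFmeas_u : jointly_measurable (grad_u F).
Hypothesis hFmeas_v : jointly_measurable (grad_v F).
Hypothesis mgu : forall i (dY : measure_display) (Y : measurableType dY)
  (U : Y -> 'rV[R]_du) (V : Y -> 'rV[R]_dv),
  mvec U -> mvec V -> mvec (fun w => gu i (U w) (V w)).

Context {dY : measure_display} {Y : measurableType dY}.
Variables (x : nat -> 'I_n -> nat -> Y -> X) (S : nat -> Y -> {set 'I_n}).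

Definition mvec_state (s : Y -> state R n du dv) : Prop :=
  [/\ mvec (fun w => st_u (s w)), forall i, mvec (fun w => st_v (s w) i),
      mvec (fun w => st_c (s w)) & forall i, mvec (fun w => st_ci (s w) i)].

Lemma mvec_local t i k : mvec_state (traj x S t) ->
  (forall l, (l < k)%N -> measurable_fun setT (x t.+1 i l)) ->
  mvec (fun w => (local x S t i k w).1) /\ mvec (fun w => (local x S t i k w).2).
Proof.
move=> [ms mv mc mci]; elim: k => [|k IH] mx; first by split=> //=; exact: mv.
have [|mu mw] := IH; first by move=> l lk; apply: mx; exact: ltnW.
have mxk := mx k (ltnSn k); split.
  rewrite (_ : (fun w => _) = fun w => (local x S t i k w).1 - gamma_u *:
      (local_grad_u x S t i k w - st_ci (traj x S t w) i + st_c (traj x S t w))).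
    apply: mvecB => //; apply: mvecZ; apply: mvecD => //; apply: mvecB => //.
    exact: mvec_oracle.
  by apply/funext => w; exact: local_uS.
rewrite (_ : (fun w => _) = fun w => (local x S t i k w).2
    - gamma_v *: local_grad_v x S t i k w).
  apply: mvecB => //; apply: mvecZ; exact: mvec_oracle.
by apply/funext => w; exact: local_vS.
Qed.

Lemma mvec_next t A : mvec_state (traj x S t) ->
  (forall i l, (l < K)%N -> measurable_fun setT (x t.+1 i l)) ->
  mvec_state (next x S t A).
Proof.
move=> hs mx; have [ms mv mc mci] := hs.
have ml i := mvec_local hs (mx i).
have mci' i : mvec (fun w => st_ci (next x S t A w) i).
  rewrite /=; case: (i \in A) => //.
  apply: mvecD; first exact: mvecB.
  by apply: mvecZ; apply: mvecB => //; have [] := ml i.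
split=> //.
- rewrite /=; apply: mvecD; first exact: mvecZ.
  by apply: mvecZ; apply: mvec_sum => i _; have [] := ml i.
- move=> i; rewrite /=; case: (i \in A) => //.
  by apply: mvecD; apply: mvecZ => //; have [] := ml i.
- rewrite /=; apply: mvecD => //; apply: mvecZ; apply: mvec_sum => i _.
  by apply: mvecB => //; exact: mci'.
Qed.

Lemma mvec_set d t (Z : {set 'I_n} -> Y -> 'rV[R]_d) :
  (forall A, measurable (S t @^-1` [set A])) ->
  (forall A, mvec (Z A)) -> mvec (fun w => Z (S t w) w).
Proof.
move=> mS mZ.
have -> : (fun w => Z (S t w) w) =
    (fun w => \sum_(A : {set 'I_n}) (if S t w == A then Z A w else 0)).
  by apply/funext => w; rewrite -big_mkcond (big_pred1 (S t w)).
by apply: mvec_sum => A _; apply: mvec_if => //; exact: mvec_cst.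
Qed.

(** The state at time [t] uses the samples with shifted time at most [t], the initial ones included,
    but only the sets with time below [t]. *)
Lemma mvec_traj t :
  (forall s i l, (s <= t)%N -> (l < K)%N -> measurable_fun setT (x s i l)) ->
  (forall s A, (s < t)%N -> measurable (S s @^-1` [set A])) ->
  mvec_state (traj x S t).
Proof.
elim: t => [|t IH] mx mS.
  have mci i : mvec (fun w => st_ci (traj x S 0 w) i).
    apply: mvecZ; apply: mvec_sum => k _.
    by apply: mvec_oracle => //; try exact: mvec_cst; exact: mx.
  split=> //; try exact: mvec_cst; first by move=> i; exact: mvec_cst.
  by apply: mvecZ; apply: mvec_sum => i _; exact: mci.
have hs : mvec_state (traj x S t).
  by apply: IH => [s i l st lK|s A st]; [apply: mx => //; exact: leqW|apply: mS; exact: leqW].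
have hn A : mvec_state (next x S t A).
  by apply: mvec_next => // i l lK; exact: mx.
have mSt A : measurable (S t @^-1` [set A]) by exact: mS.
split.
- by apply: (mvec_set (Z := fun A w => st_u (next x S t A w))) => // A; have [] := hn A.
- by move=> i; apply: (mvec_set (Z := fun A w => st_v (next x S t A w) i)) => // A; have [] := hn A.
- by apply: (mvec_set (Z := fun A w => st_c (next x S t A w))) => // A; have [] := hn A.
- by move=> i; apply: (mvec_set (Z := fun A w => st_ci (next x S t A w) i)) => // A; have [] := hn A.
Qed.

Lemma mvec_local_mean t i : mvec_state (traj x S t) ->
  (forall l, (l < K)%N -> measurable_fun setT (x t.+1 i l)) ->
  mvec (local_mean x S t i).
Proof.
move=> hs mx; apply: mvecZ; apply: mvec_sum => k _; apply: mgu.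
  by have [] := mvec_local hs (fun l lk => mx l (ltn_trans lk (ltn_ord k))).
by have [] := mvec_local hs (fun l lk => mx l (ltn_trans lk (ltn_ord k))).
Qed.

(** The analysis variables u~_i and a_i use no more randomness than the state itself. *)
Lemma mvec_last_u t i :
  (forall s i l, (s <= t)%N -> (l < K)%N -> measurable_fun setT (x s i l)) ->
  (forall s A, (s < t)%N -> measurable (S s @^-1` [set A])) ->
  mvec (last_u x S t i) /\ mvec (mean_ci x S t i).
Proof.
elim: t => [|t IH] mx mS; first by split; exact: mvec_cst.
have mx' s j l : (s <= t)%N -> (l < K)%N -> measurable_fun setT (x s j l).
  by move=> st lK; apply: mx => //; exact: leqW.
have mS' s A : (s < t)%N -> measurable (S s @^-1` [set A]).
  by move=> st; apply: mS; exact: leqW.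
have hs := mvec_traj mx' mS'; have [ml ma] := IH mx' mS'.
have mSt A : measurable (S t @^-1` [set A]) by exact: mS.
split.
  apply: (mvec_set (Z := fun A w => if i \in A then st_u (traj x S t w) else last_u x S t i w)) => // A.
  by case: (i \in A) => //; have [] := hs.
apply: (mvec_set (Z := fun A w => if i \in A then local_mean x S t i w else mean_ci x S t i w)) => // A.
case: (i \in A) => //; apply: mvec_local_mean => // l lK; exact: mx.
Qed.

End Measurability.

End Trajectory.

(** * Consequences of smoothness *)

Section JointSmoothness.
Context {R : realType} {du dv : nat}.
Variables (f : 'rV[R]_du -> 'rV[R]_dv -> R) (L : R).
Let fu u v := gradient (fun u' => f u' v) u.
Let fv u v := gradient (fun v' => f u v') v.
Hypothesis L0 : 0 <= L.
Hypothesis diff_u : forall u v, differentiable (fun u' => f u' v) u.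
Hypothesis diff_v : forall u v, differentiable (fun v' => f u v') v.
Hypothesis lip_uu : forall u u' v, enorm (fu u v - fu u' v) <= L * enorm (u - u').
Hypothesis lip_vv : forall u v v', enorm (fv u v - fv u v') <= L * enorm (v - v').
Hypothesis lip_vu : forall u u' v, enorm (fv u v - fv u' v) <= L * enorm (u - u').

(** First u moves, then v. The v-gradient at the moved u costs L |h| |k|, at most L/2 (|h|^2 +
    |k|^2), which raises the usual L/2 to L. Joint differentiability is never invoked. *)
Lemma joint_descent u v h k : f (u + h) (v + k) <=
  f u v + dot (fu u v) h + dot (fv u v) k + L * sqn h + L * sqn k.
Proof.
have h1 := lipschitz_gradient_le (f := fun u' => f u' v) (x := u) h L0
   (fun y => diff_u y v) (fun y => lip_uu y u v).
have h2 := lipschitz_gradient_le (f := fun v' => f (u + h) v') (x := v) k L0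
   (fun y => diff_v (u + h) y) (fun y => lip_vv (u + h) y v).
have h3 : dot (fv (u + h) v - fv u v) k <= L * enorm h * enorm k.
  apply: le_trans (dot_le_enorm _ _) _; rewrite ler_wpM2r ?enorm_ge0 //.
  by have := lip_vu (u + h) u v; rewrite (addrC u) addrK.
rewrite dotDl dotNl in h3.
rewrite -/(fu u v) in h1; rewrite -/(fv (u + h) v) in h2.
have h4 : L * (2 * (enorm h * enorm k)) <= L * (enorm h ^+ 2 + enorm k ^+ 2).
  by rewrite ler_wpM2l //; have := sqr_ge0 (enorm h - enorm k); rewrite sqrrB; lra.
rewrite !enorm_sqn in h4; lra.
Qed.

End JointSmoothness.

Section GradientLipschitz.
Context {R : realType} {du dv d : nat}.
Variables (g : 'rV[R]_du -> 'rV[R]_dv -> 'rV[R]_d) (L : R).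
Hypothesis L0 : 0 <= L.
Hypothesis lip_u : forall u u' v, enorm (g u v - g u' v) <= L * enorm (u - u').
Hypothesis lip_v : forall u v v', enorm (g u v - g u v') <= L * enorm (v - v').

Lemma sqn_lip_u u u' v : sqn (g u v - g u' v) <= L ^+ 2 * sqn (u - u').
Proof.
rewrite -!enorm_sqn -exprMn lerXn2r ?nnegrE ?enorm_ge0 ?lip_u //.
by rewrite mulr_ge0 ?enorm_ge0.
Qed.

Lemma sqn_lip_v u v v' : sqn (g u v - g u v') <= L ^+ 2 * sqn (v - v').
Proof.
rewrite -!enorm_sqn -exprMn lerXn2r ?nnegrE ?enorm_ge0 ?lip_v //.
by rewrite mulr_ge0 ?enorm_ge0.
Qed.

Lemma sqn_lip u u' v v' : sqn (g u v - g u' v') <=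
  2 * L ^+ 2 * sqn (u - u') + 2 * L ^+ 2 * sqn (v - v').
Proof.
have -> : g u v - g u' v' = (g u v - g u' v) + (g u' v - g u' v').
  by rewrite addrA subrK.
apply: le_trans (sqnD_le _ _) _.
by have := sqn_lip_u u u' v; have := sqn_lip_v u' v v'; lra.
Qed.

Lemma L2_lipschitz {dO : measure_display} {Omega : measurableType dO}
    (P : probability Omega R) (U : Omega -> 'rV[R]_du) (V : Omega -> 'rV[R]_dv) :
  mvec (fun w => g (U w) (V w)) -> L2 P U -> L2 P V ->
  L2 P (fun w => g (U w) (V w)).
Proof.
move=> mg lU lV.
apply: (L2_dominated (h := fun w => 2 * sqn (g 0 0) + (4 * L ^+ 2 * sqn (U w)
   + 4 * L ^+ 2 * sqn (V w)))) => //.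
  move=> w; have := sqn_lip (U w) 0 (V w) 0; rewrite !subr0.
  have := sqnD_le (g 0 0) (g (U w) (V w) - g 0 0); rewrite addrC subrK; lra.
apply: integrable_add; first exact: integrable_cstR.
by apply: integrable_add; apply: integrable_scale; [case: lU|case: lV].
Qed.

End GradientLipschitz.

Lemma gradient_fglob (R : realType) (n du dv : nat) (dX : measure_display)
    (X : measurableType dX) (D : 'I_n -> probability X R)
    (F : 'rV[R]_du -> 'rV[R]_dv -> X -> R) (u : 'rV[R]_du) (v : 'I_n -> 'rV[R]_dv) :
  (forall i, differentiable (fun u' => floc D F i u' (v i)) u) ->
  gradient (fun u' => fglob D F u' v) u =
  n%:R^-1 *: \sum_i gradient (fun u' => floc D F i u' (v i)) u.
Proof.
move=> df; apply/rowP => j; rewrite !mxE summxE.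
have -> : (fun u' => fglob D F u' v) =
    n%:R^-1 \*: (\sum_(i < n) (fun u' => floc D F i u' (v i))).
  by apply/funext => u'; rewrite /fglob /= fct_sumE.
have dd i : derivable (fun u' => floc D F i u' (v i)) u (delta_mx 0 j).
  exact: diff_derivable.
rewrite deriveZ; last exact: derivable_sum.
rewrite derive_sum // /GRing.scale /=; congr (_ * _).
by apply: eq_bigr => i _; rewrite mxE.
Qed.

(** * Summation over the rounds *)

(** [d] stands for the expected increments of the objective; they are kept as a sum of their own,
    since they are not differences of a given real sequence. *)
Lemma telescope_le (R : realFieldType) (a c : R) (g d y : nat -> R) (s : nat) :
  (forall t, (t < s)%N -> d t + y t.+1 <= y t - a * g t + c) ->
  a * (\sum_(t < s) g t) + \sum_(t < s) d t + y s <= y 0 + s%:R * c.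
Proof.
elim: s => [|s IH] h; first by rewrite !big_ord0 mulr0 mul0r !(add0r, addr0).
have := IH (fun t ht => h t (ltnW ht)); have := h s (ltnSn s).
by rewrite !big_ord_recr /= -natr1; lra.
Qed.

(** * The run as a random process *)

Section Run.
Context {R : realType} {n m K T du dv : nat}.
Hypotheses (hm : (1 <= m <= n)%N) (hK : (1 <= K)%N).
Context {dX : measure_display} {X : measurableType dX}.
Variables (D : 'I_n -> probability X R) (F : 'rV[R]_du -> 'rV[R]_dv -> X -> R).
Hypothesis hFmeas_u : jointly_measurable (grad_u F).
Hypothesis hFmeas_v : jointly_measurable (grad_v F).
Variables (L sigma_u sigma_v : R).
Hypothesis L0 : 0 < L.

Let gu i u v := gradient (fun w => floc D F i w v) u.
Let gv i u v := gradient (fun w => floc D F i u w) v.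

Hypothesis hdiff_u : forall i u v, differentiable (fun u' => floc D F i u' v) u.
Hypothesis hdiff_v : forall i u v, differentiable (fun v' => floc D F i u v') v.
Hypothesis lip_uu : forall i u u' v, enorm (gu i u v - gu i u' v) <= L * enorm (u - u').
Hypothesis lip_uv : forall i u v v', enorm (gu i u v - gu i u v') <= L * enorm (v - v').
Hypothesis lip_vv : forall i u v v', enorm (gv i u v - gv i u v') <= L * enorm (v - v').
Hypothesis lip_vu : forall i u u' v, enorm (gv i u v - gv i u' v) <= L * enorm (u - u').

Hypothesis hmean_u : forall i u v j,
  ('E_(D i)[fun x => grad_u F u v x 0%R j] = (gu i u v 0%R j)%:E)%E.
Hypothesis hmean_v : forall i u v j,
  ('E_(D i)[fun x => grad_v F u v x 0%R j] = (gv i u v 0%R j)%:E)%E.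
Hypothesis hvar_u : forall i u v,
  ('E_(D i)[fun x => (enorm (grad_u F u v x - gu i u v) ^+ 2)%R]
   <= (sigma_u ^+ 2)%:E)%E.
Hypothesis hvar_v : forall i u v,
  ('E_(D i)[fun x => (enorm (grad_v F u v x - gv i u v) ^+ 2)%R]
   <= (sigma_v ^+ 2)%:E)%E.

Context {dO : measure_display} {Omega : measurableType dO}.
Variable P : probability Omega R.
Variables (xi : nat -> 'I_n -> nat -> {RV P >-> X}) (S : nat -> Omega -> {set 'I_n}).
Hypothesis hxi : forall s i k, (s <= T)%N -> (k < K)%N ->
  forall A : set X, measurable A -> distribution P (xi s i k) A = D i A.
Hypothesis hS : forall t, (t < T)%N -> uniform_subset P m (S t).
Let E := @run_events _ _ _ _ _ P n K T xi S.
Hypothesis hindep : mutually_independent P E.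

Variables (u0 : 'rV[R]_du) (v0 : 'I_n -> 'rV[R]_dv).
Variables (gamma_u gamma_v eta_u eta_v : R).
Hypothesis hgu : 0 < gamma_u.

Let x s i k : Omega -> X := xi s i k.
Let st := traj F m K gamma_u gamma_v eta_u eta_v u0 v0 x S.
Let loc := local F m K gamma_u gamma_v eta_u eta_v u0 v0 x S.
Let nst := next F m K gamma_u gamma_v eta_u eta_v u0 v0 x S.
Let Gu := local_grad_u F m K gamma_u gamma_v eta_u eta_v u0 v0 x S.
Let Gv := local_grad_v F m K gamma_u gamma_v eta_u eta_v u0 v0 x S.
Let lmean := local_mean F m K gamma_u gamma_v eta_u eta_v u0 v0 gu x S.
Let lastu := last_u F m K gamma_u gamma_v eta_u eta_v u0 v0 x S.
Let meanc := mean_ci F m K gamma_u gamma_v eta_u eta_v u0 v0 gu x S.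

Let m0 : (0 < m)%N. Proof. by case/andP: hm. Qed.
Let n0 : (0 < n)%N. Proof. by case/andP: hm => h; exact: leq_trans. Qed.

Lemma run_setI j : setI_closed (E j).
Proof.
case: j => [[[s i] k]|t] A B [A' mA <-] [B' mB <-].
  by exists (A' `&` B'); [exact: measurableI|rewrite !setTI].
by exists (A' `&` B') => //; rewrite !setTI.
Qed.

Lemma run_setT j : E j setT.
Proof. by case: j => [[[s i] k]|t]; exists setT => //; rewrite setTI. Qed.

Lemma run_measurable j : E j `<=` measurable.
Proof.
case: j => [[[s i] k]|t] A [B mB <-]; rewrite setTI.
  by rewrite -[X in measurable X]setTI; exact: measurable_funPT.
(* Measurability is given for single values of [S t]; there are finitely many. *)
rewrite (_ : _ @^-1` _ = \bigcup_(C in B) (S t @^-1` [set C])).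
  apply: fin_bigcup_measurable => [|C _]; first exact: finite_finset.
  by have [] := hS (ltn_ord t) C.
apply/seteqP; split => [w Bw|w [C BC SC]]; first by exists (S t w).
by rewrite /preimage /= SC.
Qed.

Definition sample_index s i k (hs : (s < T.+1)%N) (hk : (k < K)%N) :
  ('I_T.+1 * 'I_n * 'I_K) + 'I_T := inl (Ordinal hs, i, Ordinal hk).

Definition set_index t (ht : (t < T)%N) :
  ('I_T.+1 * 'I_n * 'I_K) + 'I_T := inr (Ordinal ht).

Lemma sample_events s i k (hs : (s < T.+1)%N) (hk : (k < K)%N) B :
  measurable B -> E (sample_index i hs hk) (xi s i k @^-1` B).
Proof. by move=> mB; exists B; rewrite // setTI. Qed.

Lemma set_events t (ht : (t < T)%N) B : E (set_index ht) (S t @^-1` B).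
Proof. by exists B; rewrite // setTI. Qed.

Lemma sample_others j0 s i k (hs : (s < T.+1)%N) (hk : (k < K)%N) :
  sample_index i hs hk != j0 ->
  measurable_fun [set: othersType E j0] (xi s i k).
Proof.
move=> jj0 _ B mB; rewrite setTI; apply: sub_sigma_algebra.
by apply: (others_subset run_setT jj0); exact: sample_events.
Qed.

Lemma set_others j0 t (ht : (t < T)%N) A : set_index ht != j0 ->
  @measurable _ (othersType E j0) (S t @^-1` [set A]).
Proof.
move=> jj0; apply: sub_sigma_algebra.
by apply: (others_subset run_setT jj0); exact: set_events.
Qed.

Let mgu i (dY : measure_display) (Y : measurableType dY)
  (U : Y -> 'rV[R]_du) (V : Y -> 'rV[R]_dv) :
  mvec U -> mvec V -> mvec (fun w => gu i (U w) (V w)).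
Proof. exact: (mvec_mean hFmeas_u (hmean_u i)). Qed.

Let mgv i (dY : measure_display) (Y : measurableType dY)
  (U : Y -> 'rV[R]_du) (V : Y -> 'rV[R]_dv) :
  mvec U -> mvec V -> mvec (fun w => gv i (U w) (V w)).
Proof. exact: (mvec_mean hFmeas_v (hmean_v i)). Qed.

Section Past.
Variables (t : nat) (j0 : ('I_T.+1 * 'I_n * 'I_K) + 'I_T).
Hypothesis tT : (t <= T)%N.
Hypothesis past_sample : forall s i k (hs : (s < T.+1)%N) (hk : (k < K)%N),
  (s <= t)%N -> sample_index i hs hk != j0.
Hypothesis past_set : forall s (hs : (s < T)%N), (s < t)%N -> set_index hs != j0.

Let Y := othersType E j0.

Let mx s i l : (s <= t)%N -> (l < K)%N -> measurable_fun [set: Y] (x s i l).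
Proof.
move=> le_st lK; have hs : (s < T.+1)%N by rewrite ltnS (leq_trans le_st).
exact: sample_others (past_sample i hs lK le_st).
Qed.

Let mS s A : (s < t)%N -> @measurable _ Y (S s @^-1` [set A]).
Proof.
by move=> lt_st; have hs := leq_trans lt_st tT; exact: set_others (past_set hs lt_st).
Qed.

(** The source [j0] is kept abstract because it will be a sample of round [t] as well as the set of
    round [t]. *)
Lemma past_traj : @mvec_state _ n du dv _ Y (st t).
Proof. exact: (@mvec_traj _ _ _ _ _ _ F m K _ _ _ _ u0 v0 hFmeas_u hFmeas_v _ Y x S). Qed.

Lemma past_last i : @mvec _ _ Y _ (lastu t i) /\ @mvec _ _ Y _ (meanc t i).
Proof.
exact: (@mvec_last_u _ _ _ _ _ _ F m K _ _ _ _ u0 v0 gu hFmeas_u hFmeas_v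
  mgu _ Y x S).
Qed.

Lemma past_local i k :
  (forall l (hl : (l < K)%N) (hs : (t.+1 < T.+1)%N), (l < k)%N ->
     sample_index i hs hl != j0) ->
  (t < T)%N -> (k <= K)%N ->
  @mvec _ _ Y _ (fun w => (loc t i k w).1) /\ @mvec _ _ Y _ (fun w => (loc t i k w).2).
Proof.
move=> hl tT' kK.
apply: (@mvec_local _ _ _ _ _ _ F m K _ _ _ _ u0 v0 hFmeas_u hFmeas_v _ Y x S).
  exact: past_traj.
move=> l lk; have lK := leq_trans lk kK.
exact: sample_others (hl l lK tT' lk).
Qed.

End Past.

Lemma sample_index_neq s i k hs hk s' i' k' hs' hk' :
  [|| s != s', i != i' | k != k'] ->
  @sample_index s i k hs hk != @sample_index s' i' k' hs' hk'.
Proof.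
apply: contraL => /eqP[-> -> ->]; by rewrite !eqxx.
Qed.

Lemma sample_past t i k (hs : (t.+1 < T.+1)%N) (hk : (k < K)%N) s i' k'
    (hs' : (s < T.+1)%N) (hk' : (k' < K)%N) :
  (s <= t)%N -> sample_index i' hs' hk' != sample_index i hs hk.
Proof. by move=> le_st; apply: sample_index_neq; rewrite neq_ltn ltnS le_st. Qed.

Lemma noise_traj t i k (hs : (t.+1 < T.+1)%N) (hk : (k < K)%N) :
  @mvec_state _ n du dv _ (othersType E (sample_index i hs hk)) (st t).
Proof.
apply: past_traj => //; first exact: ltnW.
by move=> *; exact: sample_past.
Qed.

Lemma noise_last t i k (hs : (t.+1 < T.+1)%N) (hk : (k < K)%N) j :
  @mvec _ _ (othersType E (sample_index i hs hk)) _ (lastu t j) /\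
  @mvec _ _ (othersType E (sample_index i hs hk)) _ (meanc t j).
Proof.
apply: past_last => //; first exact: ltnW.
by move=> *; exact: sample_past.
Qed.

(** Iterate [l] uses the samples 0, ..., l - 1 of its own client in the current round, so sample [k]
    is avoided up to and including l = k. *)
Lemma noise_local t i k (hs : (t.+1 < T.+1)%N) (hk : (k < K)%N) j l :
  (l <= K)%N -> (i != j) || (l <= k)%N ->
  @mvec _ _ (othersType E (sample_index i hs hk)) _ (fun w => (loc t j l w).1) /\
  @mvec _ _ (othersType E (sample_index i hs hk)) _ (fun w => (loc t j l w).2).
Proof.
move=> lK ijl; apply: past_local => //; first exact: ltnW.
  by move=> *; exact: sample_past.
move=> l' hl' hs' l'l; apply: sample_index_neq; rewrite eqxx /=.
case/orP: ijl => [ij|lk]; first by rewrite eq_sym ij.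
by rewrite (ltn_eqF (leq_trans l'l lk)) orbT.
Qed.

Let gu_noise t i k w := Gu t i k w - gu i (loc t i k w).1 (loc t i k w).2.
Let gv_noise t i k w := Gv t i k w - gv i (loc t i k w).1 (loc t i k w).2.

Let L2_gu i U V : mvec (fun w => gu i (U w) (V w)) -> L2 P U -> L2 P V ->
  L2 P (fun w => gu i (U w) (V w)).
Proof. exact: (L2_lipschitz (ltW L0) (lip_uu i) (lip_uv i)). Qed.

Let L2_gv i U V : mvec (fun w => gv i (U w) (V w)) -> L2 P U -> L2 P V ->
  L2 P (fun w => gv i (U w) (V w)).
Proof. exact: (L2_lipschitz (ltW L0) (lip_vu i) (lip_vv i)). Qed.

Section Sample.
Variables (t : nat) (i : 'I_n) (k : nat).
Hypotheses (ht : (t < T)%N) (hk : (k < K)%N).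

Let j0 := sample_index i (ht : (t.+1 < T.+1)%N) hk.

Let mloc : @mvec _ _ (othersType E j0) _ (fun w => (loc t i k w).1) /\
  @mvec _ _ (othersType E j0) _ (fun w => (loc t i k w).2).
Proof. by apply: noise_local; [exact: ltnW|rewrite leqnn orbT]. Qed.

Let Exi B : measurable B -> E j0 (xi t.+1 i k @^-1` B).
Proof. exact: sample_events. Qed.

Let law : forall B, measurable B -> distribution P (xi t.+1 i k) B = D i B.
Proof. exact: hxi. Qed.

(** No moment of the iterate is needed, as the variance bound is uniform in the point. Hence the
    noise can be used to prove that the iterates are square-integrable. *)
Lemma L2_gu_noise : L2 P (gu_noise t i k).
Proof.
exact: (L2_noise hFmeas_u (hmean_u i) (hvar_u i) hindep run_setI run_setT
  run_measurable Exi law mloc.1 mloc.2).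
Qed.

Lemma L2_gv_noise : L2 P (gv_noise t i k).
Proof.
exact: (L2_noise hFmeas_v (hmean_v i) (hvar_v i) hindep run_setI run_setT
  run_measurable Exi law mloc.1 mloc.2).
Qed.

Lemma nsq_gu_noise :
  L2_ip (toL2 P (gu_noise t i k)) (toL2 P (gu_noise t i k)) <= sigma_u ^+ 2.
Proof.
exact: (nsq_noise hFmeas_u (hmean_u i) (hvar_u i) hindep run_setI run_setT
  run_measurable Exi law mloc.1 mloc.2).
Qed.

Lemma nsq_gv_noise :
  L2_ip (toL2 P (gv_noise t i k)) (toL2 P (gv_noise t i k)) <= sigma_v ^+ 2.
Proof.
exact: (nsq_noise hFmeas_v (hmean_v i) (hvar_v i) hindep run_setI run_setT
  run_measurable Exi law mloc.1 mloc.2).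
Qed.

Lemma gu_noise_orthogonal (Z : Omega -> 'rV[R]_du) :
  @mvec _ _ (othersType E j0) _ Z -> L2 P Z ->
  L2_ip (toL2 P Z) (toL2 P (gu_noise t i k)) = 0.
Proof.
exact: (noise_orthogonal hFmeas_u (hmean_u i) (hvar_u i) hindep run_setI run_setT
  run_measurable Exi law mloc.1 mloc.2).
Qed.

Lemma gv_noise_orthogonal (Z : Omega -> 'rV[R]_dv) :
  @mvec _ _ (othersType E j0) _ Z -> L2 P Z ->
  L2_ip (toL2 P Z) (toL2 P (gv_noise t i k)) = 0.
Proof.
exact: (noise_orthogonal hFmeas_v (hmean_v i) (hvar_v i) hindep run_setI run_setT
  run_measurable Exi law mloc.1 mloc.2).
Qed.

Hypotheses (lU : L2 P (fun w => (loc t i k w).1)) (lV : L2 P (fun w => (loc t i k w).2)).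

Lemma L2_local_gu : L2 P (fun w => gu i (loc t i k w).1 (loc t i k w).2).
Proof. by apply: L2_gu => //; apply: mgu; [case: lU|case: lV]. Qed.

Lemma L2_local_gv : L2 P (fun w => gv i (loc t i k w).1 (loc t i k w).2).
Proof. by apply: L2_gv => //; apply: mgv; [case: lU|case: lV]. Qed.

Lemma L2_local_grad : L2 P (Gu t i k) /\ L2 P (Gv t i k).
Proof.
split.
  have := L2D L2_gu_noise L2_local_gu.
  by under [X in L2 _ X -> _]eq_fun do rewrite /gu_noise subrK.
have := L2D L2_gv_noise L2_local_gv.
by under [X in L2 _ X -> _]eq_fun do rewrite /gv_noise subrK.
Qed.

End Sample.

Section InitialSample.
Variable i : 'I_n.

Let c0_noise k w := grad_u F u0 (v0 i) (xi 0 i k w) - gu i u0 (v0 i).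

Let mcst (c : 'rV[R]_du) k (hk : (k < K)%N) :
  @mvec _ _ (othersType E (sample_index i (ltn0Sn T) hk)) _ (fun=> c).
Proof. exact: mvec_cst. Qed.

Let mcst' (c : 'rV[R]_dv) k (hk : (k < K)%N) :
  @mvec _ _ (othersType E (sample_index i (ltn0Sn T) hk)) _ (fun=> c).
Proof. exact: mvec_cst. Qed.

Let law0 k : (k < K)%N -> forall B, measurable B -> distribution P (xi 0 i k) B = D i B.
Proof. exact: hxi. Qed.

Let L2_c0_noise k : (k < K)%N -> L2 P (c0_noise k).
Proof.
move=> hk.
exact: (L2_noise hFmeas_u (hmean_u i) (hvar_u i) hindep run_setI run_setT
  run_measurable (sample_events i (ltn0Sn T) hk) (law0 hk) (@mcst u0 k hk) (@mcst' (v0 i) k hk)).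
Qed.

Lemma L2_init_ci : L2 P (fun w => st_ci (st 0 w) i).
Proof.
apply: L2Z; apply: L2_sum => k _.
have := L2D (L2_c0_noise (ltn_ord k)) (L2_cst P (gu i u0 (v0 i))).
by under [X in L2 _ X -> _]eq_fun do rewrite /c0_noise subrK.
Qed.

(** Base case of the noise bound for the control variates: K independent samples at a deterministic
    point. *)
Lemma init_ci_var : nsq (toL2 P (fun w => st_ci (st 0 w) i - meanc 0 i w) : L2space P du)
  <= sigma_u ^+ 2 / K%:R.
Proof.
have -> : toL2 P (fun w => st_ci (st 0 w) i - meanc 0 i w) =
    K%:R^-1 *: \sum_(k < K) toL2 P (c0_noise k).
  apply: L2v_ext => w; rewrite !L2vE toL2K; last first.
    by apply: L2B; [exact: L2_init_ci|exact: L2_cst].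
  rewrite /= [in RHS](eq_bigr (fun k : 'I_K => grad_u F u0 (v0 i) (xi 0 i k w) - gu i u0 (v0 i))).
    rewrite sumrB sumr_const card_ord scalerBr -[gu _ _ _ *+ K]scaler_nat scalerA.
    by rewrite mulVf ?pnatr_eq0 -?lt0n // scale1r.
  by move=> k _; rewrite toL2K //; exact: L2_c0_noise.
have := @nsq_avg_orthogonal_le R (L2space P du) _ (fun k : 'I_K => toL2 P (c0_noise k)) (sigma_u ^+ 2).
rewrite card_ord; apply=> // [k l kl|k].
  apply: (noise_orthogonal hFmeas_u (hmean_u i) (hvar_u i) hindep run_setI run_setT
    run_measurable (sample_events i (ltn0Sn T) (ltn_ord l)) (law0 (ltn_ord l))
    (@mcst u0 l (ltn_ord l)) (@mcst' (v0 i) l (ltn_ord l))); last exact: L2_c0_noise.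
  apply: mvecB; last exact: mcst.
  apply: mvec_oracle => //; try exact: mvec_cst.
  apply: (sample_others (hs := ltn0Sn T) (hk := ltn_ord k)); apply: sample_index_neq.
  by rewrite eqxx eqxx /=; exact: kl.
exact: (nsq_noise hFmeas_u (hmean_u i) (hvar_u i) hindep run_setI run_setT
  run_measurable (sample_events i (ltn0Sn T) (ltn_ord k)) (law0 (ltn_ord k))
    (@mcst u0 k (ltn_ord k)) (@mcst' (v0 i) k (ltn_ord k))).
Qed.

End InitialSample.

Let L2_st_c t : (forall i, L2 P (fun w => st_ci (st t w) i)) -> L2 P (fun w => st_c (st t w)).
Proof.
move=> lci; rewrite (_ : (fun w => _) = fun w => n%:R^-1 *: \sum_i st_ci (st t w) i).
  by apply: L2Z; apply: L2_sum.
by apply/funext => w; exact: traj_c.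
Qed.

Let L2_loc_step t : (t < T)%N -> L2 P (fun w => st_u (st t w)) ->
  (forall i, L2 P (fun w => st_v (st t w) i)) ->
  (forall i, L2 P (fun w => st_ci (st t w) i)) ->
  forall i k, (k <= K)%N ->
  L2 P (fun w => (loc t i k w).1) /\ L2 P (fun w => (loc t i k w).2).
Proof.
move=> ht lu lv lci i; elim=> [|k IH] hk; first by split; [exact: lu|exact: lv].
have [l1 l2] := IH (ltnW hk).
have [lG lH] := L2_local_grad ht hk l1 l2.
split.
  rewrite (_ : (fun w => _) = fun w => (loc t i k w).1 - gamma_u *:
      (Gu t i k w - st_ci (st t w) i + st_c (st t w))).
    apply: L2B => //; apply: L2Z; apply: L2D; last exact: L2_st_c.
    exact: L2B.
  by apply/funext => w; exact: local_uS.
rewrite (_ : (fun w => _) = fun w => (loc t i k w).2 - gamma_v *: Gv t i k w).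
  by apply: L2B => //; exact: L2Z.
by apply/funext => w; exact: local_vS.
Qed.

(** Finite second moments must precede all estimates, since [toL2] is faithful only on them. They
    propagate because mean gradients grow linearly, the noise is bounded in mean square and the
    drawn set takes finitely many values. *)
Lemma L2_run t : (t <= T)%N ->
  [/\ L2 P (fun w => st_u (st t w)), forall i, L2 P (fun w => st_v (st t w) i),
      forall i, L2 P (fun w => st_ci (st t w) i), forall i, L2 P (lastu t i)
    & forall i, L2 P (meanc t i)].
Proof.
elim: t => [_|t IH ht].
  split; [exact: L2_cst|by move=> i; exact: L2_cst|exact: L2_init_ci|..];
  by move=> i; exact: L2_cst.
have [lu lv lci ll lm] := IH (ltnW ht).
have lloc := L2_loc_step ht lu lv lci.
have lc := L2_st_c lci.
have sel d (Z : {set 'I_n} -> Omega -> 'rV[R]_d) :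
  (forall A, L2 P (Z A)) -> L2 P (fun w => Z (S t w) w) by apply: L2_select; exact: hS.
split.
- apply: (sel _ (fun A w => st_u (nst t A w))) => A; apply: L2D; apply: L2Z => //.
  by apply: L2_sum => i _; have [] := lloc i K (leqnn K).
- move=> i; apply: (sel _ (fun A w => st_v (nst t A w) i)) => A.
  rewrite /nst /next /=; case: (i \in A); last exact: lv.
  by apply: L2D; apply: L2Z; [exact: lv|have [] := lloc i K (leqnn K)].
- move=> i; apply: (sel _ (fun A w => st_ci (nst t A w) i)) => A.
  rewrite /nst /next /=; case: (i \in A); last exact: lci.
  apply: L2D; first exact: L2B.
  by apply: L2Z; apply: L2B => //; have [] := lloc i K (leqnn K).
- move=> i; apply: (sel _ (fun A w => if i \in A then st_u (st t w) else lastu t i w)) => A.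
  by case: (i \in A).
- move=> i; apply: (sel _ (fun A w => if i \in A then lmean t i w else meanc t i w)) => A.
  case: (i \in A) => //; apply: L2Z; apply: L2_sum => k _.
  by have [l1 l2] := lloc i k (ltnW (ltn_ord k)); exact: L2_local_gu.
Qed.

Variable gam : R.
Hypothesis gam_u : gamma_u * eta_u = gam.
Hypothesis gam_v : gamma_v * eta_v = gam.

Let Eu := L2space P du.
Let Ev := L2space P dv.

Let du_w t A w := st_u (nst t A w) - st_u (st t w).
Let dv_w t i w := - (gam * K%:R) *: (K%:R^-1 *: \sum_(k < K) Gv t i k w).
Let grad_w t i w := gu i (st_u (st t w)) (st_v (st t w) i).
Let gradv_w t i w := gv i (st_u (st t w)) (st_v (st t w) i).
Let lag_w t i w := st_u (st t w) - lastu t i w.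
Let stale_w t i w := gu i (lastu t i w) (st_v (st t w) i) - meanc t i w.
(** Staleness after taking part: u~_i becomes the u from the start of the round, whereas v_i has
    already moved. *)
Let fresh_w t i w :=
  gu i (st_u (st t w)) (st_v (st t w) i + dv_w t i w) - lmean t i w.

Let lag2 t := n%:R^-1 * \sum_i nsq (toL2 P (lag_w t i) : Eu).
Let stale2 t := n%:R^-1 * \sum_i nsq (toL2 P (stale_w t i) : Eu).
Let noise2 t i := nsq (toL2 P (fun w => st_ci (st t w) i - meanc t i w) : Eu).
Let grad2 t := nsq (toL2 P (fun w => n%:R^-1 *: \sum_i grad_w t i w) : Eu).
Let gradv2 t := m%:R / n%:R ^+ 2 * \sum_i nsq (toL2 P (gradv_w t i) : Ev).
Let step_u_w t w := st_u (st t.+1 w) - st_u (st t w).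
Let step_v_w t i w := st_v (st t.+1 w) i - st_v (st t w) i.
(** The expectation of the pathwise bound [decrease_w], written with inner products so that
    [round_progress] applies. *)
Let decrease t :=
  ip (toL2 P (fun w => n%:R^-1 *: \sum_i grad_w t i w) : Eu) (toL2 P (step_u_w t))
  + n%:R^-1 * \sum_i ip (toL2 P (gradv_w t i) : Ev) (toL2 P (step_v_w t i))
  + (L * nsq (toL2 P (step_u_w t) : Eu)
     + L * (n%:R^-1 * \sum_i nsq (toL2 P (step_v_w t i) : Ev))).

Hypothesis gam0 : 0 < gam.
Hypothesis hgu2 : gamma_u ^+ 2 <= gam ^+ 2 / m%:R.
Hypothesis hgv2 : gamma_v ^+ 2 <= gam ^+ 2 * (m%:R / n%:R).
Hypothesis small1 : gam * K%:R * L <= 1 / 72.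
Hypothesis small2 : (gam * K%:R * L) ^+ 2 * n%:R / m%:R ^+ 2 <= 1 / 72 ^+ 2.
Hypothesis small3 : (gam * K%:R * L) ^+ 3 * n%:R ^+ 2 / m%:R ^+ 3 <= 1 / 72 ^+ 3.

(** * One round of the run *)

Section At.
Variable t : nat.
Hypothesis ht : (t < T)%N.

Let l_u : L2 P (fun w => st_u (st t w)). Proof. by have [] := L2_run (ltnW ht). Qed.
Let l_v i : L2 P (fun w => st_v (st t w) i). Proof. by have [] := L2_run (ltnW ht). Qed.
Let l_ci i : L2 P (fun w => st_ci (st t w) i). Proof. by have [] := L2_run (ltnW ht). Qed.
Let l_last i : L2 P (lastu t i). Proof. by have [] := L2_run (ltnW ht). Qed.
Let l_mean i : L2 P (meanc t i). Proof. by have [] := L2_run (ltnW ht). Qed.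
Let l_c : L2 P (fun w => st_c (st t w)). Proof. exact: L2_st_c. Qed.

Let l_loc i k : (k <= K)%N ->
  L2 P (fun w => (loc t i k w).1) /\ L2 P (fun w => (loc t i k w).2).
Proof. exact: L2_loc_step. Qed.

Let l_G i k : (k < K)%N -> L2 P (Gu t i k).
Proof. by move=> hk; have [l1 l2] := l_loc i (ltnW hk); have [] := L2_local_grad ht hk l1 l2. Qed.
Let l_H i k : (k < K)%N -> L2 P (Gv t i k).
Proof. by move=> hk; have [l1 l2] := l_loc i (ltnW hk); have [] := L2_local_grad ht hk l1 l2. Qed.
Let l_p i k : (k < K)%N -> L2 P (fun w => gu i (loc t i k w).1 (loc t i k w).2).
Proof. by move=> hk; have [l1 l2] := l_loc i (ltnW hk); exact: L2_local_gu. Qed.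
Let l_q i k : (k < K)%N -> L2 P (fun w => gv i (loc t i k w).1 (loc t i k w).2).
Proof. by move=> hk; have [l1 l2] := l_loc i (ltnW hk); exact: L2_local_gv. Qed.

Let l_lmean i : L2 P (lmean t i).
Proof. by apply: L2Z; apply: L2_sum => k _; exact: l_p. Qed.

Let l_grad i : L2 P (grad_w t i).
Proof. by apply: L2_gu => //; apply: mgu; [case: l_u|case: (l_v i)]. Qed.

Let l_gradv i : L2 P (gradv_w t i).
Proof. by apply: L2_gv => //; apply: mgv; [case: l_u|case: (l_v i)]. Qed.

Let l_lag i : L2 P (lag_w t i). Proof. exact: L2B. Qed.

Let l_stale i : L2 P (stale_w t i).
Proof. by apply: L2B => //; apply: L2_gu => //; apply: mgu; [case: (l_last i)|case: (l_v i)]. Qed.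

Let l_dv i : L2 P (dv_w t i).
Proof. by apply: L2Z; apply: L2Z; apply: L2_sum => k _; exact: l_H. Qed.

Let l_fresh i : L2 P (fresh_w t i).
Proof.
have l_v' : L2 P (fun w => st_v (st t w) i + dv_w t i w) by exact: L2D.
by apply: L2B => //; apply: L2_gu => //; apply: mgu; [case: l_u|case: l_v'].
Qed.

Let l_next_u A : L2 P (fun w => st_u (nst t A w)).
Proof.
apply: L2D; apply: L2Z => //.
by apply: L2_sum => i _; have [] := l_loc i (leqnn K).
Qed.

Let l_du A : L2 P (du_w t A). Proof. exact: L2B. Qed.

Let tu (f : Omega -> 'rV[R]_du) : Eu := toL2 P f.
Let tv (f : Omega -> 'rV[R]_dv) : Ev := toL2 P f.

Let uk i k : Eu := tu (fun w => (loc t i k w).1).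
Let vk i k : Ev := tv (fun w => (loc t i k w).2).
Let p i k : Eu := tu (fun w => gu i (loc t i k w).1 (loc t i k w).2).
Let q i k : Ev := tv (fun w => gv i (loc t i k w).1 (loc t i k w).2).
Let G i k : Eu := tu (Gu t i k).
Let H i k : Ev := tv (Gv t i k).
Let g i : Eu := tu (grad_w t i).
Let b i : Ev := tv (gradv_w t i).
Let c i : Eu := tu (fun w => st_ci (st t w) i).
Let al i : Eu := tu (meanc t i).
Let z i : Eu := tu (lag_w t i).
Let y i : Eu := tu (stale_w t i).
Let y' i : Eu := tu (fresh_w t i).

Let KR : (K%:R : R) != 0. Proof. by rewrite pnatr_eq0 -lt0n. Qed.

Let avg_c : n%:R^-1 *: \sum_i c i = tu (fun w => st_c (st t w)).
Proof.
rewrite /c /tu -toL2_sum // -toL2Z; last exact: L2_sum.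
by congr (toL2 P _); apply/funext => w; rewrite [RHS]traj_c.
Qed.

Let step_u i k : (k < K)%N ->
  uk i k.+1 = uk i k - gamma_u *: (G i k + (n%:R^-1 *: \sum_i c i - c i)).
Proof.
move=> hk; rewrite avg_c; apply: L2v_ext => w.
have [l1 _] := l_loc i hk; have [l2 _] := l_loc i (ltnW hk).
rewrite !L2vE !toL2K //; last exact: l_G.
by rewrite [LHS]local_uS -/(Gu t i k w) -[in LHS]addrA (addrC (- _) (st_c _)).
Qed.

Let step_v i k : (k < K)%N -> vk i k.+1 = vk i k - gamma_v *: H i k.
Proof.
move=> hk; apply: L2v_ext => w.
have [_ l1] := l_loc i hk; have [_ l2] := l_loc i (ltnW hk).
rewrite !L2vE !toL2K //; last exact: l_H.
exact: local_vS.
Qed.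

Let lipk_u i k : (k < K)%N -> nsq (p i k - g i) <=
  2 * L ^+ 2 * (nsq (uk i k - uk i 0%N) + nsq (vk i k - vk i 0%N)).
Proof.
move=> hk; rewrite mulrDr; apply: nsq_le2 => w.
have [l1 l2] := l_loc i (ltnW hk); have [l3 l4] := l_loc i (leq0n K).
rewrite !L2vE !toL2K //; last exact: l_p.
exact: (sqn_lip (ltW L0) (lip_uu i) (lip_uv i)).
Qed.

Let lipk_v i k : (k < K)%N -> nsq (q i k - b i) <=
  2 * L ^+ 2 * (nsq (uk i k - uk i 0%N) + nsq (vk i k - vk i 0%N)).
Proof.
move=> hk; rewrite mulrDr; apply: nsq_le2 => w.
have [l1 l2] := l_loc i (ltnW hk); have [l3 l4] := l_loc i (leq0n K).
rewrite !L2vE !toL2K //; last exact: l_q.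
exact: (sqn_lip (ltW L0) (lip_vu i) (lip_vv i)).
Qed.

Let stale_le i : nsq (g i - al i) <= 2 * L ^+ 2 * nsq (z i) + 2 * nsq (y i).
Proof.
apply: nsq_le2 => w; rewrite !L2vE !toL2K // /stale_w.
have -> : grad_w t i w - meanc t i w = (grad_w t i w
    - gu i (lastu t i w) (st_v (st t w) i))
   + (gu i (lastu t i w) (st_v (st t w) i) - meanc t i w) by rewrite addrA subrK.
apply: le_trans (sqnD_le _ _) _; rewrite lerD2r -mulrA ler_wpM2l //.
exact: (sqn_lip_u (ltW L0) (lip_uu i)).
Qed.

Let dvE i : round_dv K gam H i = tv (dv_w t i).
Proof.
rewrite /round_dv /H /tv -toL2_sum; last by move=> k _; exact: l_H.
by rewrite -!toL2Z //; [apply: L2Z|]; apply: L2_sum => k _; exact: l_H.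
Qed.

Let paE i : K%:R^-1 *: \sum_(k < K) p i k = tu (lmean t i).
Proof.
rewrite /p /tu -toL2_sum; last by move=> k _; exact: l_p.
by rewrite -toL2Z //; apply: L2_sum => k _; exact: l_p.
Qed.

Let fresh_le i : nsq (y' i) <= 2 * L ^+ 2 * nsq (round_dv K gam H i)
  + 2 * nsq (g i - K%:R^-1 *: \sum_(k < K) p i k).
Proof.
rewrite dvE paE; apply: nsq_le2 => w; rewrite !L2vE !toL2K // /fresh_w.
set gn := gu i _ _; have -> : gn - lmean t i w =
  (gn - grad_w t i w) + (grad_w t i w - lmean t i w) by rewrite addrA subrK.
apply: le_trans (sqnD_le _ _) _; rewrite lerD2r -mulrA ler_wpM2l //.
apply: le_trans (sqn_lip_v (ltW L0) (lip_uv i) _ _ _) _.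
by rewrite (addrC (st_v _ _)) addrK.
Qed.

Let GpE i k : (k < K)%N -> G i k - p i k = tu (gu_noise t i k).
Proof. by move=> hk; rewrite /G /p /tu -toL2B //; [exact: l_G|exact: l_p]. Qed.

Let HqE i k : (k < K)%N -> H i k - q i k = tv (gv_noise t i k).
Proof. by move=> hk; rewrite /H /q /tv -toL2B //; [exact: l_H|exact: l_q]. Qed.

Let var_u i k : (k < K)%N -> nsq (G i k - p i k) <= sigma_u ^+ 2.
Proof. by move=> hk; rewrite GpE //; exact: nsq_gu_noise. Qed.

Let var_v i k : (k < K)%N -> nsq (H i k - q i k) <= sigma_v ^+ 2.
Proof. by move=> hk; rewrite HqE //; exact: nsq_gv_noise. Qed.

(** The inequality l < k is strict, unlike for the iterates: noise [l] uses sample [l] itself. *)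
Let m_noise_u i k (hk : (k < K)%N) j l : (l < K)%N -> (i != j) || (l < k)%N ->
  @mvec _ _ (othersType E (sample_index i (ht : (t.+1 < T.+1)%N) hk)) _ (gu_noise t j l).
Proof.
move=> hl ijl.
have ijl' : (i != j) || (l <= k)%N by case/orP: ijl => [->//|/ltnW ->]; rewrite orbT.
have [m1 m2] := noise_local (ht : (t.+1 < T.+1)%N) hk (ltnW hl) ijl'.
apply: mvecB; last exact: mgu.
apply: mvec_oracle => //; apply: (sample_others (hs := (ht : (t.+1 < T.+1)%N)) (hk := hl)).
apply: sample_index_neq; rewrite eqxx /=; case/orP: ijl => [ij|lk].
  by rewrite eq_sym ij.
by rewrite (ltn_eqF lk) orbT.
Qed.

Let m_noise_v i k (hk : (k < K)%N) j l : (l < K)%N -> (i != j) || (l < k)%N ->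
  @mvec _ _ (othersType E (sample_index i (ht : (t.+1 < T.+1)%N) hk)) _ (gv_noise t j l).
Proof.
move=> hl ijl.
have ijl' : (i != j) || (l <= k)%N by case/orP: ijl => [->//|/ltnW ->]; rewrite orbT.
have [m1 m2] := noise_local (ht : (t.+1 < T.+1)%N) hk (ltnW hl) ijl'.
apply: mvecB; last exact: mgv.
apply: mvec_oracle => //; apply: (sample_others (hs := (ht : (t.+1 < T.+1)%N)) (hk := hl)).
apply: sample_index_neq; rewrite eqxx /=; case/orP: ijl => [ij|lk].
  by rewrite eq_sym ij.
by rewrite (ltn_eqF lk) orbT.
Qed.

Let ip_noise_u i k (hk : (k < K)%N) (Z : Omega -> 'rV[R]_du) :
  @mvec _ _ (othersType E (sample_index i (ht : (t.+1 < T.+1)%N) hk)) _ Z -> L2 P Z ->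
  ip (tu Z) (tu (gu_noise t i k)) = 0.
Proof. exact: gu_noise_orthogonal. Qed.

Let ip_noise_v i k (hk : (k < K)%N) (Z : Omega -> 'rV[R]_dv) :
  @mvec _ _ (othersType E (sample_index i (ht : (t.+1 < T.+1)%N) hk)) _ Z -> L2 P Z ->
  ip (tv Z) (tv (gv_noise t i k)) = 0.
Proof. exact: gv_noise_orthogonal. Qed.

(** Within one client the later sample is the fresh one and the earlier noise is frozen; for two
    clients either sample will do. *)
Let orth_u i k j l : (k < K)%N -> (l < K)%N -> (i, k) != (j, l) ->
  ip (G i k - p i k) (G j l - p j l) = 0.
Proof.
move=> hk hl; rewrite !GpE // => ikjl.
have [ij|ij] := eqVneq i j; last first.
  rewrite ipC; apply: (ip_noise_u (i := i) (hk := hk)); last exact: L2_gu_noise.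
  by apply: m_noise_u => //; rewrite ij.
move: ikjl; rewrite xpair_eqE ij eqxx andTb neq_ltn => /orP[kl|lk].
  apply: (ip_noise_u (i := j) (hk := hl)); last exact: L2_gu_noise.
  by apply: m_noise_u => //; rewrite kl orbT.
rewrite ipC; apply: (ip_noise_u (i := j) (hk := hk)); last exact: L2_gu_noise.
by apply: m_noise_u => //; rewrite lk orbT.
Qed.

Let orth_v i k l : (k < K)%N -> (l < K)%N -> k != l ->
  ip (H i k - q i k) (H i l - q i l) = 0.
Proof.
move=> hk hl; rewrite !HqE // neq_ltn => /orP[kl|lk].
  apply: (ip_noise_v (i := i) (hk := hl)); last exact: L2_gv_noise.
  by apply: m_noise_v => //; rewrite kl orbT.
rewrite ipC; apply: (ip_noise_v (i := i) (hk := hk)); last exact: L2_gv_noise.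
by apply: m_noise_v => //; rewrite lk orbT.
Qed.

Let avgE (f : 'I_n -> Omega -> 'rV[R]_du) : (forall i, L2 P (f i)) ->
  n%:R^-1 *: \sum_i tu (f i) = tu (fun w => n%:R^-1 *: \sum_i f i w).
Proof. by move=> lf; rewrite /tu -toL2_sum // -toL2Z //; exact: L2_sum. Qed.

Let orth_g i k : (k < K)%N -> ip (n%:R^-1 *: \sum_i g i) (G i k - p i k) = 0.
Proof.
move=> hk; rewrite GpE // avgE //; apply: (ip_noise_u (i := i) (hk := hk)).
  have [m1 m2 _ _] := noise_traj i (ht : (t.+1 < T.+1)%N) hk.
  by apply: mvecZ; apply: mvec_sum => j _; exact: mgu.
by apply: L2Z; exact: L2_sum.
Qed.

Let orth_z i k : (k < K)%N -> ip (n%:R^-1 *: \sum_i z i) (G i k - p i k) = 0.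
Proof.
move=> hk; rewrite GpE // avgE //; apply: (ip_noise_u (i := i) (hk := hk)).
  have [m1 m2 _ _] := noise_traj i (ht : (t.+1 < T.+1)%N) hk.
  apply: mvecZ; apply: mvec_sum => j _; apply: mvecB => //.
  by have [] := noise_last i (ht : (t.+1 < T.+1)%N) hk j.
by apply: L2Z; exact: L2_sum.
Qed.

Let orth_b i k : (k < K)%N -> ip (b i) (H i k - q i k) = 0.
Proof.
move=> hk; rewrite HqE //; apply: (ip_noise_v (i := i) (hk := hk)) => //.
have [m1 m2 _ _] := noise_traj i (ht : (t.+1 < T.+1)%N) hk.
exact: mgv.
Qed.

Let duE (A : {set 'I_n}) : #|A| = m -> round_du m K gam G c A = tu (du_w t A).
Proof.
move=> Am; rewrite /round_du avg_c.
have lS i : L2 P (fun w => \sum_(k < K) Gu t i k w).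
  by apply: L2_sum => k _; exact: l_G.
have lT i : L2 P (fun w => K%:R^-1 *: (\sum_(k < K) Gu t i k w)
    + (st_c (st t w) - st_ci (st t w) i)).
  by apply: L2D; [exact: L2Z|exact: L2B].
transitivity (tu (fun w => - (gam * K%:R / m%:R) *: \sum_(i in A)
  (K%:R^-1 *: (\sum_(k < K) Gu t i k w) + (st_c (st t w) - st_ci (st t w) i)))).
  rewrite /tu toL2Z; last by apply: L2_sum => i _.
  rewrite toL2_sum //; congr (_ *: _); apply: eq_bigr => i _.
  rewrite toL2D //; [|exact: L2Z|exact: L2B].
  rewrite toL2Z // toL2B // toL2_sum //; by move=> k _; exact: l_G.
rewrite -gam_u (mulrC gamma_u); congr (toL2 P _); apply/funext => w.
by rewrite /du_w [RHS]next_u // gt_eqF.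
Qed.

Let Ys := othersType E (set_index ht).

Let m_st : @mvec_state _ n du dv _ Ys (st t).
Proof.
apply: past_traj => //; first exact: ltnW.
move=> s hs lt_st; apply/eqP => -[est].
by rewrite est ltnn in lt_st.
Qed.

Let m_last i : @mvec _ _ Ys _ (lastu t i) /\ @mvec _ _ Ys _ (meanc t i).
Proof.
apply: past_last => //; first exact: ltnW.
move=> s hs lt_st; apply/eqP => -[est].
by rewrite est ltnn in lt_st.
Qed.

Let m_x i l (hl : (l < K)%N) : measurable_fun [set: Ys] (xi t.+1 i l).
Proof. by apply: (sample_others (hs := (ht : (t.+1 < T.+1)%N)) (hk := hl)). Qed.

(** Local paths are defined for every client, drawn or not, so those of round [t] do not depend on
    [S t]. *)
Let m_loc i k : (k <= K)%N ->
  @mvec _ _ Ys _ (fun w => (loc t i k w).1) /\ @mvec _ _ Ys _ (fun w => (loc t i k w).2).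
Proof.
move=> hk; apply: (@mvec_local _ _ _ _ _ _ F m K _ _ _ _ u0 v0 hFmeas_u hFmeas_v _ Ys x S).
  exact: m_st.
by move=> l lk; apply: m_x; exact: leq_trans hk.
Qed.

Let m_next A : @mvec_state _ n du dv _ Ys (nst t A).
Proof.
exact: (@mvec_next _ _ _ _ _ _ F m K _ _ _ _ u0 v0 hFmeas_u hFmeas_v _ Ys x S).
Qed.

Let m_G i k : (k < K)%N -> @mvec _ _ Ys _ (Gu t i k).
Proof.
by move=> hk; have [m1 m2] := m_loc i (ltnW hk); apply: mvec_oracle => //; exact: m_x.
Qed.

Let m_H i k : (k < K)%N -> @mvec _ _ Ys _ (Gv t i k).
Proof.
by move=> hk; have [m1 m2] := m_loc i (ltnW hk); apply: mvec_oracle => //; exact: m_x.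
Qed.

Let m_lmean i : @mvec _ _ Ys _ (lmean t i).
Proof.
apply: mvecZ; apply: mvec_sum => k _; apply: mgu;
by have [] := m_loc i (ltnW (ltn_ord k)).
Qed.

Let m_dv i : @mvec _ _ Ys _ (dv_w t i).
Proof. by apply: mvecZ; apply: mvecZ; apply: mvec_sum => k _; exact: m_H. Qed.

Let m_grad i : @mvec _ _ Ys _ (grad_w t i).
Proof. by have [m1 m2 _ _] := m_st; exact: mgu. Qed.

Let m_gradv i : @mvec _ _ Ys _ (gradv_w t i).
Proof. by have [m1 m2 _ _] := m_st; exact: mgv. Qed.

Let m_lag i : @mvec _ _ Ys _ (lag_w t i).
Proof. by have [m1 _ _ _] := m_st; have [m2 _] := m_last i; exact: mvecB. Qed.

Let m_stale i : @mvec _ _ Ys _ (stale_w t i).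
Proof.
have [_ m1 _ _] := m_st; have [m2 m3] := m_last i.
by apply: mvecB => //; exact: mgu.
Qed.

Let m_fresh i : @mvec _ _ Ys _ (fresh_w t i).
Proof.
have [m1 m2 _ _] := m_st; apply: mvecB => //; apply: mgu => //.
exact: mvecD.
Qed.

Let m_du A : @mvec _ _ Ys _ (du_w t A).
Proof. by have [m1 _ _ _] := m_st; have [m2 _ _ _] := m_next A; exact: mvecB. Qed.

Let sel_u (Z Z' : {set 'I_n} -> Omega -> 'rV[R]_du) :
  (forall A, L2 P (Z A)) -> (forall A, L2 P (Z' A)) ->
  (forall A, @mvec _ _ Ys _ (Z A)) -> (forall A, @mvec _ _ Ys _ (Z' A)) ->
  ip (tu (fun w => Z (S t w) w)) (tu (fun w => Z' (S t w) w))
  = avgS m (fun A => ip (tu (Z A)) (tu (Z' A))).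
Proof.
exact: (ip_select hindep run_setI run_setT run_measurable (hS ht) (set_events ht)).
Qed.

Let sel_v (Z Z' : {set 'I_n} -> Omega -> 'rV[R]_dv) :
  (forall A, L2 P (Z A)) -> (forall A, L2 P (Z' A)) ->
  (forall A, @mvec _ _ Ys _ (Z A)) -> (forall A, @mvec _ _ Ys _ (Z' A)) ->
  ip (tv (fun w => Z (S t w) w)) (tv (fun w => Z' (S t w) w))
  = avgS m (fun A => ip (tv (Z A)) (tv (Z' A))).
Proof.
exact: (ip_select hindep run_setI run_setT run_measurable (hS ht) (set_events ht)).
Qed.

Let dv_A i (A : {set 'I_n}) w := if i \in A then dv_w t i w else 0.

Let l_dv_A i A : L2 P (dv_A i A).
Proof. by rewrite /dv_A; case: (i \in A) => //; exact: L2_cst. Qed.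

Let m_dv_A i A : @mvec _ _ Ys _ (dv_A i A).
Proof. by rewrite /dv_A; case: (i \in A) => //; exact: mvec_cst. Qed.

Let next_vE A i w : st_v (nst t A w) i = st_v (st t w) i + dv_A i A w.
Proof.
apply/eqP; rewrite addrC -subr_eq; apply/eqP.
rewrite [LHS](next_v F m gamma_u gamma_v eta_u eta_v u0 v0 x S hK) /dv_A /dv_w.
by rewrite -gam_v (mulrC gamma_v).
Qed.

Let tv_dv_A i A : tv (dv_A i A) = if i \in A then round_dv K gam H i else 0.
Proof.
rewrite /dv_A; case: (i \in A); first by rewrite dvE.
by apply: L2v_ext => w; rewrite L2vE toL2K //; exact: L2_cst.
Qed.

Let step_vE i : step_v_w t i = (fun w => dv_A i (S t w) w).
Proof. by apply/funext => w; rewrite /step_v_w [st_v (st t.+1 w) i]next_vE addrC addKr. Qed.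

Let lag_A i (A : {set 'I_n}) w :=
  if i \in A then du_w t A w else lag_w t i w + du_w t A w.

Let lag_next i : lag_w t.+1 i = (fun w => lag_A i (S t w) w).
Proof.
apply/funext => w; rewrite /lag_w /lag_A /lastu /= -/lastu.
case: (i \in S t w) => //.
by rewrite /du_w [RHS]addrC addrA subrK.
Qed.

Let stale_A i (A : {set 'I_n}) w := if i \in A then fresh_w t i w else stale_w t i w.

Let stale_next i : stale_w t.+1 i = (fun w => stale_A i (S t w) w).
Proof.
apply/funext => w; rewrite /stale_w /stale_A [st_v (st t.+1 w) i]next_vE /dv_A.
rewrite /lastu /meanc /= -/lastu -/meanc.
by case: (i \in S t w); rewrite ?addr0.
Qed.

Lemma lag2_next : lag2 t.+1 = avgS m (fun A => n%:R^-1 *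
  \sum_i nsq (if i \in A then round_du m K gam G c A else z i + round_du m K gam G c A)).
Proof.
rewrite avgSZ avgS_sum; congr (_ * _); apply: eq_bigr => i _.
rewrite lag_next /nsq (sel_u (Z := lag_A i) (Z' := lag_A i)); try by
  move=> A; rewrite /lag_A; case: (i \in A) => //; first [exact: L2D|exact: mvecD].
apply: eq_avgS_in => A Am; rewrite (duE Am) /lag_A; case: (i \in A) => //.
by rewrite /tu toL2D.
Qed.

Lemma stale2_next : stale2 t.+1 = avgS m (fun A => n%:R^-1 *
  \sum_i nsq (if i \in A then y' i else y i)).
Proof.
rewrite avgSZ avgS_sum; congr (_ * _); apply: eq_bigr => i _.
rewrite stale_next /nsq (sel_u (Z := stale_A i) (Z' := stale_A i)); try by
  move=> A; rewrite /stale_A; case: (i \in A).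
by apply: eq_avgS => A; rewrite /stale_A; case: (i \in A).
Qed.

Let mn : (0 < m <= n)%N := hm.

Lemma decreaseE : decrease t = avgS m (fun A =>
  ip (n%:R^-1 *: \sum_i g i) (round_du m K gam G c A)
  + n%:R^-1 * \sum_(i in A) ip (b i) (round_dv K gam H i)
  + (L * nsq (round_du m K gam G c A)
     + L * (n%:R^-1 * \sum_(i in A) nsq (round_dv K gam H i)))).
Proof.
have l_ag : L2 P (fun w => n%:R^-1 *: \sum_i grad_w t i w) by apply: L2Z; exact: L2_sum.
have m_ag : @mvec _ _ Ys _ (fun w => n%:R^-1 *: \sum_i grad_w t i w).
  by apply: mvecZ; exact: mvec_sum.
rewrite !avgSD !avgSZ; congr (_ + _ + (_ + _)).
- rewrite (sel_u (Z := fun A w => n%:R^-1 *: \sum_i grad_w t i w) (Z' := du_w t)) //.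
  by apply: eq_avgS_in => A Am; rewrite (duE Am) avgE.
- congr (_ * _); transitivity (\sum_i avgS m (fun A => ip (b i) (tv (dv_A i A)))).
    by apply: eq_bigr => i _; rewrite step_vE (sel_v (Z := fun A => gradv_w t i) (Z' := dv_A i)).
  rewrite -avgS_sum; apply: eq_avgS => A; rewrite [RHS]big_mkcond; apply: eq_bigr => i _.
  by rewrite tv_dv_A; case: (i \in A); rewrite ?ip0r.
- congr (_ * _); rewrite /nsq (sel_u (Z := du_w t) (Z' := du_w t)) //.
  by apply: eq_avgS_in => A Am; rewrite (duE Am).
- congr (_ * (_ * _)); transitivity (\sum_i avgS m (fun A => nsq (tv (dv_A i A)))).
    by apply: eq_bigr => i _; rewrite step_vE /nsq (sel_v (Z := dv_A i) (Z' := dv_A i)).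
  rewrite -avgS_sum; apply: eq_avgS => A; rewrite [RHS]big_mkcond; apply: eq_bigr => i _.
  by rewrite tv_dv_A; case: (i \in A); rewrite ?nsq0.
Qed.

Hypothesis hnoise : forall i, noise2 t i <= sigma_u ^+ 2 / K%:R.

Let hc i : nsq (c i - al i) <= sigma_u ^+ 2 / K%:R.
Proof. by apply: le_trans (hnoise i); rewrite /noise2 toL2B. Qed.

(** A drawn client has fresh noise, an absent one keeps its old noise; both obey the same bound,
    which the average over the sets preserves. *)
Lemma noise_next i : noise2 t.+1 i <= sigma_u ^+ 2 / K%:R.
Proof.
pose ctl (A : {set 'I_n}) w := (if i \in A then K%:R^-1 *: \sum_(k < K) Gu t i k w - lmean t i w
  else st_ci (st t w) i - meanc t i w).
have lS : L2 P (fun w => \sum_(k < K) Gu t i k w) by apply: L2_sum => k _; exact: l_G.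
have lctl A : L2 P (ctl A).
  by rewrite /ctl; case: (i \in A); apply: L2B => //; exact: L2Z.
have mctl A : @mvec _ _ Ys _ (ctl A).
  have [_ _ _ mci] := m_st; have [_ mm] := m_last i.
  rewrite /ctl; case: (i \in A); apply: mvecB => //.
  by apply: mvecZ; apply: mvec_sum => k _; exact: m_G.
have e : (fun w => st_ci (st t.+1 w) i - meanc t.+1 i w) = (fun w => ctl (S t w) w).
  apply/funext => w; rewrite /ctl.
  have gu0' : gamma_u != 0 by rewrite gt_eqF.
  rewrite [st_ci (st t.+1 w) i](next_ci F m gamma_v eta_u eta_v u0 v0 x S hK gu0').
  by rewrite /meanc /= -/meanc; case: (i \in S t w).
rewrite /noise2 e /nsq (sel_u (Z := ctl) (Z' := ctl)) // -(avgS_cst mn (sigma_u ^+ 2 / K%:R)).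
apply: le_avgS => A _; rewrite -/(nsq _) /ctl; case: (i \in A); last exact: hnoise.
have -> : tu (fun w => K%:R^-1 *: \sum_(k < K) Gu t i k w - lmean t i w) =
   K%:R^-1 *: \sum_(k < K) G i k - K%:R^-1 *: \sum_(k < K) p i k.
  rewrite paE /tu toL2B //; last exact: L2Z.
  by rewrite toL2Z // toL2_sum // => k _; exact: l_G.
by apply: (round_noise_var (n := n) hK var_u orth_u).
Qed.

Lemma round_bound (A0 : R) :
  A0 = 60 * (gam * K%:R) * (gam * K%:R * L) * n%:R / m%:R ^+ 2 ->
  decrease t + A0 * (L ^+ 2 * lag2 t.+1 + stale2 t.+1)
  <= A0 * (L ^+ 2 * lag2 t + stale2 t) - gam * K%:R / 4 * (grad2 t + gradv2 t)
     + 37 * (gam * K%:R * L) * (gam * K%:R)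
       * (sigma_u ^+ 2 / (m%:R * K%:R) + m%:R * sigma_v ^+ 2 / (n%:R * K%:R)).
Proof.
move=> eA0; rewrite decreaseE lag2_next stale2_next.
have -> : grad2 t = nsq (n%:R^-1 *: \sum_i g i) by rewrite avgE.
exact: (round_progress mn hK L0 gam0 (sqr_ge0 _) (sqr_ge0 _) hgu2 hgv2 step_u step_v
  lipk_u lipk_v stale_le fresh_le hc var_u var_v orth_u orth_v orth_g orth_z orth_b
  small1 small2 small3 eA0).
Qed.

End At.

Let noise_bound t i : (t <= T)%N -> noise2 t i <= sigma_u ^+ 2 / K%:R.
Proof.
elim: t i => [|t IH] i ht; first exact: init_ci_var.
by apply: noise_next => // j; apply: IH; exact: ltnW.
Qed.

Let decrease_w t w :=
  dot (n%:R^-1 *: \sum_i grad_w t i w) (step_u_w t w)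
  + n%:R^-1 * \sum_i dot (gradv_w t i w) (step_v_w t i w)
  + (L * sqn (step_u_w t w) + L * (n%:R^-1 * \sum_i sqn (step_v_w t i w))).

Let nR : (0 : R) < n%:R. Proof. by rewrite ltr0n. Qed.

Lemma fglob_step t w :
  fglob D F (st_u (st t.+1 w)) (st_v (st t.+1 w)) - fglob D F (st_u (st t w)) (st_v (st t w))
  <= decrease_w t w.
Proof.
rewrite /fglob -mulrBr -sumrB.
have h i : floc D F i (st_u (st t.+1 w)) (st_v (st t.+1 w) i)
    - floc D F i (st_u (st t w)) (st_v (st t w) i) <=
   dot (grad_w t i w) (step_u_w t w) + dot (gradv_w t i w) (step_v_w t i w)
   + (L * sqn (step_u_w t w) + L * sqn (step_v_w t i w)).
  have := joint_descent (ltW L0) (@hdiff_u i) (@hdiff_v i) (lip_uu i) (lip_vv i) (lip_vu i)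
    (st_u (st t w)) (st_v (st t w) i) (step_u_w t w) (step_v_w t i w).
  rewrite /step_u_w /step_v_w ![_ + (_ - _)]addrC !subrK -/(step_u_w t w) -/(step_v_w t i w).
  rewrite -/(gu i _ _) -/(gv i _ _) -/(grad_w t i w) -/(gradv_w t i w); lra.
apply: le_trans (_ : n%:R^-1 * \sum_i (dot (grad_w t i w) (step_u_w t w)
    + dot (gradv_w t i w) (step_v_w t i w)
    + (L * sqn (step_u_w t w) + L * sqn (step_v_w t i w))) <= _).
  by rewrite ler_wpM2l ?invr_ge0 ?ler0n // ler_sum.
rewrite /decrease_w !big_split /= -!mulr_sumr sumr_const card_ord -[sqn _ *+ n]mulr_natl.
rewrite dotZl le_eqVlt; apply/orP; left; apply/eqP.
have -> : dot (\sum_i grad_w t i w) (step_u_w t w) = \sum_i dot (grad_w t i w) (step_u_w t w).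
  apply: (big_morph (fun v => dot v (step_u_w t w))) => [? ?|]; [exact: dotDl|exact: dot0l].
by field; rewrite gt_eqF.
Qed.

(** * Total decrease and average stationarity *)

Section Final.
Variable F0 : R.
Hypothesis hF0 : forall u v, fglob D F u0 v0 - F0 <= fglob D F u v.

Let l_stepu t : (t < T)%N -> L2 P (step_u_w t).
Proof.
move=> ht; have [l1 _ _ _ _] := L2_run ht; have [l2 _ _ _ _] := L2_run (ltnW ht).
exact: L2B.
Qed.

Let l_stepv t i : (t < T)%N -> L2 P (step_v_w t i).
Proof.
move=> ht; have [_ l1 _ _ _] := L2_run ht; have [_ l2 _ _ _] := L2_run (ltnW ht).
exact: L2B.
Qed.

Let l_gradT t i : (t < T)%N -> L2 P (grad_w t i).
Proof.
move=> ht; have [l1 l2 _ _ _] := L2_run (ltnW ht).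
by apply: L2_gu => //; apply: mgu; [case: l1|case: (l2 i)].
Qed.

Let l_gradvT t i : (t < T)%N -> L2 P (gradv_w t i).
Proof.
move=> ht; have [l1 l2 _ _ _] := L2_run (ltnW ht).
by apply: L2_gv => //; apply: mgv; [case: l1|case: (l2 i)].
Qed.

Let l_avg t : (t < T)%N -> L2 P (fun w => n%:R^-1 *: \sum_i grad_w t i w).
Proof. by move=> ht; apply: L2Z; apply: L2_sum => i _; exact: l_gradT. Qed.

Let integrable_sumR (f : 'I_n -> Omega -> R) :
  (forall i, P.-integrable setT (fun w => (f i w)%:E)) ->
  P.-integrable setT (fun w => (\sum_i f i w)%:E).
Proof. by move=> jf; under eq_fun do rewrite -sumEFin; exact: integrable_sum. Qed.

Let decrease_integral t : (t < T)%N ->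
  P.-integrable setT (fun w => (decrease_w t w)%:E) /\
  decrease t = (\int[P]_w decrease_w t w)%R.
Proof.
move=> ht.
have i1 := integrable_dot (l_avg ht) (l_stepu ht).
have i2' i := integrable_dot (l_gradvT i ht) (l_stepv i ht).
have i2s := integrable_sumR i2'; have i2 := integrable_scale n%:R^-1 i2s.
have i3' := integrable_dot (l_stepu ht) (l_stepu ht); have i3 := integrable_scale L i3'.
have i4' i := integrable_dot (l_stepv i ht) (l_stepv i ht).
have i4s := integrable_sumR i4'; have i4n := integrable_scale n%:R^-1 i4s.
have i4 := integrable_scale L i4n.
have i12 := integrable_add i1 i2; have i34 := integrable_add i3 i4.
split; first exact: integrable_add.
rewrite /decrease_w /sqn.
rewrite (RintegralD measurableT i12 i34) (RintegralD measurableT i1 i2) (RintegralD measurableT i3 i4).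
rewrite (RintegralZl _ measurableT i2s) (RintegralZl _ measurableT i3').
rewrite (RintegralZl _ measurableT i4n) (RintegralZl _ measurableT i4s).
rewrite (Rintegral_sum _ i2') (Rintegral_sum _ i4').
congr (_ + _ * _ + (_ * _ + _ * (_ * _))).
- by apply: ip_toL2; [exact: l_avg|exact: l_stepu].
- by apply: eq_bigr => i _; apply: ip_toL2; [exact: l_gradvT|exact: l_stepv].
- by apply: ip_toL2; exact: l_stepu.
- by apply: eq_bigr => i _; apply: ip_toL2; exact: l_stepv.
Qed.

Let sum_decrease : - F0 <= \sum_(t < T) decrease t.
Proof.
have -> : \sum_(t < T) decrease t = (\int[P]_w (\sum_(t < T) decrease_w t w))%R.
  rewrite Rintegral_sum => [|t]; last by have [] := decrease_integral (ltn_ord t).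
  by apply: eq_bigr => t _; have [] := decrease_integral (ltn_ord t).
have e : (\int[P]_w (- F0) = - F0)%R.
  by have := expectation_cst P (- F0); rewrite unlock /Rintegral => ->.
have isum : P.-integrable setT (fun w => (\sum_(t < T) decrease_w t w)%:E).
  rewrite (_ : (fun w => _) = fun w => (\sum_(t < T) (decrease_w t w)%:E)%E).
    apply: integrable_sum => // t _.
    by have [] := decrease_integral (ltn_ord t).
  by apply/funext => w; rewrite sumEFin.
rewrite -[leLHS]e; apply: (le_Rintegral measurableT (integrable_cstR P _) isum) => w _.
have tel s : fglob D F (st_u (st s w)) (st_v (st s w)) - fglob D F u0 v0
    <= \sum_(t < s) decrease_w t w.
  elim: s => [|s IH]; first by rewrite big_ord0 subrr.
  rewrite big_ord_recr /=; have := fglob_step s w; lra.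
have := tel T; have := hF0 (st_u (st T w)) (st_v (st T w)); lra.
Qed.

Let lag2_0 : lag2 0 = 0.
Proof.
rewrite /lag2 big1 ?mulr0 // => i _.
have -> : toL2 P (lag_w 0 i) = 0; last exact: nsq0.
apply: L2v_ext => w; rewrite L2vE toL2K; first by rewrite /lag_w /= subrr.
by apply: L2B; exact: L2_cst.
Qed.

Let stale2_0 : stale2 0 = 0.
Proof.
rewrite /stale2 big1 ?mulr0 // => i _.
have -> : toL2 P (stale_w 0 i) = 0; last exact: nsq0.
apply: L2v_ext => w; rewrite L2vE toL2K; first by rewrite /stale_w /= subrr.
by apply: L2B; exact: (L2_cst P (gu i u0 (v0 i))).
Qed.

Let noise_level :=
  sigma_u ^+ 2 / (m%:R * K%:R) + m%:R * sigma_v ^+ 2 / (n%:R * K%:R).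

Let sum_bound : gam * K%:R / 4 * \sum_(t < T) (grad2 t + gradv2 t) <=
  F0 + T%:R * (37 * (gam * K%:R * L) * (gam * K%:R) * noise_level).
Proof.
set c := 37 * _ * _ * _.
pose A0 := 60 * (gam * K%:R) * (gam * K%:R * L) * n%:R / m%:R ^+ 2.
have A00 : 0 <= A0.
  have gK : 0 <= gam * K%:R by rewrite mulr_ge0 // ltW.
  rewrite /A0 divr_ge0 ?sqr_ge0 // mulr_ge0 // mulr_ge0 ?(mulr_ge0 _ (ltW L0)) //.
  by rewrite mulr_ge0.
have ge0_avg (f : 'I_n -> R) : (forall i, 0 <= f i) -> 0 <= n%:R^-1 * \sum_i f i.
  by move=> f0; rewrite mulr_ge0 ?invr_ge0 ?ler0n // sumr_ge0.
have tel := telescope_le (a := gam * K%:R / 4) (g := fun t => grad2 t + gradv2 t)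
  (d := decrease) (y := fun t => A0 * (L ^+ 2 * lag2 t + stale2 t)) (c := c)
  (fun t ht => round_bound ht (fun i => noise_bound i (ltnW ht)) (erefl A0)).
rewrite lag2_0 stale2_0 mulr0 addr0 mulr0 add0r in tel.
apply: le_trans (_ : _ <= F0 + (gam * K%:R / 4 * \sum_(t < T) (grad2 t + gradv2 t)
  + \sum_(t < T) decrease t + A0 * (L ^+ 2 * lag2 T + stale2 T))) _; last by rewrite lerD2l.
have y0 : 0 <= A0 * (L ^+ 2 * lag2 T + stale2 T).
  rewrite mulr_ge0 // addr_ge0 //; last by apply: ge0_avg => i; exact: nsq_ge0.
  by rewrite mulr_ge0 ?sqr_ge0 //; apply: ge0_avg => i; exact: nsq_ge0.
rewrite addrA addrCA -addrA lerDl addr_ge0 // -lerBlDl sub0r.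
exact: sum_decrease.
Qed.

Let E_grad2 t : (t < T)%N -> 'E_P[fun w =>
    (enorm (gradient (fun u => fglob D F u (st_v (st t w))) (st_u (st t w))) ^+ 2)%R]%E
  = (grad2 t)%:E.
Proof.
move=> ht; rewrite unlock.
transitivity (\int[P]_w (sqn (n%:R^-1 *: \sum_i grad_w t i w))%:E)%E.
  by apply: eq_integral => w _; rewrite enorm_sqn gradient_fglob.
have l := l_avg ht; rewrite /grad2 [nsq _](ip_toL2 l l) /Rintegral fineK //.
exact: integrable_fin_num (integrable_dot l l).
Qed.

Let E_gradv t i : (t < T)%N -> 'E_P[fun w =>
    (enorm (gradient (floc D F i (st_u (st t w))) (st_v (st t w) i)) ^+ 2)%R]%E
  = (nsq (toL2 P (gradv_w t i) : Ev))%:E.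
Proof.
move=> ht; rewrite unlock.
transitivity (\int[P]_w (sqn (gradv_w t i w))%:E)%E.
  by apply: eq_integral => w _; rewrite enorm_sqn.
have l := l_gradvT i ht; rewrite [nsq _](ip_toL2 l l) /Rintegral fineK //.
exact: integrable_fin_num (integrable_dot l l).
Qed.

Lemma run_stationarity : (0 < T)%N ->
  ((T%:R^-1)%:E * \sum_(t < T)
     ('E_P[fun w => (enorm (gradient (fun u => fglob D F u (st_v (st t w))) (st_u (st t w))) ^+ 2)%R]
      + (m%:R / n%:R ^+ 2)%:E * \sum_(i < n) 'E_P[fun w =>
          (enorm (gradient (floc D F i (st_u (st t w))) (st_v (st t w) i)) ^+ 2)%R])
   <= (4 / (gam * K%:R * T%:R) * F0 + 148 * (gam * K%:R * L) * noise_level)%:E)%E.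
Proof.
move=> T0.
have -> : (\sum_(t < T)
     ('E_P[fun w => (enorm (gradient (fun u => fglob D F u (st_v (st t w))) (st_u (st t w))) ^+ 2)%R]
      + (m%:R / n%:R ^+ 2)%:E * \sum_(i < n) 'E_P[fun w =>
          (enorm (gradient (floc D F i (st_u (st t w))) (st_v (st t w) i)) ^+ 2)%R])
   = (\sum_(t < T) (grad2 t + gradv2 t))%R%:E)%E.
  rewrite -sumEFin; apply: eq_bigr => t _; rewrite E_grad2 // EFinD; congr (_ + _)%E.
  rewrite /gradv2 [RHS]EFinM -sumEFin; congr (_ * _)%E.
  by apply: eq_bigr => i _; exact: E_gradv.
have TR : (0 : R) < T%:R by rewrite ltr0n.
have KR : (0 : R) < K%:R by rewrite ltr0n.
rewrite -EFinM lee_fin ler_pdivrMl //.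
have gK : 0 < gam * K%:R / 4 by rewrite divr_gt0 // mulr_gt0.
(* Undoing the factor gamma K / 4 turns 37 into 148. *)
rewrite -(ler_pM2l gK); apply: le_trans sum_bound _.
by rewrite le_eqVlt; apply/orP; left; apply/eqP; field; rewrite !gt_eqF.
Qed.

End Final.

End Run.

(** * Step size *)

Section StepSize.
Context {R : realType} {n m K : nat}.
Hypothesis hm : (1 <= m <= n)%N.
Variables (L gam : R).
Hypotheses (L0 : 0 < L) (gam0 : 0 < gam).

Let M : R := Num.max (n%:R `^ (2 / 3) / m%:R) 1.
Let m0 : (0 : R) < m%:R. Proof. by rewrite ltr0n; case/andP: hm. Qed.

Let cube : n%:R ^+ 2 / m%:R ^+ 3 <= M ^+ 3.
Proof.
have p0 : 0 <= n%:R `^ (2 / 3) :> R by exact: powR_ge0.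
have -> : n%:R ^+ 2 = (n%:R `^ (2 / 3)) ^+ 3 :> R.
  by rewrite -(powR_mulrn 3) // -powRrM -(powR_mulrn 2) ?ler0n //; congr (_ `^ _); field.
rewrite -expr_div_n lerXn2r ?nnegrE ?divr_ge0 ?(ltW m0) //.
  by rewrite /M le_max ler01 orbT.
by rewrite /M le_max lexx.
Qed.

Let M1 : 1 <= M. Proof. by rewrite /M le_max lexx orbT. Qed.
Let M0 : 0 < M. Proof. exact: lt_le_trans M1. Qed.

(** Follows from [cube]: n (n/m^2)^3 = (n^2/m^3)^2 <= M^6, where the factor n >= 1 may be
    dropped. *)
Let square : n%:R / m%:R ^+ 2 <= M ^+ 2.
Proof.
have [le1|gt1] := leP (n%:R / m%:R ^+ 2 : R) 1.
  by apply: le_trans le1 _; rewrite exprn_ege1.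
have q0 : 0 <= n%:R / m%:R ^+ 2 :> R by apply: ltW; exact: lt_trans gt1.
rewrite -(@ler_pXn2r _ 3) ?nnegrE ?sqr_ge0 // -[leRHS]exprM mulnC exprM.
have c0 : 0 <= n%:R ^+ 2 / m%:R ^+ 3 :> R by rewrite divr_ge0 ?exprn_ge0 // ltW.
apply: le_trans (_ : (n%:R ^+ 2 / m%:R ^+ 3) ^+ 2 <= _).
  have -> : (n%:R ^+ 2 / m%:R ^+ 3) ^+ 2 = n%:R * (n%:R / m%:R ^+ 2) ^+ 3 :> R.
    by field; rewrite gt_eqF.
  by rewrite ler_peMl ?exprn_ge0 // ler1n; case/andP: hm => a; exact: leq_trans.
by rewrite lerXn2r ?nnegrE // exprn_ge0 // ltW.
Qed.

Hypothesis small : 72 * M * (gam * K%:R * L) <= 1.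

Let a := gam * K%:R * L.
Let a0 : 0 <= a.
Proof. by rewrite /a mulr_ge0 ?mulr_ge0 // ltW. Qed.

Lemma step_size_pow k (q : R) : q <= M ^+ k -> a ^+ k * q <= (72 ^+ k)^-1.
Proof.
move=> hq; rewrite -[leRHS]mul1r ler_pdivlMr ?exprn_gt0 //.
apply: le_trans (_ : (72 * M * a) ^+ k <= _).
  rewrite (exprMn k (72 * M) a) (exprMn k 72 M) [leRHS]mulrC mulrA mulrAC.
  by rewrite ler_wpM2l // mulr_ge0 ?exprn_ge0.
by rewrite exprn_ile1 // !mulr_ge0 // ltW.
Qed.
Lemma step_size_small : [/\ a <= 1 / 72, a ^+ 2 * n%:R / m%:R ^+ 2 <= 1 / 72 ^+ 2
  & a ^+ 3 * n%:R ^+ 2 / m%:R ^+ 3 <= 1 / 72 ^+ 3].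
Proof.
rewrite !div1r; split.
- by have := @step_size_pow 1 1; rewrite !expr1 mulr1; apply.
- by rewrite -[leLHS]mulrA; exact: step_size_pow.
- by rewrite -[leLHS]mulrA; exact: step_size_pow.
Qed.

End StepSize.

(* [B = sqrt (37 L K T V / F0)] balances the two terms: [B ^ 2 * F0 / (K * T) = 37 * L * V] *)
Lemma stationarity_rate (R : realType) (L K T F0 M V gam : R) :
  0 < L -> 0 < K -> 0 < T -> 0 < F0 -> 0 < M -> 0 <= V ->
  gam = (72 * L * K * M + Num.sqrt (37 * L * K * T / F0 * V))^-1 ->
  4 / (gam * K * T) * F0 + 148 * gam * L * V
  <= 8 * Num.sqrt (37 * L * F0 / (K * T) * V) + 288 * L * F0 / T * M.
Proof.
move=> L0 K0 T0 F00 M0 V0.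
set B := Num.sqrt _ => hg.
have B0 : 0 <= B by exact: sqrtr_ge0.
have d0 : 0 < 72 * L * K * M + B by rewrite ltr_pwDl // !mulr_gt0.
have g0 : 0 < gam by rewrite hg invr_gt0.
have gB : gam * B <= 1.
  by rewrite hg mulrC ler_pdivrMr // mul1r lerDr !mulr_ge0 // ltW.
have B2 : B ^+ 2 = 37 * L * K * T / F0 * V.
  by rewrite sqr_sqrtr // mulr_ge0 // divr_ge0 ?(ltW F00) // !mulr_ge0 // ltW.
have sqrtE : Num.sqrt (37 * L * F0 / (K * T) * V) = B * F0 / (K * T).
  have -> : 37 * L * F0 / (K * T) * V = (B * F0 / (K * T)) ^+ 2.
    by rewrite !exprMn B2; field; rewrite !gt_eqF.
  by rewrite sqrtr_sqr ger0_norm // divr_ge0 ?mulr_ge0 // ltW.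
have noise : 148 * gam * L * V <= 4 * (B * F0 / (K * T)).
  have -> : 148 * gam * L * V = 4 * (gam * B) * (B * F0 / (K * T)).
    have -> : 4 * (gam * B) * (B * F0 / (K * T)) = 4 * gam * B ^+ 2 * F0 / (K * T).
      by field; rewrite !gt_eqF.
    by rewrite B2; field; rewrite !gt_eqF.
  by rewrite ler_wpM2r ?divr_ge0 ?mulr_ge0 ?(ltW F00) ?(ltW K0) ?(ltW T0) //; lra.
have descent : 4 / (gam * K * T) * F0 = 288 * L * F0 / T * M + 4 * (B * F0 / (K * T)).
  have -> : 4 / (gam * K * T) * F0 = 4 * gam^-1 / (K * T) * F0.
    by field; rewrite !gt_eqF.
  by rewrite hg invrK; field; rewrite !gt_eqF.
rewrite sqrtE descent; lra.
Qed.

(** * From the hypotheses of the theorem to those of the run *)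

Lemma ereal_inf_gap (R : realType) (U : Type) (g : U -> R) (x0 : U) (F0 : R) :
  F0%:E = ((g x0)%:E - ereal_inf [set (g x)%:E | x in [set: U]])%E ->
  forall x, g x0 - F0 <= g x.
Proof.
move=> + x; have : (ereal_inf [set (g x)%:E | x in [set: U]] <= (g x)%:E)%E.
  by apply: ereal_inf_lbound; exists x.
case: (ereal_inf _) => [r||] //=.
by rewrite lee_fin -EFinB => ? [->]; lra.
Qed.

(** Converts a lower bound on a server step size into an upper bound on the local one; used with q =
    m for u and q = n/m for v. *)
Lemma server_step (R : realType) (a e gam q : R) :
  0 < a -> a * e = gam -> 0 < q -> Num.sqrt q <= e -> a ^+ 2 <= gam ^+ 2 / q.
Proof.
move=> a0 <- q0 he; rewrite ler_pdivlMr // exprMn ler_wpM2l ?sqr_ge0 //.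
by rewrite -[leLHS](sqr_sqrtr (ltW q0)) lerXn2r ?nnegrE ?sqrtr_ge0 ?(le_trans _ he) ?sqrtr_ge0.
Qed.

Theorem corollary4p6 (R : realType) (n m K T du dv : nat)
  (hm : (1 <= m <= n)%N) (hK : (1 <= K)%N) (hT : (1 <= T)%N)
  (* problem data *)
  (dX : measure_display) (X : measurableType dX)
  (D : 'I_n -> probability X R)
  (F : 'rV[R]_du -> 'rV[R]_dv -> X -> R)
  (hFint : forall i u v, (D i).-integrable setT (fun x => (F u v x)%:E))
  (hFdiff_u : forall i u v,
    {ae D i, forall x, differentiable (fun u' => F u' v x) u})
  (hFdiff_v : forall i u v,
    {ae D i, forall x, differentiable (fun v' => F u v' x) v})
  (hFmeas_u : jointly_measurable (grad_u F))
  (hFmeas_v : jointly_measurable (grad_v F))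
  (* smoothness *)
  (L Lu Lv Luv Lvu sigma_u sigma_v : R)
  (hdiff_u : forall i u v, differentiable (fun u' => floc D F i u' v) u)
  (hdiff_v : forall i u v, differentiable (fun v' => floc D F i u v') v)
  (hLu : forall i u u' v,
    enorm (gradient (fun w => floc D F i w v) u
           - gradient (fun w => floc D F i w v) u') <= Lu * enorm (u - u'))
  (hLuv : forall i u v v',
    enorm (gradient (fun w => floc D F i w v) u
           - gradient (fun w => floc D F i w v') u) <= Luv * enorm (v - v'))
  (hLv : forall i u v v',
    enorm (gradient (fun w => floc D F i u w) v
           - gradient (fun w => floc D F i u w) v') <= Lv * enorm (v - v'))
  (hLvu : forall i u u' v,
    enorm (gradient (fun w => floc D F i u w) v
           - gradient (fun w => floc D F i u' w) v) <= Lvu * enorm (u - u'))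
  (hL : L = Num.max (Num.max Lu Lv) (Num.max Luv Lvu)) (hL0 : 0 < L)
  (* stochastic gradients *)
  (hmean_u : forall i u v j, ('E_(D i)[fun x => grad_u F u v x 0%R j]
     = (gradient (fun w => floc D F i w v) u 0%R j)%:E)%E)
  (hmean_v : forall i u v j, ('E_(D i)[fun x => grad_v F u v x 0%R j]
     = (gradient (fun w => floc D F i u w) v 0%R j)%:E)%E)
  (hvar_u : forall i u v, ('E_(D i)[fun x =>
       (enorm (grad_u F u v x - gradient (fun w => floc D F i w v) u) ^+ 2)%R]
     <= (sigma_u ^+ 2)%:E)%E)
  (hvar_v : forall i u v, ('E_(D i)[fun x =>
       (enorm (grad_v F u v x - gradient (fun w => floc D F i u w) v) ^+ 2)%R]
     <= (sigma_v ^+ 2)%:E)%E)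
  (* the samples and the participating clients *)
  (dO : measure_display) (Omega : measurableType dO) (P : probability Omega R)
  (xi : nat -> 'I_n -> nat -> {RV P >-> X}) (S : nat -> Omega -> {set 'I_n})
  (hxi : forall s i k, (s <= T)%N -> (k < K)%N ->
     forall A : set X, measurable A -> distribution P (xi s i k) A = D i A)
  (hS : forall t, (t < T)%N -> uniform_subset P m (S t))
  (hindep : mutually_independent P (@run_events _ _ _ _ _ P n K T xi S))
  (* initial point and step sizes *)
  (u0 : 'rV[R]_du) (v0 : 'I_n -> 'rV[R]_dv) (F0 : R)
  (hF0 : F0%:E = ((fglob D F u0 v0)%:E
     - ereal_inf [set (fglob D F uv.1 uv.2)%:E
                  | uv in [set: 'rV[R]_du * ('I_n -> 'rV[R]_dv)]])%E)
  (hF0pos : 0 < F0)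
  (gamma gamma_u gamma_v eta_u eta_v : R)
  (hgu : 0 < gamma_u) (hgv : 0 < gamma_v) (heu0 : 0 < eta_u) (hev0 : 0 < eta_v)
  (hgamma_u : gamma_u * eta_u = gamma) (hgamma_v : gamma_v * eta_v = gamma)
  (heu : Num.sqrt m%:R <= eta_u) (hev : Num.sqrt (n%:R / m%:R) <= eta_v)
  (hgamma : gamma =
     (72 * L * K%:R * Num.max (n%:R `^ (2 / 3) / m%:R) 1
      + Num.sqrt (37 * L * K%:R * T%:R / F0
                  * (sigma_u ^+ 2 / m%:R + m%:R * sigma_v ^+ 2 / n%:R)))^-1) :
  let st t (w : Omega) := scaffoldP F m K gamma_u gamma_v eta_u eta_v u0 v0
    (fun s i k => xi s i k w) (fun s => S s w) t in
  let Gu t := ('E_P[fun w =>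
    (enorm (gradient (fun u => fglob D F u (st_v (st t w))) (st_u (st t w)))
       ^+ 2)%R])%E in
  let Gv t := ((m%:R / n%:R ^+ 2)%:E * \sum_(i < n) 'E_P[fun w =>
    (enorm (gradient (floc D F i (st_u (st t w))) (st_v (st t w) i))
       ^+ 2)%R])%E in
  ((T%:R^-1)%:E * \sum_(t < T) (Gu t + Gv t)
   <= (8 * Num.sqrt (37 * L * F0 / (K%:R * T%:R)
                     * (sigma_u ^+ 2 / m%:R + sigma_v ^+ 2 * m%:R / n%:R))
       + 288 * L * F0 / T%:R * Num.max 1 (n%:R `^ (2 / 3) / m%:R))%:E)%E.

Proof.
cbv zeta.
have [hm1 hmn] := andP hm.
have mR : (0 : R) < m%:R by rewrite ltr0n.
have nR : (0 : R) < n%:R by rewrite ltr0n (leq_trans hm1).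
have KR : (0 : R) < K%:R by rewrite ltr0n.
have TR : (0 : R) < T%:R by rewrite ltr0n.
have [Lu_le Lv_le Luv_le Lvu_le] : [/\ Lu <= L, Lv <= L, Luv <= L & Lvu <= L].
  by rewrite hL !le_max !lexx !orbT.
have lipL d d' (y : 'rV[R]_d) (x : 'rV[R]_d') l :
    enorm y <= l * enorm x -> l <= L -> enorm y <= L * enorm x.
  by move=> h hl; apply: le_trans h _; rewrite ler_wpM2r // sqrtr_ge0.
set M := Num.max (n%:R `^ (2 / 3) / m%:R) 1 in hgamma.
set V := sigma_u ^+ 2 / m%:R + m%:R * sigma_v ^+ 2 / n%:R in hgamma.
have M0 : 0 < M by rewrite /M lt_max ltr01 orbT.
have V0 : 0 <= V.
  by rewrite addr_ge0 // divr_ge0 ?sqr_ge0 ?ler0n // mulr_ge0 ?sqr_ge0.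
have B0 : 0 <= Num.sqrt (37 * L * K%:R * T%:R / F0 * V) by exact: sqrtr_ge0.
have d0 : 0 < 72 * L * K%:R * M + Num.sqrt (37 * L * K%:R * T%:R / F0 * V).
  by rewrite ltr_pwDl // !mulr_gt0.
have gam0 : 0 < gamma by rewrite hgamma invr_gt0.
(* Drops the square root from the denominator of [gamma]. *)
have small : 72 * M * (gamma * K%:R * L) <= 1.
  have -> : 72 * M * (gamma * K%:R * L) = 72 * L * K%:R * M / gamma^-1.
    by rewrite invrK; ring.
  by rewrite ler_pdivrMr ?invr_gt0 // mul1r hgamma invrK lerDl.
have [s1 s2 s3] := step_size_small hm hL0 gam0 small.
have hu2 : gamma_u ^+ 2 <= gamma ^+ 2 / m%:R by exact: server_step hgamma_u _ heu.
have hv2 : gamma_v ^+ 2 <= gamma ^+ 2 * (m%:R / n%:R).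
  by rewrite -[m%:R / n%:R]invf_div; apply: server_step hgamma_v _ hev; rewrite ?divr_gt0.
have hF u v : fglob D F u0 v0 - F0 <= fglob D F u v.
  have := @ereal_inf_gap _ _ (fun uv => fglob D F uv.1 uv.2) (u0, v0) F0 hF0 (u, v).
  exact.
have := run_stationarity hm hK hFmeas_u hFmeas_v hL0 hdiff_u hdiff_v
  (fun i u u' v => lipL _ _ _ _ _ (hLu i u u' v) Lu_le)
  (fun i u v v' => lipL _ _ _ _ _ (hLuv i u v v') Luv_le)
  (fun i u v v' => lipL _ _ _ _ _ (hLv i u v v') Lv_le)
  (fun i u u' v => lipL _ _ _ _ _ (hLvu i u u' v) Lvu_le)
  hmean_u hmean_v hvar_u hvar_v hxi hS hindep hgu hgamma_u hgamma_v gam0 hu2 hv2 s1 s2 s3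
  hF hT.
move=> h; apply: le_trans h _; rewrite lee_fin.
have := stationarity_rate hL0 KR TR hF0pos M0 V0 hgamma.
rewrite maxC -/M [sigma_v ^+ 2 * _]mulrC -/V.
apply: le_trans; rewrite lerD2l le_eqVlt; apply/orP; left; apply/eqP.
by rewrite /V; field; rewrite !gt_eqF.
Qed.
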